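(* Let $(X,\Omega,\mathcal{H})$ be a holomorphic Hamiltonian system with complex structure $J$, Hamiltonian vector field $X_{\mathcal{H}}=\frac12(X^R_{\mathcal{H}}-iJ(X^R_{\mathcal{H}}))$, and regular value $E$ of $\mathcal{H}$. Then the energy hypersurface $\mathcal{H}^{-1}(E)$ admits a holomorphic foliation. The leaf $L_{x_0}$ of this foliation through a point $x_0\in\mathcal{H}^{-1}(E)$ is given by $$L_{x_0}:=\{y\in X\mid y=\varphi^{X^R_{\mathcal{H}}}_{t_1}\circ\varphi^{J(X^R_{\mathcal{H}})}_{s_1}\circ\varphi^{X^R_{\mathcal{H}}}_{t_2}\circ\varphi^{J(X^R_{\mathcal{H}})}_{s_2}\circ\cdots\circ\varphi^{X^R_{\mathcal{H}}}_{t_n}\circ\varphi^{J(X^R_{\mathcal{H}})}_{s_n}(x_0);\ t_1,\dots,t_n,s_1,\dots,s_n\in\mathbb{R};\ n\in\mathbb{N}\},$$ where $\varphi^{X^R_{\mathcal{H}}}_{t_j}$ and $\varphi^{J(X^R_{\mathcal{H}})}_{s_j}$ are the flows of $X^R_{\mathcal{H}}$ and $J(X^R_{\mathcal{H}})$ for time $t_j$ and $s_j$, respectively. Every holomorphic trajectory of $(X,\Omega,\mathcal{H})$ with energy $E$ is completely contained in one such leaf.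
   Context: A holomorphic Hamiltonian system is a triple $(X,\Omega,\mathcal{H})$ where $X$ is a complex manifold (with complex structure $J$ on $TX$), $\Omega$ is a closed holomorphic $2$-form on $X$ that is non-degenerate on $T^{(1,0)}X$, and $\mathcal{H}:X\to\mathbb{C}$ is holomorphic. Its Hamiltonian vector field $X_{\mathcal{H}}$ is the holomorphic vector field defined by $\iota_{X_{\mathcal{H}}}\Omega=-d\mathcal{H}$; $X^R_{\mathcal{H}}$ is the unique real vector field on $X$ with $X_{\mathcal{H}}=\frac12(X^R_{\mathcal{H}}-iJ(X^R_{\mathcal{H}}))$. A holomorphic trajectory is a holomorphic map $\gamma:U\to X$, $U\subset\mathbb{C}$ open and connected, with $\gamma'(z)=X_{\mathcal{H}}(\gamma(z))$ for all $z\in U$; it has energy $E$ iff $\mathcal{H}\circ\gamma\equiv E$. The flows may be only locally defined; in the description of $L_{x_0}$ all times for which the composition is defined at $x_0$ are allowed. A ($d$-dimensional) holomorphic foliation of a complex manifold $Y$ of dimension $N$ is a decomposition of $Y$ into a disjoint union of path-connected subsets (leaves) such that every point of $Y$ has a holomorphic chart $\phi=(z_1,\dots,z_N):U\to V\subset\mathbb{C}^N$ near it with the property that, for every leaf $L$ with $U\cap L\neq\emptyset$, the connected components of $U\cap L$ are given by $z_{d+1}=c_{d+1},\dots,z_N=c_N$ for constants $c_j\in\mathbb{C}$. *)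

(* Defs.v *)
From HB Require Import structures.
From mathcomp Require Import all_boot all_order all_algebra.
From mathcomp Require Import complex.
From mathcomp Require Import all_classical all_reals topology normedtype derive.

Set Implicit Arguments.
Unset Strict Implicit.
Unset Printing Implicit Defensive.

Import Order.TTheory GRing.Theory Num.Theory.
Import numFieldNormedType.Exports.

Local Open Scope classical_set_scope.
Local Open Scope complex_scope.
Local Open Scope ring_scope.

(* Packing R[i] as a numClosedFieldType makes the library's topology and normed
   module structure available on it, and hence on 'rV[Cx R]_n. *)
Definition Cx (R : realType) : numClosedFieldType := R[i].

Section Manifolds.
Variable R : realType.
Local Notation C := (Cx R).

(* [cinv] is a two-sided inverse of [cmap] between [dom] and [cmap @` dom]
   (see [is_chart]); outside these sets both maps are unconstrained. *)
Record chart (T : Type) (n : nat) := Chart {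
  dom : set T;
  cmap :> T -> 'rV[C]_n;
  cinv : 'rV[C]_n -> T }.

(* Meant for open V: complex differentiability at every point of V. *)
Definition holomorphic_on (n : nat) (W : normedModType C)
    (V : set 'rV[C]_n) (f : 'rV[C]_n -> W) :=
  forall z, V z -> differentiable f z.

Section Charts.
Variables (T : topologicalType) (n : nat).
Implicit Types (c : chart T n) (A : set (chart T n)).

Definition is_chart c :=
  [/\ open (dom c),
      open (c @` dom c),
      forall x, dom c x -> cinv c (c x) = x,
      forall x, dom c x -> {for x, continuous c} &
      forall z, (c @` dom c) z -> {for z, continuous (cinv c)}].

Definition transition c1 c2 : 'rV[C]_n -> 'rV[C]_n := c2 \o cinv c1.

Definition holomorphic_transition c1 c2 :=
  holomorphic_on (c1 @` (dom c1 `&` dom c2)) (transition c1 c2).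

Definition complex_atlas A :=
  [/\ forall c, A c -> is_chart c,
      forall c1 c2, A c1 -> A c2 -> holomorphic_transition c1 c2 &
      forall x, exists2 c, A c & dom c x].

Definition complex_manifold A :=
  [/\ hausdorff_space T, @second_countable T & complex_atlas A].

(* Membership in the maximal atlas generated by A. *)
Definition holomorphic_chart A c :=
  is_chart c /\
  forall c', A c' -> holomorphic_transition c c' /\ holomorphic_transition c' c.

End Charts.

Section Tensors.
Variables (X : topologicalType) (n : nat) (A : set (chart X n)).

Definition holomorphic_function (H : X -> C) :=
  forall c, A c -> holomorphic_on (c @` dom c) (H \o cinv c : _ -> C).

(* Value of dH at x on the (1,0)-vector with components v in the chart c. *)
Definition dfun (H : X -> C) (c : chart X n) (x : X) (v : 'rV[C]_n) : C :=
  'd (H \o cinv c : _ -> C) (c x) v.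

Definition regular_value (H : X -> C) (E : C) :=
  forall x c, H x = E -> A c -> dom c x -> forall a, exists v, dfun H c x v = a.

(* Tensor fields are given by their components in the charts of A together with
   the transformation law. Here V c x is the row of the a_j in
   V = sum_j a_j d/dz_j, where z_1, ..., z_n are the coordinates of c. *)
Definition holomorphic_vfield (V : chart X n -> X -> 'rV[C]_n) :=
  (forall c1 c2 x, A c1 -> A c2 -> dom c1 x -> dom c2 x ->
     V c2 x = 'd (transition c1 c2) (c1 x) (V c1 x)) /\
  (forall c, A c -> holomorphic_on (c @` dom c) (V c \o cinv c)).

(* W c x is the matrix (Omega_x(d/dz_j, d/dz_k))_jk. *)
Definition form_at (W : chart X n -> X -> 'M[C]_n) (c : chart X n) (x : X)
    (v w : 'rV[C]_n) : C := (v *m W c x *m w^T) 0 0.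

Definition holomorphic_2form (W : chart X n -> X -> 'M[C]_n) :=
  [/\ forall c x, A c -> dom c x -> (W c x)^T = - W c x,
      forall c1 c2 x, A c1 -> A c2 -> dom c1 x -> dom c2 x -> forall v w,
        form_at W c1 x v w =
        form_at W c2 x ('d (transition c1 c2) (c1 x) v)
                       ('d (transition c1 c2) (c1 x) w) &
      forall c, A c -> holomorphic_on (c @` dom c) (W c \o cinv c)].

(* The components are holomorphic, so d involves only the d/dz_i. *)
Definition closed_2form (W : chart X n -> X -> 'M[C]_n) :=
  forall c x, A c -> dom c x -> forall i j k : 'I_n,
    let d (l p q : 'I_n) : C :=
      'D_(delta_mx 0 l) (fun z => W c (cinv c z) p q : C) (c x) in
    d i j k + d j k i + d k i j = 0.

Definition nondegenerate_2form (W : chart X n -> X -> 'M[C]_n) :=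
  forall c x, A c -> dom c x ->
    forall v, (forall w, form_at W c x v w = 0) -> v = 0.

Definition holomorphic_hamiltonian_system
    (W : chart X n -> X -> 'M[C]_n) (H : X -> C) :=
  [/\ complex_manifold A, holomorphic_2form W, closed_2form W,
      nondegenerate_2form W & holomorphic_function H].

Definition hamiltonian_vfield (W : chart X n -> X -> 'M[C]_n) (H : X -> C)
    (V : chart X n -> X -> 'rV[C]_n) :=
  holomorphic_vfield V /\
  forall c x, A c -> dom c x -> forall w, form_at W c x (V c x) w = - dfun H c x w.

End Tensors.

Section RealFields.
Variable n : nat.

(* A pair (u, v) stands for the real tangent vector
   sum_j u_j d/dx_j + v_j d/dy_j, where z_j = x_j + i y_j; a pair of complex
   rows stands likewise for an element of the complexified tangent space. *)
Definition to_real (z : 'rV[C]_n) : 'rV[R]_n * 'rV[R]_n :=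
  (\row_j complex.Re (z 0 j), \row_j complex.Im (z 0 j)).

Definition of_real (p : 'rV[R]_n * 'rV[R]_n) : 'rV[C]_n :=
  \row_j (p.1 0 j +i* p.2 0 j).

Definition Jvec (p : 'rV[R]_n * 'rV[R]_n) : 'rV[R]_n * 'rV[R]_n :=
  (- p.2, p.1).

Definition complexify (p : 'rV[R]_n * 'rV[R]_n) : 'rV[C]_n * 'rV[C]_n :=
  (\row_j (p.1 0 j)%:C, \row_j (p.2 0 j)%:C).

(* sum_j a_j d/dz_j, with d/dz_j = 1/2 (d/dx_j - i d/dy_j). *)
Definition vec10 (a : 'rV[C]_n) : 'rV[C]_n * 'rV[C]_n :=
  (2^-1 *: a, - (2^-1 * 'i%C) *: a).

Variables (X : topologicalType) (A : set (chart X n)).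

Definition real_transition (c1 c2 : chart X n) :
    'rV[R]_n * 'rV[R]_n -> 'rV[R]_n * 'rV[R]_n :=
  to_real \o transition c1 c2 \o of_real.

Definition real_vfield (V : chart X n -> X -> 'rV[R]_n * 'rV[R]_n) :=
  forall c1 c2 x, A c1 -> A c2 -> dom c1 x -> dom c2 x ->
    V c2 x = 'd (real_transition c1 c2) (to_real (c1 x)) (V c1 x).

Definition Jfield (V : chart X n -> X -> 'rV[R]_n * 'rV[R]_n) c x :=
  Jvec (V c x).

(* V = 1/2 (VR - i J(VR)) *)
Definition real_field_of (V : chart X n -> X -> 'rV[C]_n)
    (VR : chart X n -> X -> 'rV[R]_n * 'rV[R]_n) :=
  real_vfield VR /\
  forall c x, A c -> dom c x ->
    vec10 (V c x) =
    (2^-1 : C) *: (complexify (VR c x) - ('i%C : C) *: complexify (Jfield VR c x)).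

Definition integral_curve (V : chart X n -> X -> 'rV[R]_n * 'rV[R]_n)
    (I : set R) (g : R -> X) :=
  forall t, I t -> {for t, continuous g} /\
    forall c, A c -> dom c (g t) ->
      is_derive t (1 : R) (to_real \o c \o g) (V c (g t)).

(* y is the value at x of the time-t flow of V, where defined. *)
Definition flow (V : chart X n -> X -> 'rV[R]_n * 'rV[R]_n)
    (t : R) (x y : X) :=
  exists (I : set R) (g : R -> X),
    [/\ open I, is_interval I, I 0 & I t] /\
    [/\ integral_curve V I g, g 0 = x & g t = y].

(* flow_word V W [:: (t_1, s_1); ...; (t_n, s_n)] x y says that
   y = phi^V_{t_1} o phi^W_{s_1} o ... o phi^V_{t_n} o phi^W_{s_n} (x),
   all the flows being defined at the points where they are applied. *)
Fixpoint flow_word (V W : chart X n -> X -> 'rV[R]_n * 'rV[R]_n)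
    (ts : seq (R * R)) (x y : X) : Prop :=
  if ts is (t, s) :: ts' then
    exists x1 x2, [/\ flow_word V W ts' x x1, flow W s x1 x2 & flow V t x2 y]
  else y = x.

Definition hamiltonian_leaf (XR : chart X n -> X -> 'rV[R]_n * 'rV[R]_n)
    (x0 : X) : set X :=
  [set y | exists ts, flow_word XR (Jfield XR) ts x0 y].

Definition holomorphic_trajectory (V : chart X n -> X -> 'rV[C]_n)
    (U : set C) (g : C -> X) :=
  [/\ open U, connected U, U !=set0 &
      forall z, U z -> {for z, continuous g} /\
        forall c, A c -> dom c (g z) ->
          is_derive z (1 : C) (c \o g) (V c (g z))].

End RealFields.

(* Charts induced on S by the charts of X in which S is the slice
   z_(m+1) = ... = z_n = 0, i.e. the structure of m-dimensional complex
   submanifold of S. *)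
Definition slice_atlas (X : topologicalType) (n m : nat) (le_mn : (m <= n)%N)
    (A : set (chart X n)) (S : set X) : set (chart (set_type S) m) :=
  [set k | exists2 c, holomorphic_chart A c &
     [/\ forall x, dom c x ->
           S x <-> (forall j : 'I_n, (m <= j)%N -> c x 0 j = 0),
         dom k = [set y | dom c (set_val y)],
         forall y, dom k y -> forall i,
           k y 0 i = c (set_val y) 0 (widen_ord le_mn i) &
         forall y, dom k y -> cinv k (k y) = y]].

Section Foliations.
Variables (Y : topologicalType) (N : nat).

Definition path_connected (L : set Y) :=
  L !=set0 /\
  forall x y, L x -> L y -> exists f : R -> Y,
    [/\ {within `[0, 1], continuous f}, f 0 = x, f 1 = y &
        forall t, `[0, 1]%classic t -> L (f t)].

Definition plaque (d : nat) (c : chart Y N) (a : 'rV[C]_N) : set Y :=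
  [set y | dom c y /\ forall j : 'I_N, (d <= j)%N -> c y 0 j = a 0 j].

(* F is the set of leaves. *)
Definition holomorphic_foliation (A : set (chart Y N)) (d : nat)
    (F : set (set Y)) :=
  [/\ (d <= N)%N,
      partition F id [set: Y],
      forall L, F L -> path_connected L &
      forall y, exists2 c, holomorphic_chart A c /\ dom c y &
        forall L, F L -> forall x, (dom c `&` L) x ->
          exists a, connected_component (dom c `&` L) x = plaque d c a].

End Foliations.

End Manifolds.

Arguments slice_atlas {R X n m} le_mn A S _.

(* Main.v *)
(* Around a point of H^-1(E) both dH and X_H are nonzero, and dH(X_H) = 0. The
   holomorphic inverse function theorem, applied first to H completed by linear
   coordinates and then to the holomorphic flow of X_H, gives a chart (flow box)
   in which X_H = d/dz_0 and the last coordinate is H - E. Flow boxes restrict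
   to charts of H^-1(E), and every real flow line of X_H^R or J X_H^R and every
   holomorphic trajectory stays locally in a plaque {z_1, ..., z_(n-1) constant}
   of a flow box; conversely a plaque is swept out by the two real flows. So the
   leaves are the classes of the relation generated by the plaques. As complex
   rational times suffice to reach every plaque met by a leaf, a leaf meets a flow
   box in countably many plaques, and these are its connected components there,
   because a countable connected subset of the line is a point.

   Complex differentiability is only assumed pointwise, so all analysis rests on
   a Cauchy estimate for f', obtained by bounding dyadic Riemann sums of
   (f(z) - f(0)) / z^2 over squares: Goursat's subdivision makes them independent
   of the square in the limit, and no integral is needed. *)

Require Import Defs.
From HB Require Import structures.
From mathcomp Require Import all_boot all_order all_algebra.
From mathcomp Require Import complex.
From mathcomp Require Import all_classical all_reals topology normedtype derive.
From mathcomp Require Import perm landau interval_inference ring lra zify.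
Set Implicit Arguments.
Unset Strict Implicit.
Unset Printing Implicit Defensive.
Import Order.TTheory GRing.Theory Num.Theory.
Import numFieldNormedType.Exports.
Local Open Scope classical_set_scope.
Local Open Scope complex_scope.
Local Open Scope ring_scope.

(** * Moduli and norms with real values *)

Section ModulusAndNorm.
Variable R : realType.
Local Notation C := (Cx R).

(** Cauchy's estimate bounds [f'] by [f] alone. Applied to differences of [f] it yields Lipschitz
    bounds for [f] and [f'], a second-order Taylor bound, and the stability of holomorphy under
    uniform limits. The flow is then the limit of Euler polygons: each polygon is a composition of
    holomorphic maps, hence holomorphic in time and initial point together, and so is the limit. A
    flow is a relation between points, witnessed by some integral curve. Uniqueness of integral
    curves enters locally: in a flow box the difference between a curve with derivative [X_H] and
    the straight line has zero derivative. Local statements become global by subdividing a square or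
    a time interval until each piece is small enough for the statement at one of its points. The
    description of leaves by flow words is awkward to invert or to follow through charts. Statements
    about leaves are therefore proved for an arbitrary transitive relation that holds along plaques,
    and instantiated three times: with the leaf relation, with countable reach, and with paths
    inside a leaf. *)

Definition nm (V : normedZmodType C) (v : V) : R := complex.Re `|v|.

(** The norm of a complex normed space takes its values in [C]; [nm] moves it to [R], where [lra]
    and suprema work, at the price of this coercion. *)
Lemma normE (V : normedZmodType C) (v : V) : `|v| = (nm v)%:C :> C.
Proof. by rewrite /nm; apply/esym/RRe_real/ger0_real. Qed.

Lemma nm_ge0 (V : normedZmodType C) (v : V) : 0 <= nm v.
Proof. by rewrite -ler0c -normE. Qed.

Lemma nm0 (V : normedZmodType C) : nm (0 : V) = 0.
Proof. by rewrite /nm normr0. Qed.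

Lemma nm_eq0 (V : normedZmodType C) (v : V) : nm v = 0 -> v = 0.
Proof. by move=> h; apply/eqP; rewrite -normr_eq0 normE h. Qed.

Lemma nmN (V : normedZmodType C) (v : V) : nm (- v) = nm v.
Proof. by rewrite /nm normrN. Qed.

Lemma nmD (V : normedZmodType C) (v w : V) : nm (v + w) <= nm v + nm w.
Proof. by rewrite -lecR rmorphD /= -!normE ler_normD. Qed.

Lemma nmBC (V : normedZmodType C) (v w : V) : nm (v - w) = nm (w - v).
Proof. by rewrite -nmN opprB. Qed.

Lemma nm_sum (V : normedZmodType C) I (r : seq I) (P : pred I) (F : I -> V) :
  nm (\sum_(i <- r | P i) F i) <= \sum_(i <- r | P i) nm (F i).
Proof.
elim/big_ind2: _ => [|x1 x2 y1 y2 h1 h2|//]; first by rewrite nm0.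
exact: le_trans (nmD _ _) (lerD h1 h2).
Qed.

Lemma nmZ (V : normedModType C) (a : C) (v : V) : nm (a *: v) = nm a * nm v.
Proof.
by apply: complexI; rewrite rmorphM /= -!normE normrZ.
Qed.

Lemma nmM (a b : C) : nm (a * b) = nm a * nm b.
Proof. by apply: complexI; rewrite rmorphM /= -!normE normrM. Qed.

Lemma nm1 : nm (1 : C) = 1.
Proof. by rewrite /nm normr1. Qed.

Lemma nmV (a : C) : nm a^-1 = (nm a)^-1.
Proof. by apply: complexI; rewrite fmorphV /= -!normE normfV. Qed.

Lemma nmR (x : R) : nm (x%:C : C) = `|x|.
Proof. by rewrite /nm normc_def /= expr0n addr0 sqrtr_sqr. Qed.

Lemma nmi : nm ('i%C : C) = 1.
Proof. by rewrite /nm normc_def /= expr0n add0r expr1n sqrtr1. Qed.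

Lemma Re_le_nm (z : C) : `|complex.Re z| <= nm z.
Proof. by rewrite -lecR -normE normc_ge_Re. Qed.

Lemma Im_le_nm (z : C) : `|complex.Im z| <= nm z.
Proof.
have := Re_le_nm (z * 'i%C); rewrite nmM nmi mulr1.
by case: z => a b /=; rewrite mulr0 mulr1 sub0r normrN.
Qed.

Lemma nm_le_ReIm (z : C) : nm z <= `|complex.Re z| + `|complex.Im z|.
Proof.
rewrite {1}(complexE z); apply: le_trans (nmD _ _) _.
by rewrite nmM nmi mul1r !nmR.
Qed.

Lemma nm_entry m n (v : 'M[C]_(m, n)) i j : nm (v i j) <= nm v.
Proof.
rewrite -lecR -!normE.
have h : (`|v i j|%:nng <= \big[Order.max/0%:nng]_ij `|v ij.1 ij.2|%:nng).
  exact: (@le_bigmax _ _ _ 0%:nng (fun ij : 'I_m * 'I_n => `|v ij.1 ij.2|%:nng) (i, j)).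
by rewrite -num_le in h.
Qed.

Lemma nm_le m n (v : 'M[C]_(m, n)) (B : R) : 0 <= B ->
  (forall i j, nm (v i j) <= B) -> nm v <= B.
Proof.
move=> B0 h; have [->|v0] := eqVneq v 0; first by rewrite nm0.
have [i Hi] : exists i, mx_norm v = `|v i.1 i.2|.
  by apply: mx_norm_neq0; move: v0; rewrite -normr_eq0.
by rewrite -lecR -normE [`|v|]Hi normE lecR.
Qed.

(** The factor [n] is the price of the maximum norm: an entry of the product is a sum of [n]
    products. *)
Lemma nm_mulmx m n p (v : 'M[C]_(m, n)) (L : 'M[C]_(n, p)) :
  nm (v *m L) <= n%:R * nm v * nm L.
Proof.
apply: nm_le => [|i j]; first by rewrite !mulr_ge0 ?nm_ge0.
rewrite mxE; apply: le_trans (nm_sum _ _ _) _.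
rewrite -mulrA -[n in n%:R]card_ord -sumr_const mulr_suml.
apply: ler_sum => k _; rewrite mul1r nmM.
by apply: ler_pM; rewrite ?nm_ge0 ?nm_entry.
Qed.

Lemma nm_ball (V : normedModType C) (z w : V) (e : R) :
  ball z e%:C w <-> nm (z - w) < e.
Proof. by rewrite -ball_normE /ball_ /= normE ltcR. Qed.

Lemma nbhs_nm (V : normedModType C) (z : V) (A : set V) :
  nbhs z A <-> exists2 e : R, 0 < e & forall w, nm (w - z) < e -> A w.
Proof.
split=> [/nbhs_ballP[e e0 h]|[e e0 h]].
  have eE : e = (complex.Re e)%:C by apply/esym/RRe_real/ger0_real/ltW.
  exists (complex.Re e); first by rewrite -ltcR -eE.
  by move=> w hw; apply: h; rewrite eE; apply/nm_ball; rewrite nmBC.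
apply/nbhs_ballP; exists e%:C; first by rewrite /= ltcR.
by move=> w /nm_ball; rewrite nmBC; exact: h.
Qed.

Lemma open_nm (V : normedModType C) (A : set V) :
  open A <-> forall z, A z -> exists2 e : R, 0 < e & forall w, nm (w - z) < e -> A w.
Proof.
rewrite openE; split=> h z Az; first exact/nbhs_nm/h.
exact/nbhs_nm/h.
Qed.

Lemma continuous_nm (V W : normedModType C) (f : V -> W) z :
  {for z, continuous f} <-> forall e : R, 0 < e ->
    exists2 d : R, 0 < d & forall w, nm (w - z) < d -> nm (f w - f z) < e.
Proof.
split=> [h e e0|h A /nbhs_nm[e e0 hA]].
  by apply/nbhs_nm; apply: (h [set y | nm (y - f z) < e]); apply/nbhs_nm; exists e.
have [d d0 hd] := h e e0; apply/nbhs_nm; exists d => // w hw.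
exact/hA/hd.
Qed.

End ModulusAndNorm.

(** * Subdivision arguments in place of compactness *)

Section LocalToGlobal.
Variable R : realType.

Lemma nested_intervals (a h : nat -> R) :
  (forall n, a n <= a n.+1) -> (forall n, a n.+1 + h n.+1 <= a n + h n) ->
  (forall n, 0 <= h n) -> exists x, forall n, a n <= x <= a n + h n.
Proof.
move=> ha hb h0.
have am n k : a n <= a (n + k)%N.
  elim: k => [|k IH]; first by rewrite addn0.
  by rewrite addnS; apply: le_trans IH _.
have bm n k : a (n + k)%N + h (n + k)%N <= a n + h n.
  elim: k => [|k IH]; first by rewrite addn0.
  by rewrite addnS; apply: le_trans (hb _) IH.
have ab n k : a n <= a k + h k.
  have [nk|kn] := leqP n k.
    rewrite -(subnKC nk); apply: le_trans (am n (k - n)%N) _.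
    by rewrite lerDl.
  rewrite -(subnKC (ltnW kn)); apply: le_trans _ (bm k (n - k)%N).
  by rewrite lerDl.
pose S := [set a n | n in [set: nat]].
have hS : has_sup S.
  split; first by exists (a 0%N), 0%N.
  by exists (a 0%N + h 0%N) => _ [n _ <-].
exists (sup S) => n; apply/andP; split.
  by apply: ub_le_sup; [case: hS | exists n].
by apply: ge_sup => [|_ [k _ <-]]; [exists (a 0%N), 0%N | exact: ab].
Qed.

(* Cousin's lemma for dyadic squares, given by lower left corner and side. *)
Lemma square_chain (Q : R -> R -> R -> Prop) (x0 y0 h0 : R) : 0 < h0 ->
  (forall x y h, 0 < h -> Q x y (h / 2) -> Q (x + h / 2) y (h / 2) ->
     Q x (y + h / 2) (h / 2) -> Q (x + h / 2) (y + h / 2) (h / 2) -> Q x y h) ->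
  (forall x y, x0 <= x <= x0 + h0 -> y0 <= y <= y0 + h0 ->
     exists2 d, 0 < d & forall x' y' h, 0 < h -> h < d ->
       x' <= x <= x' + h -> y' <= y <= y' + h ->
       x0 <= x' -> x' + h <= x0 + h0 -> y0 <= y' -> y' + h <= y0 + h0 ->
       Q x' y' h) ->
  Q x0 y0 h0.
Proof.
move=> h0p split4 loc; apply: contrapT => nQ.
pose T := (R * R * R)%type.
(* A square where [Q] fails has a quarter where it fails. The premises stand under the existential
   so that [choice] yields a total map to iterate. *)
have step (t : T) : exists t' : T, 0 < t.2 -> ~ Q t.1.1 t.1.2 t.2 ->
    [/\ ~ Q t'.1.1 t'.1.2 t'.2, t'.2 = t.2 / 2,
      t'.1.1 = t.1.1 \/ t'.1.1 = t.1.1 + t.2 / 2 &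
      t'.1.2 = t.1.2 \/ t'.1.2 = t.1.2 + t.2 / 2].
  case: t => [[x y] h] /=; apply: contrapT => H; apply: (H); exists (x, y, h).
  move=> hp /= nq; exfalso; apply: nq; apply: split4 => //.
  - apply: contrapT => q; apply: (H); exists (x, y, h / 2) => _ _ /=.
    by split => //; left.
  - apply: contrapT => q; apply: (H); exists (x + h / 2, y, h / 2) => _ _ /=.
    by split => //; [right|left].
  - apply: contrapT => q; apply: (H); exists (x, y + h / 2, h / 2) => _ _ /=.
    by split => //; [left|right].
  - apply: contrapT => q; apply: (H); exists (x + h / 2, y + h / 2, h / 2) => _ _ /=.
    by split => //; right.
have [F HF] := choice step.
have [s [s0 s_iter]] : exists s : nat -> T, s 0%N = (x0, y0, h0) /\
    forall n, s n.+1 = F (s n) by exists (fun n => iter n F (x0, y0, h0)).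
have sP n : 0 < (s n).2 /\ ~ Q (s n).1.1 (s n).1.2 (s n).2.
  elim: n => [|n [IH1 IH2]]; first by rewrite s0.
  have [h1 h2 _ _] := HF _ IH1 IH2; rewrite s_iter.
  by split => //; rewrite h2 divr_gt0.
have sS n : [/\ (s n.+1).2 = (s n).2 / 2,
      (s n.+1).1.1 = (s n).1.1 \/ (s n.+1).1.1 = (s n).1.1 + (s n).2 / 2 &
      (s n.+1).1.2 = (s n).1.2 \/ (s n.+1).1.2 = (s n).1.2 + (s n).2 / 2].
  by have [h1 h2] := sP n; have [_ ? ? ?] := HF _ h1 h2; rewrite s_iter; split.
have [x hx] : exists x, forall n, (s n).1.1 <= x <= (s n).1.1 + (s n).2.
  by apply: (nested_intervals (h := fun n => (s n).2)) => n;
     have [? _] := sP n; have [? [] ? _] := sS n; cbv beta; lra.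
have [y hy] : exists y, forall n, (s n).1.2 <= y <= (s n).1.2 + (s n).2.
  by apply: (nested_intervals (h := fun n => (s n).2)) => n;
     have [? _] := sP n; have [? _ [] ?] := sS n; cbv beta; lra.
have hx0 := hx 0%N; have hy0 := hy 0%N; rewrite s0 /= in hx0 hy0.
have [d d0 hd] := loc x y hx0 hy0.
have half (a h c e a' : R) : 0 < h -> a' = a \/ a' = a + h / 2 -> c <= a ->
    a + h <= e -> c <= a' /\ a' + h / 2 <= e.
  by clear; move=> ? [] -> ? ?; split; lra.
have inside n : [/\ x0 <= (s n).1.1, (s n).1.1 + (s n).2 <= x0 + h0,
    y0 <= (s n).1.2 & (s n).1.2 + (s n).2 <= y0 + h0].
  elim: n => [|n [b1 b2 b3 b4]]; first by rewrite s0.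
  have [sp _] := sP n; have [-> e1 e2] := sS n.
  by have [? ?] := half _ _ _ _ _ sp e1 b1 b2; have [? ?] := half _ _ _ _ _ sp e2 b3 b4.
(* The sides are [h0 / 2^n]; the weaker rate [h0 / (n+1)] is enough to get below [d]. *)
have small n : (s n).2 * n.+1%:R <= h0.
  elim: n => [|n IH]; first by rewrite mulr1 s0.
  have [-> _ _] := sS n; have [sp _] := sP n.
  apply: le_trans IH; rewrite -mulrA ler_pM2l // ler_pdivrMl //.
  by rewrite -natrM ler_nat; lia.
pose n := Num.truncn (h0 / d).
have nd : h0 / d < n.+1%:R by apply: truncnS_gt.
have [sp nQn] := sP n; have [? ? ? ?] := inside n.
apply: nQn; apply: hd => //.
rewrite ltr_pdivrMr // in nd.
have := le_lt_trans (small n) nd; rewrite mulrC ltr_pM2l //.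
Qed.

(** The square version with the ordinate ignored. It propagates a transitive relation along a path,
    where the local hypothesis is only available for pairs that enclose the given point [s]. *)
Lemma interval_chain (Q : R -> R -> Prop) (a b : R) : a <= b ->
  (forall x, Q x x) ->
  (forall x y z, x <= y -> y <= z -> Q x y -> Q y z -> Q x z) ->
  (forall s, a <= s <= b -> exists2 d, 0 < d & forall x y, a <= x -> y <= b ->
     x <= s <= y -> s - d < x -> y < s + d -> Q x y) ->
  Q a b.
Proof.
rewrite le_eqVlt => /orP[/eqP-> //|ab] _ tr loc.
suff : (fun x y h : R => Q x (x + h)) a 0 (b - a) by rewrite addrC subrK.
apply: (@square_chain (fun x y h : R => Q x (x + h)) a 0 (b - a)) => [|x y h hp q1 q2 _ _|x y hx _].
- by rewrite subr_gt0.
- by apply: (tr _ (x + h / 2)) => //; [lra|lra|move: q2; rewrite -addrA -splitr].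
have hxab : a <= x <= b by lra.
have [d d0 hd] := loc x hxab; exists d => // x' y' h hp hh /andP[h1 h2] _ h3 h4 _ _.
by clear -hd hp hh h1 h2 h3 h4; apply: hd; [lra..|apply/andP; split|lra|lra]; lra.
Qed.

End LocalToGlobal.

(** * Cauchy's estimate without integrals *)

Section Goursat.
Variable R : realType.
Local Notation C := (Cx R).
Implicit Types (u v : C -> C) (x y h : R).

Lemma complexDi x y : x +i* y = x%:C + 'i%C * y%:C :> C.
Proof. exact: (complexE (x +i* y)). Qed.

(* Left Riemann sums with 2^k points of u(z) dz along a horizontal side and of
   u(z) dy along a vertical side of length h starting at x + i y. *)
Fixpoint hsum u (k : nat) x y h : C :=
  if k is k'.+1 then hsum u k' x y (h / 2) + hsum u k' (x + h / 2) y (h / 2)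
  else h%:C * u (x +i* y).

Fixpoint vsum u (k : nat) x y h : C :=
  if k is k'.+1 then vsum u k' x y (h / 2) + vsum u k' x (y + h / 2) (h / 2)
  else h%:C * u (x +i* y).

(** A dyadic sum for the integral of [u(z) dz] over the boundary of a square, counterclockwise; the
    factor ['i] comes from [dz = i dy] on the vertical sides. *)
Definition contour u k x y h : C :=
  hsum u k x y h - hsum u k x (y + h) h
  + 'i%C * (vsum u k (x + h) y h - vsum u k x y h).

(** Additivity is exact at each level: two neighbours sample their common side at the same points,
    so the inner sides cancel. *)
Lemma contourS u k x y h : contour u k.+1 x y h =
  contour u k x y (h / 2) + contour u k (x + h / 2) y (h / 2)
  + contour u k x (y + h / 2) (h / 2) + contour u k (x + h / 2) (y + h / 2) (h / 2).
Proof.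
rewrite /contour /=.
have -> : y + h / 2 + h / 2 = y + h by lra.
have -> : x + h / 2 + h / 2 = x + h by lra.
ring.
Qed.

Lemma hsum_lin u v (a b : C) k x y h :
  hsum (fun z => a * u z + b * v z) k x y h = a * hsum u k x y h + b * hsum v k x y h.
Proof.
elim: k x h => [|k IH] x h /=; first by ring.
by rewrite !IH; ring.
Qed.

Lemma vsum_lin u v (a b : C) k x y h :
  vsum (fun z => a * u z + b * v z) k x y h = a * vsum u k x y h + b * vsum v k x y h.
Proof.
elim: k y h => [|k IH] y h /=; first by ring.
by rewrite !IH; ring.
Qed.

Lemma contour_lin u v (a b : C) k x y h :
  contour (fun z => a * u z + b * v z) k x y h
  = a * contour u k x y h + b * contour v k x y h.
Proof. by rewrite /contour !hsum_lin !vsum_lin; ring. Qed.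

Lemma hsum_le u k x y h M : 0 <= h ->
  (forall t, 0 <= t <= h -> nm (u ((x + t) +i* y)) <= M) ->
  nm (hsum u k x y h) <= h * M.
Proof.
elim: k x h => [|k IH] x h h0 H /=.
  by rewrite nmM nmR ger0_norm // ler_wpM2l // -[x]addr0 H // lexx.
apply: le_trans (nmD _ _) _; have -> : h * M = h / 2 * M + h / 2 * M by lra.
apply: lerD; apply: IH => [|t ht]; [lra|apply: H; lra|lra|].
by rewrite -addrA; apply: H; lra.
Qed.

Lemma vsum_le u k x y h M : 0 <= h ->
  (forall t, 0 <= t <= h -> nm (u (x +i* (y + t))) <= M) ->
  nm (vsum u k x y h) <= h * M.
Proof.
elim: k y h => [|k IH] y h h0 H /=.
  by rewrite nmM nmR ger0_norm // ler_wpM2l // -[y]addr0 H // lexx.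
apply: le_trans (nmD _ _) _; have -> : h * M = h / 2 * M + h / 2 * M by lra.
apply: lerD; apply: IH => [|t ht]; [lra|apply: H; lra|lra|].
by rewrite -addrA; apply: H; lra.
Qed.

Lemma Im_hsum_ge u k x y h c : 0 <= h ->
  (forall t, 0 <= t <= h -> c <= complex.Im (u ((x + t) +i* y))) ->
  h * c <= complex.Im (hsum u k x y h).
Proof.
elim: k x h => [|k IH] x h h0 H /=.
  have := H 0 ltac:(lra); rewrite addr0.
  by case: (u _) => a b /=; rewrite mul0r addr0 => ?; exact: ler_wpM2l.
have H1 : h / 2 * c <= complex.Im (hsum u k x y (h / 2)).
  by apply: IH => [|t ht]; [lra|apply: H; lra].
have H2 : h / 2 * c <= complex.Im (hsum u k (x + h / 2) y (h / 2)).
  by apply: IH => [|t ht]; [lra|rewrite -addrA; apply: H; lra].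
by rewrite raddfD /=; lra.
Qed.

Lemma Im_vsum_ge u k x y h c : 0 <= h ->
  (forall t, 0 <= t <= h -> c <= complex.Im (u (x +i* (y + t)))) ->
  h * c <= complex.Im (vsum u k x y h).
Proof.
elim: k y h => [|k IH] y h h0 H /=.
  have := H 0 ltac:(lra); rewrite addr0.
  by case: (u _) => a b /=; rewrite mul0r addr0 => ?; exact: ler_wpM2l.
have H1 : h / 2 * c <= complex.Im (vsum u k x y (h / 2)).
  by apply: IH => [|t ht]; [lra|apply: H; lra].
have H2 : h / 2 * c <= complex.Im (vsum u k x (y + h / 2) (h / 2)).
  by apply: IH => [|t ht]; [lra|rewrite -addrA; apply: H; lra].
by rewrite raddfD /=; lra.
Qed.

(** Only boundary points are constrained, because the estimate is applied to functions that are
    singular at the centre of the square. *)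
Lemma contour_le u k x y h M : 0 <= h ->
  (forall s t, 0 <= s <= h -> 0 <= t <= h -> [\/ s = 0, s = h, t = 0 | t = h] ->
     nm (u ((x + s) +i* (y + t))) <= M) ->
  nm (contour u k x y h) <= 4 * h * M.
Proof.
move=> h0 H.
have h1 : nm (hsum u k x y h) <= h * M.
  apply: hsum_le => // t ht; rewrite -[y]addr0; apply: H => //; first by lra.
  by constructor 3.
have h2 : nm (hsum u k x (y + h) h) <= h * M.
  by apply: hsum_le => // t ht; apply: H => //; [lra|constructor 4].
have h3 : nm (vsum u k x y h) <= h * M.
  apply: vsum_le => // t ht; rewrite -[x]addr0; apply: H => //; first by lra.
  by constructor 1.
have h4 : nm (vsum u k (x + h) y h) <= h * M.
  by apply: vsum_le => // t ht; apply: H => //; [lra|constructor 2].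
apply: le_trans (nmD _ _) _; rewrite nmM nmi mul1r.
have := nmD (hsum u k x y h) (- hsum u k x (y + h) h).
have := nmD (vsum u k (x + h) y h) (- vsum u k x y h).
by rewrite !nmN; lra.
Qed.

(** Zero at every finite level, not just in the limit: on opposite sides the integrand differs by a
    constant, so the discretization errors cancel. *)
Lemma contour_affine (a b : C) k x y h : contour (fun z => a + b * z) k x y h = 0.
Proof.
have H j y1 y2 x1 h1 : hsum (fun z => a + b * z) j x1 y2 h1 -
    hsum (fun z => a + b * z) j x1 y1 h1 = h1%:C * b * 'i%C * (y2 - y1)%:C.
  elim: j x1 h1 => [|j IH] x1 h1 /=.
    by rewrite (complexDi x1 y1) (complexDi x1 y2) rmorphB /=; ring.
  have -> : h1%:C * b * 'i%C * (y2 - y1)%:C = (h1 / 2)%:C * b * 'i%C * (y2 - y1)%:C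
     + (h1 / 2)%:C * b * 'i%C * (y2 - y1)%:C :> C.
    by rewrite {1}(splitr h1) rmorphD /=; ring.
  by rewrite -{1}(IH x1) -(IH (x1 + h1 / 2)); ring.
have V j x1 x2 y1 h1 : vsum (fun z => a + b * z) j x2 y1 h1 -
    vsum (fun z => a + b * z) j x1 y1 h1 = h1%:C * b * (x2 - x1)%:C.
  elim: j y1 h1 => [|j IH] y1 h1 /=.
    by rewrite (complexDi x1 y1) (complexDi x2 y1) rmorphB /=; ring.
  have -> : h1%:C * b * (x2 - x1)%:C = (h1 / 2)%:C * b * (x2 - x1)%:C
     + (h1 / 2)%:C * b * (x2 - x1)%:C :> C.
    by rewrite {1}(splitr h1) rmorphD /=; ring.
  by rewrite -{1}(IH y1) -(IH (y1 + h1 / 2)); ring.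
rewrite /contour V -opprB H addrC.
have -> : x + h - x = h by lra. have -> : y + h - y = h by lra.
ring.
Qed.

Definition cderiv u (z l : C) := forall e : R, 0 < e -> exists2 d : R, 0 < d &
  forall w, nm (w - z) < d -> nm (u w - u z - l * (w - z)) <= e * nm (w - z).

Lemma goursat u x y h : 0 < h ->
  (forall s t, 0 <= s <= h -> 0 <= t <= h -> exists l, cderiv u ((x + s) +i* (y + t)) l) ->
  forall e : R, 0 < e -> exists K, forall k, (K <= k)%N -> nm (contour u k x y h) <= e.
Proof.
move=> h0 hu e e0.
pose e1 : R := e / h ^+ 2.
have e1p : 0 < e1 by rewrite divr_gt0 // exprn_gt0.
(* An error proportional to the area adds up correctly over four quarters, as [square_chain]
   requires. *)
suff [K HK] : exists K, forall k, (K <= k)%N -> nm (contour u k x y h) <= e1 * h ^+ 2.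
  exists K => k /HK; rewrite /e1 divfK //.
  by rewrite expf_neq0 // gt_eqF.
apply: (@square_chain R (fun x y h => exists K, forall k, (K <= k)%N ->
  nm (contour u k x y h) <= e1 * h ^+ 2) x y h) => //.
  move=> a b c c0 [K1 H1] [K2 H2] [K3 H3] [K4 H4].
  exists (maxn (maxn K1 K2) (maxn K3 K4)).+1 => -[//|k]; rewrite ltnS !geq_max.
  move=> /andP[/andP[/H1 {}H1 /H2 {}H2] /andP[/H3 {}H3 /H4 {}H4]].
  rewrite contourS.
  have := nmD (contour u k a b (c / 2) + contour u k (a + c / 2) b (c / 2)
     + contour u k a (b + c / 2) (c / 2)) (contour u k (a + c / 2) (b + c / 2) (c / 2)).
  have := nmD (contour u k a b (c / 2) + contour u k (a + c / 2) b (c / 2))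
     (contour u k a (b + c / 2) (c / 2)).
  have := nmD (contour u k a b (c / 2)) (contour u k (a + c / 2) b (c / 2)).
  have -> : e1 * c ^+ 2 = 4 * (e1 * (c / 2) ^+ 2) by field.
  lra.
move=> a b ha hb; have [l hl] := hu (a - x) (b - y) ltac:(lra) ltac:(lra).
have ax : x + (a - x) = a by lra. have bx : y + (b - y) = b by lra.
rewrite ax bx in hl.
have e8 : 0 < e1 / 8 by lra.
have [d d0 hd] := hl _ e8; exists (d / 2); first by lra.
move=> x' y' c c0 cd hx hy _ _ _ _; exists 0%N => k _.
(* Removing the affine part of [u] at [z] does not change the contour sum. The remainder is at most
   [(e1 / 8) (2 c)] on a boundary of length [4 c]. *)
pose z : C := a +i* b; pose E : C -> C := fun w => u w - (u z - l * z + l * w).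
have -> : contour u k x' y' c = contour E k x' y' c.
  have -> : u = (fun w => 1 * E w + 1 * (u z - l * z + l * w)).
    by apply/funext => w; rewrite /E; ring.
  by rewrite contour_lin contour_affine mulr0 addr0 mul1r.
have := @contour_le E k x' y' c (e1 / 8 * (2 * c)) (ltW c0).
have -> : 4 * c * (e1 / 8 * (2 * c)) = e1 * c ^+ 2 by field.
apply=> s t hs ht _.
set w : C := _ +i* _.
have nw : nm (w - z) <= 2 * c.
  apply: le_trans (nm_le_ReIm _) _ => /=.
  have : `|x' + s - a| <= c by rewrite ler_norml; lra.
  have : `|y' + t - b| <= c by rewrite ler_norml; lra.
  lra.
have -> : E w = u w - u z - l * (w - z) by rewrite /E; ring.
apply: le_trans (hd w _) _; first by lra.
by rewrite ler_pM2l.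
Qed.

End Goursat.

Section CauchyEstimate.
Variable R : realType.
Local Notation C := (Cx R).
Implicit Types (u v : C -> C) (x y h r M : R).

Lemma cderiv_lip u z l : cderiv u z l -> exists2 d : R, 0 < d &
  forall w, nm (w - z) < d -> nm (u w - u z) <= (1 + nm l) * nm (w - z).
Proof.
move=> /(_ 1 ltr01)[d d0 hd]; exists d => // w /hd h.
have -> : u w - u z = (u w - u z - l * (w - z)) + l * (w - z) by ring.
by apply: le_trans (nmD _ _) _; rewrite nmM mulrDl; apply: lerD.
Qed.

Lemma cderivM u v z a b : cderiv u z a -> cderiv v z b ->
  cderiv (fun w => u w * v w) z (a * v z + u z * b).
Proof.
move=> ha hb e e0.
have [d1 d10 h1] := cderiv_lip hb.
pose K : R := 1 + nm b; have K0 : 0 < K by have := nm_ge0 b; rewrite /K; lra.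
pose B : R := nm (v z) + K * d1 + 1.
have B0 : 0 < B by rewrite /B; have := nm_ge0 (v z); have := mulr_gt0 K0 d10; lra.
pose A : R := nm (u z) + 1; have A0 : 0 < A by have := nm_ge0 (u z); rewrite /A; lra.
pose D : R := nm a + 1; have D0 : 0 < D by have := nm_ge0 a; rewrite /D; lra.
have [d2 d20 h2] := ha (e / 3 / B) ltac:(by rewrite !divr_gt0).
have [d3 d30 h3] := hb (e / 3 / A) ltac:(by rewrite !divr_gt0).
have d40 : 0 < e / 3 / (D * K) by rewrite !divr_gt0 // mulr_gt0.
exists (Num.min (Num.min d1 d2) (Num.min d3 (e / 3 / (D * K)))).
  by rewrite !lt_min d10 d20 d30 d40.
move=> w; rewrite !lt_min => /andP[/andP[w1 w2] /andP[w3 w4]].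
have {}h1 := h1 _ w1; have {}h2 := h2 _ w2; have {}h3 := h3 _ w3.
have -> : u w * v w - u z * v z - (a * v z + u z * b) * (w - z) =
  (u w - u z - a * (w - z)) * v w + u z * (v w - v z - b * (w - z))
  + a * (w - z) * (v w - v z) by ring.
set t := nm (w - z) in w1 w2 w3 w4 h1 h2 h3 *.
have t0 : 0 <= t := nm_ge0 _.
have vB : nm (v w) <= B.
  have -> : v w = (v w - v z) + v z by ring.
  apply: le_trans (nmD _ _) _; rewrite /B.
  have := ler_wpM2l (ltW K0) (ltW w1); move: h1; rewrite -/K; lra.
have e1 : nm ((u w - u z - a * (w - z)) * v w) <= e / 3 * t.
  rewrite nmM; apply: le_trans (ler_pM (nm_ge0 _) (nm_ge0 _) h2 vB) _.
  by rewrite mulrAC divfK // gt_eqF.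
have e2 : nm (u z * (v w - v z - b * (w - z))) <= e / 3 * t.
  rewrite nmM; have uA : nm (u z) <= A by rewrite /A; lra.
  apply: le_trans (ler_pM (nm_ge0 _) (nm_ge0 _) uA h3) _.
  by rewrite mulrC mulrAC divfK // gt_eqF.
have e3 : nm (a * (w - z) * (v w - v z)) <= e / 3 * t.
  rewrite !nmM -/t; have aD : nm a <= D by rewrite /D; lra.
  have s1 : nm a * t <= D * t by apply: ler_wpM2r.
  apply: le_trans (ler_pM _ (nm_ge0 _) s1 h1) _; first by rewrite mulr_ge0 ?nm_ge0.
  rewrite -/K.
  have -> : D * t * (K * t) = (D * K * t) * t by ring.
  apply: ler_wpM2r => //; rewrite mulrC -ler_pdivlMr ?mulr_gt0 //; exact: ltW.
have := nmD ((u w - u z - a * (w - z)) * v w + u z * (v w - v z - b * (w - z)))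
  (a * (w - z) * (v w - v z)).
have := nmD ((u w - u z - a * (w - z)) * v w) (u z * (v w - v z - b * (w - z))).
lra.
Qed.

Lemma cderivV (z : C) : z != 0 -> cderiv (fun w => w^-1) z (- z^-1 ^+ 2).
Proof.
move=> z0 e e0.
have nz : 0 < nm z.
  by rewrite lt_def nm_ge0 andbT; apply: contra z0 => /eqP/nm_eq0->.
exists (Num.min (nm z / 2) (e * nm z ^+ 3 / 2)).
  by rewrite lt_min !divr_gt0 ?mulr_gt0 ?exprn_gt0.
move=> w; rewrite lt_min => /andP[w1 w2].
have nw : nm z / 2 < nm w.
  have := nmD w (z - w); rewrite nmBC.
  have -> : w + (z - w) = z by ring.
  lra.
have w0 : w != 0 by apply/eqP => w0; move: nw; rewrite w0 nm0; lra.
have -> : w^-1 - z^-1 - - z^-1 ^+ 2 * (w - z) = (w - z) * ((w - z) / (z ^+ 2 * w)).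
  by field; rewrite z0 w0.
rewrite nmM mulrC ler_wpM2r ?nm_ge0 // nmM nmV !nmM.
have ne : nm z * nm z * nm w > 0 by rewrite !mulr_gt0 //; lra.
rewrite ler_pdivrMr //; apply: le_trans (ltW w2) _.
rewrite -mulrA ler_pM2l // exprS expr2.
have -> : nm z * (nm z * nm z) / 2 = nm z * nm z * (nm z / 2) by field.
by rewrite ler_pM2l ?mulr_gt0 // ltW.
Qed.

(** Each side contributes at least 1: there the imaginary part of [dz / z] has density
    [r / (x^2 + r^2) >= 1 / (2 r)], and the side has length [2 r]. The integral itself is
    [2 pi i]. *)
Lemma Im_contour_inv_ge k r : 0 < r ->
  4 <= complex.Im (contour (fun z => z^-1) k (- r) (- r) (2 * r)).
Proof.
move=> r0; set u := fun z : C => z^-1.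
have invE x y : (x +i* y : C)^-1 = (x / (x ^+ 2 + y ^+ 2)) -i* (y / (x ^+ 2 + y ^+ 2)).
  by [].
have lb x y : `|x| <= r -> y ^+ 2 = r ^+ 2 -> (2 * r)^-1 <= r / (x ^+ 2 + y ^+ 2).
  move=> hx ->; have hx2 : x ^+ 2 <= r ^+ 2.
    by rewrite -(real_normK (num_real x)) lerXn2r // ?nnegrE // ltW.
  have rr : 0 < r ^+ 2 by rewrite exprn_gt0.
  have x2 := sqr_ge0 x.
  rewrite ler_pdivlMr; last by lra.
  rewrite mulrC ler_pdivrMr ?mulr_gt0 //.
  rewrite (_ : r * (2 * r) = 2 * r ^+ 2); last by ring.
  lra.
have ab t : 0 <= t <= 2 * r -> `|- r + t| <= r by move=> ?; rewrite ler_norml; lra.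
have rN : (- r + 2 * r) = r by ring.
have r2 : 0 <= 2 * r by lra.
have one : (2 * r) * (2 * r)^-1 = 1 by rewrite divff // gt_eqF // mulr_gt0.
have s1 : 1 <= complex.Im (hsum u k (- r) (- r) (2 * r)).
  rewrite -{1}one; apply: Im_hsum_ge => // t ht; rewrite /u invE /= mulNr opprK.
  by apply: lb; [exact: ab|rewrite sqrrN].
(* The sign or factor ['i] of a side is absorbed into the integrand, in the shape of [hsum_lin] and
   [vsum_lin] with second coefficient 0. *)
have s2 : 1 <= complex.Im (hsum (fun z => (-1) * u z + 0 * u z) k (- r) (- r + 2 * r) (2 * r)).
  rewrite -{1}one; apply: Im_hsum_ge => // t ht; rewrite rN mulN1r mul0r addr0 /u invE /= opprK.
  by apply: lb; [exact: ab|].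
have s3 : 1 <= complex.Im (vsum (fun z => 'i%C * u z + 0 * u z) k (- r + 2 * r) (- r) (2 * r)).
  rewrite -{1}one; apply: Im_vsum_ge => // t ht; rewrite rN mul0r addr0 /u invE /=.
  by rewrite mul0r mul1r add0r [r ^+ 2 + _]addrC; apply: lb; [exact: ab|].
have s4 : 1 <= complex.Im (vsum (fun z => - 'i%C * u z + 0 * u z) k (- r) (- r) (2 * r)).
  rewrite -{1}one; apply: Im_vsum_ge => // t ht; rewrite mul0r addr0 /u invE /=.
  rewrite oppr0 mul0r add0r mulN1r mulNr opprK sqrrN [r ^+ 2 + _]addrC.
  by apply: lb; [exact: ab|].
have -> : contour u k (- r) (- r) (2 * r) = hsum u k (- r) (- r) (2 * r)
  + hsum (fun z => (-1) * u z + 0 * u z) k (- r) (- r + 2 * r) (2 * r)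
  + vsum (fun z => 'i%C * u z + 0 * u z) k (- r + 2 * r) (- r) (2 * r)
  + vsum (fun z => - 'i%C * u z + 0 * u z) k (- r) (- r) (2 * r).
  by rewrite /contour hsum_lin !vsum_lin; ring.
by rewrite !raddfD /=; lra.
Qed.

Local Ltac side := rewrite ?ler_norml; try lra.

(* The square [-h, h]^2 minus [-h/2, h/2]^2 is tiled by twelve squares of side h/2. *)
Lemma contour_annulus u h : 0 < h ->
  (forall x y, `|x| <= h -> `|y| <= h -> (x != 0) || (y != 0) ->
     exists l, cderiv u (x +i* y) l) ->
  forall e : R, 0 < e -> exists K, forall k, (K <= k)%N ->
    nm (contour u k.+2 (- h) (- h) (2 * h)
        - contour u k.+1 (- (h / 2)) (- (h / 2)) (2 * (h / 2))) <= e.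
Proof.
move=> h0 hu e e0.
have e12 : 0 < e / 12 by lra.
pose s := h / 2.
(* The four alternatives say on which side the closed tile misses the origin, the only point where
   [u] may fail to be differentiable. *)
have g (a b : R) : (`|a| <= h) -> (`|a + s| <= h) -> (`|b| <= h) -> (`|b + s| <= h) ->
   [\/ a + s < 0, 0 < a, b + s < 0 | 0 < b] ->
   exists K, forall k, (K <= k)%N -> nm (contour u k a b s) <= e / 12.
  rewrite !ler_norml => h1 h2 h3 h4 h5; apply: goursat => //; first by rewrite /s; lra.
  move=> p q hp hq; apply: hu; rewrite ?ler_norml; try lra.
  by apply/orP; case: h5 => h5; [left|left|right|right]; apply/eqP; lra.
have sh : h = 2 * s by rewrite /s; lra.
have s0 : 0 < s by rewrite /s; lra.
have [K1 H1] := g (- h) (- h) ltac:(side) ltac:(side) ltac:(side) ltac:(side) ltac:(constructor 1; lra).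
have [K2 H2] := g (- h) (- s) ltac:(side) ltac:(side) ltac:(side) ltac:(side) ltac:(constructor 1; lra).
have [K3 H3] := g (- h) 0 ltac:(side) ltac:(side) ltac:(side) ltac:(side) ltac:(constructor 1; lra).
have [K4 H4] := g (- h) s ltac:(side) ltac:(side) ltac:(side) ltac:(side) ltac:(constructor 1; lra).
have [K5 H5] := g s (- h) ltac:(side) ltac:(side) ltac:(side) ltac:(side) ltac:(constructor 2; lra).
have [K6 H6] := g s (- s) ltac:(side) ltac:(side) ltac:(side) ltac:(side) ltac:(constructor 2; lra).
have [K7 H7] := g s 0 ltac:(side) ltac:(side) ltac:(side) ltac:(side) ltac:(constructor 2; lra).
have [K8 H8] := g s s ltac:(side) ltac:(side) ltac:(side) ltac:(side) ltac:(constructor 2; lra).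
have [K9 H9] := g (- s) (- h) ltac:(side) ltac:(side) ltac:(side) ltac:(side) ltac:(constructor 3; lra).
have [Ka Ha] := g 0 (- h) ltac:(side) ltac:(side) ltac:(side) ltac:(side) ltac:(constructor 3; lra).
have [Kb Hb] := g (- s) s ltac:(side) ltac:(side) ltac:(side) ltac:(side) ltac:(constructor 4; lra).
have [Kc Hc] := g 0 s ltac:(side) ltac:(side) ltac:(side) ltac:(side) ltac:(constructor 4; lra).
exists (\max_(i <- [:: K1; K2; K3; K4; K5; K6; K7; K8; K9; Ka; Kb; Kc]) i)%N => k.
rewrite !big_cons big_nil !geq_max.
move=> /and5P[/H1{}H1 /H2{}H2 /H3{}H3 /H4{}H4 /and5P[/H5{}H5 /H6{}H6 /H7{}H7 /H8{}H8]].
move=> /and5P[/H9{}H9 /Ha{}Ha /Hb{}Hb /Hc{}Hc _].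
(* The levels differ by one so that both squares break into tiles of side [s] at the same level [k];
   the four central tiles cancel and twelve remain. *)
rewrite !contourS.
have -> : 2 * h / 2 / 2 = s by rewrite /s; lra.
have -> : 2 * (h / 2) / 2 = s by rewrite /s; lra.
have -> : 2 * h / 2 = h by lra.
have -> : - h + h + s = s by lra.
have -> : - h + s = - s by lra.
have -> : - h + h = 0 by lra.
rewrite -/s; have -> : - s + s = 0 by lra.
set a1 := contour u k (- h) (- h) s in H1 *.
set a2 := contour u k (- h) (- s) s in H2 *.
set a3 := contour u k (- h) 0 s in H3 *.
set a4 := contour u k (- h) s s in H4 *.
set a5 := contour u k s (- h) s in H5 *.
set a6 := contour u k s (- s) s in H6 *.
set a7 := contour u k s 0 s in H7 *.
set a8 := contour u k s s s in H8 *.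
set a9 := contour u k (- s) (- h) s in H9 *.
set aa := contour u k 0 (- h) s in Ha *.
set ab := contour u k (- s) s s in Hb *.
set ac := contour u k 0 s s in Hc *.
set X := (X in nm X).
have -> : X = \sum_(i <- [:: a1; a2; a3; a4; a5; a6; a7; a8; a9; aa; ab; ac]) i.
  by rewrite !big_cons big_nil /X; ring.
apply: le_trans (nm_sum _ _ _) _.
rewrite !big_cons big_nil; lra.
Qed.

(** Halving the square [m] times goes with lowering the level by [m], which keeps the mesh fixed. *)
Lemma contour_shrink u r : 0 < r ->
  (forall x y, `|x| <= r -> `|y| <= r -> (x != 0) || (y != 0) ->
     exists l, cderiv u (x +i* y) l) ->
  forall m (e : R), 0 < e -> exists k,
    nm (contour u (k + m).+1 (- r) (- r) (2 * r)
        - contour u k.+1 (- (r / 2 ^+ m)) (- (r / 2 ^+ m)) (2 * (r / 2 ^+ m))) <= e.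
Proof.
move=> r0 hu m e e0.
suff [K HK] : exists K, forall k, (K <= k)%N ->
    nm (contour u (k + m).+1 (- r) (- r) (2 * r)
        - contour u k.+1 (- (r / 2 ^+ m)) (- (r / 2 ^+ m)) (2 * (r / 2 ^+ m))) <= e.
  by exists K; exact: HK.
elim: m e e0 => [|m IH] e e0.
  by exists 0%N => k _; rewrite expr0 divr1 addn0 subrr nm0 ltW.
have [K1 H1] := IH (e / 2) ltac:(lra).
pose h := r / 2 ^+ m.
have h0 : 0 < h by rewrite divr_gt0 // exprn_gt0.
have hr : h <= r by rewrite ler_pdivrMr ?exprn_gt0 // ler_peMr ?(ltW r0) // exprn_ege1 // ler1n.
have [K2 H2] : exists K, forall k, (K <= k)%N ->
    nm (contour u k.+2 (- h) (- h) (2 * h)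
        - contour u k.+1 (- (h / 2)) (- (h / 2)) (2 * (h / 2))) <= e / 2.
  apply: contour_annulus => // [x y hx hy|]; last by lra.
  by apply: hu; apply: le_trans hr.
exists (maxn K1 K2) => k; rewrite geq_max => /andP[k1 k2].
have -> : r / 2 ^+ m.+1 = h / 2.
  by rewrite /h exprS; field; rewrite expf_neq0.
have := H1 k.+1 ltac:(exact: leqW); have := H2 k k2.
rewrite -/h addSnnS; set A := contour _ _ (- r) _ _; set B := contour _ _ (- h) _ _.
set D := contour _ _ _ _ _.
have -> : A - D = (A - B) + (B - D) by ring.
have := nmD (A - B) (B - D); lra.
Qed.

(** The derivative is the residue of [w z = (u z - u 0) / z^2] at 0. On the square of half-side [r]
    its sum is at most [8 r * 2 M / r^2]; on a tiny square [w] is close to [l / z], whose sum has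
    modulus at least [4 nm l]. By [contour_shrink] the two sums are close. *)
Lemma cauchy_estimate u l r M : 0 < r -> cderiv u 0 l ->
  (forall x y, `|x| <= r -> `|y| <= r -> exists l, cderiv u (x +i* y) l) ->
  (forall x y, `|x| <= r -> `|y| <= r -> nm (u (x +i* y)) <= M) ->
  nm l <= 4 * M / r.
Proof.
move=> r0 hl hu hM.
pose w : C -> C := fun z => (u z - u 0) * (z^-1 * z^-1).
have dw x y : `|x| <= r -> `|y| <= r -> (x != 0) || (y != 0) ->
    exists l, cderiv w (x +i* y) l.
  move=> hx hy xy0; have [a ha] := hu _ _ hx hy.
  have z0 : (x +i* y : C) != 0 by rewrite eq_complex /= negb_and.
  have hb := cderivV z0.
  have ha' : cderiv (fun z => u z - u 0) (x +i* y) a.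
    move=> e /ha[d d0 hd]; exists d => // z /hd.
    by have -> : u z - u 0 - (u (x +i* y) - u 0) = u z - u (x +i* y) by ring.
  by eexists; apply: (cderivM ha' (cderivM hb hb)).
have bd (c s : R) : 0 < c -> s = 0 \/ s = 2 * c -> `|- c + s| = c.
  by move=> c0 []->; rewrite ?addr0 ?normrN gtr0_norm //; lra.
have M0 : 0 <= M by have := hM 0 0; rewrite normr0 => /(_ (ltW r0) (ltW r0)); apply: le_trans; exact: nm_ge0.
have bw k : nm (contour w k (- r) (- r) (2 * r)) <= 16 * M / r.
  have -> : 16 * M / r = 4 * (2 * r) * (2 * M / r ^+ 2) by field; rewrite gt_eqF.
  apply: contour_le => [|s t hs ht st]; first by lra.
  set z : C := _ +i* _.
  have zr : r <= nm z.
    case: st => st; [apply: le_trans (Re_le_nm z)|apply: le_trans (Re_le_nm z)|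
                     apply: le_trans (Im_le_nm z)|apply: le_trans (Im_le_nm z)];
      by rewrite /= (bd r) //; tauto.
  have uz : nm (u z - u 0) <= 2 * M.
    apply: le_trans (nmD _ _) _; rewrite nmN.
    have := hM (- r + s) (- r + t); have := hM 0 0; rewrite normr0 -/z.
    move=> /(_ (ltW r0) (ltW r0)) h1; rewrite !ler_norml.
    by move=> /(_ ltac:(lra) ltac:(lra)) h2; have : nm (u 0) <= M := h1; lra.
  rewrite /w !nmM !nmV; apply: ler_pM => //; rewrite ?nm_ge0 // ?mulr_ge0 ?invr_ge0 ?nm_ge0 //.
  have nz0 : 0 < nm z by apply: lt_le_trans zr.
  by rewrite expr2 invfM; apply: ler_pM; rewrite ?invr_ge0 ?nm_ge0 // lef_pV2.
(* One [eta] is spent on shrinking the square, eight on the remainder [E], which is at most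
   [eta / h] on a boundary of length [8 h]. *)
have key (eta : R) : 0 < eta -> 4 * nm l <= 16 * M / r + 9 * eta.
  move=> eta0; have [d d0 hd] := hl _ eta0.
  pose m := Num.truncn (2 * r / d).
  pose h := r / 2 ^+ m.
  have h0 : 0 < h by rewrite divr_gt0 // exprn_gt0.
  have hd2 : 2 * h < d.
    have nd : 2 * r / d < m.+1%:R by apply: truncnS_gt.
    have m2 : m.+1%:R <= 2 ^+ m :> R by rewrite -natrX ler_nat ltn_expl.
    have : 2 * r / d < 2 ^+ m by apply: lt_le_trans nd m2.
    rewrite /h !ltr_pdivrMr // mulrA ltr_pdivrMr ?exprn_gt0 //.
    by rewrite [d * _]mulrC.
  have [k Hk] := contour_shrink r0 dw m eta0.
  rewrite -/h in Hk; have {}bw := bw (k + m).+1.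
  pose E : C -> C := fun z => w z + - l * z^-1.
  have hE : nm (contour E k.+1 (- h) (- h) (2 * h)) <= 8 * eta.
    have -> : 8 * eta = 4 * (2 * h) * (eta / h) by field; rewrite gt_eqF.
    apply: contour_le => [|s t hs ht st]; first by lra.
    set z : C := _ +i* _.
    have zh : h <= nm z.
      case: st => st; [apply: le_trans (Re_le_nm z)|apply: le_trans (Re_le_nm z)|
                     apply: le_trans (Im_le_nm z)|apply: le_trans (Im_le_nm z)];
      by rewrite /= (bd h) //; tauto.
    have nz0 : 0 < nm z by apply: lt_le_trans zh.
    have z0 : z != 0 by apply/eqP => z0; move: nz0; rewrite z0 nm0 ltxx.
    have zd : nm (z - 0) < d.
      rewrite subr0; apply: le_lt_trans (nm_le_ReIm z) _; apply: le_lt_trans hd2 => /=.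
      have : `|- h + s| <= h by rewrite ler_norml; lra.
      have : `|- h + t| <= h by rewrite ler_norml; lra.
      lra.
    have := hd _ zd; rewrite subr0.
    have -> : E z = (u z - u 0 - l * z) * (z^-1 * z^-1) by rewrite /E /w; field.
    rewrite !nmM nmV => hz.
    apply: le_trans (ler_wpM2r _ hz) _; first by rewrite mulr_ge0 ?invr_ge0 ?nm_ge0.
    have -> : eta * nm z * ((nm z)^-1 / nm z) = eta / nm z by field; rewrite gt_eqF.
    by rewrite ler_pM2l // lef_pV2.
  have Hinv : 4 <= nm (contour (fun z => z^-1) k.+1 (- h) (- h) (2 * h)).
    apply: le_trans (Im_contour_inv_ge k.+1 h0) _.
    exact: le_trans (ler_norm _) (Im_le_nm _).
  have wE : contour w k.+1 (- h) (- h) (2 * h) =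
     contour E k.+1 (- h) (- h) (2 * h)
     + l * contour (fun z => z^-1) k.+1 (- h) (- h) (2 * h).
    rewrite -[contour E _ _ _ _]mul1r -contour_lin; congr contour; apply/funext => z.
    by rewrite /E; ring.
  have l4 : 4 * nm l <= nm (l * contour (fun z => z^-1) k.+1 (- h) (- h) (2 * h)).
    by rewrite nmM mulrC ler_wpM2l ?nm_ge0.
  apply: le_trans l4 _.
  set a := contour w k.+1 _ _ _ in wE Hk.
  set b := contour w (k + m).+1 _ _ _ in Hk bw.
  set cE := contour E _ _ _ _ in wE hE.
  have -> : l * contour (fun z => z^-1) k.+1 (- h) (- h) (2 * h) = (b - (b - a)) - cE.
    by rewrite wE; ring.
  have := nmD (b - (b - a)) (- cE); have := nmD b (- (b - a)); rewrite !nmN.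
  lra.
apply/ler_addgt0Pr => e e0.
have := key (e / 9 * 4) ltac:(lra).
have -> : 4 * M / r = 16 * M / r / 4 by field; rewrite gt_eqF.
lra.
Qed.

End CauchyEstimate.

(** * Complex derivatives in several variables and their estimates *)

Section Frechet.
Variable R : realType.
Local Notation C := (Cx R).

Lemma nm_tri (V : normedZmodType C) (b a c : V) : nm (a - c) <= nm (a - b) + nm (b - c).
Proof. by have := nmD (a - b) (b - c); rewrite addrA subrK. Qed.

(** The derivative is a matrix acting on rows from the right, so the chain rule reads [L *m L']. It
    is an explicit witness, which makes estimates for it statable before any translation to ['d]. *)
Definition hasd n m (f : 'rV[C]_n -> 'rV[C]_m) z (L : 'M[C]_(n, m)) :=
  forall e : R, 0 < e -> exists2 d : R, 0 < d &
    forall w, nm (w - z) < d -> nm (f w - f z - (w - z) *m L) <= e * nm (w - z).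

Lemma hasd_lip n m (f : 'rV[C]_n -> 'rV[C]_m) z L : hasd f z L ->
  exists K d : R, [/\ 0 < K, 0 < d &
    forall w, nm (w - z) < d -> nm (f w - f z) <= K * nm (w - z)].
Proof.
move=> /(_ 1 ltr01)[d d0 hd]; exists (1 + n%:R * nm L), d; split => //.
  by apply: ltr_wpDr; rewrite // mulr_ge0 ?nm_ge0.
move=> w /hd h; rewrite -[f w - f z](subrK ((w - z) *m L)).
apply: le_trans (nmD _ _) _; rewrite mulrDl; apply: lerD => //.
by apply: le_trans (nm_mulmx _ _) _; rewrite mulrAC.
Qed.

Lemma hasd_comp n m p (f : 'rV[C]_n -> 'rV[C]_m) (g : 'rV[C]_m -> 'rV[C]_p) z L L' :
  hasd f z L -> hasd g (f z) L' -> hasd (g \o f) z (L *m L').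
Proof.
move=> hf hg e e0.
have [K [d1 [K0 d10 h1]]] := hasd_lip hf.
have [d2 d20 h2] := hg (e / 2 / K) ltac:(by rewrite !divr_gt0).
pose B := m%:R * nm L' + 1.
have B0 : 0 < B by apply: ltr_wpDl; rewrite // mulr_ge0 ?nm_ge0.
have [d3 d30 h3] := hf (e / 2 / B) ltac:(by rewrite !divr_gt0).
exists (Num.min (Num.min d1 (d2 / K)) d3).
  by rewrite !lt_min d10 d30 divr_gt0.
move=> w; rewrite !lt_min => /andP[/andP[w1 w2] w3].
have {}h1 := h1 _ w1; have {}h3 := h3 _ w3.
have h4 : nm (f w - f z) < d2.
  by apply: le_lt_trans h1 _; rewrite mulrC -ltr_pdivlMr.
have {}h2 := h2 _ h4.
have -> : (g \o f) w - (g \o f) z - (w - z) *m (L *m L') =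
  (g (f w) - g (f z) - (f w - f z) *m L') + (f w - f z - (w - z) *m L) *m L'.
  by rewrite (mulmxBl (f w - f z)) -mulmxA addrA subrK.
apply: le_trans (nmD _ _) _.
have e1 : nm (g (f w) - g (f z) - (f w - f z) *m L') <= e / 2 * nm (w - z).
  apply: le_trans h2 _.
  have := ler_wpM2l (x := e / 2 / K) ltac:(by rewrite ltW // !divr_gt0) h1.
  by rewrite mulrA divfK // gt_eqF.
have e2 : nm ((f w - f z - (w - z) *m L) *m L') <= e / 2 * nm (w - z).
  apply: le_trans (nm_mulmx _ _) _; rewrite mulrAC.
  have := ler_wpM2l (ltW B0) h3.
  have -> : B * (e / 2 / B * nm (w - z)) = e / 2 * nm (w - z) by field; rewrite gt_eqF.
  apply: le_trans; apply: ler_wpM2r; rewrite ?nm_ge0 // /B; lra.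
lra.
Qed.

Lemma hasdD n m (f g : 'rV[C]_n -> 'rV[C]_m) z L L' :
  hasd f z L -> hasd g z L' -> hasd (fun w => f w + g w) z (L + L').
Proof.
move=> hf hg e e0.
have [d1 d10 h1] := hf (e / 2) ltac:(lra); have [d2 d20 h2] := hg (e / 2) ltac:(lra).
exists (Num.min d1 d2); first by rewrite lt_min d10.
move=> w; rewrite lt_min => /andP[/h1 {}h1 /h2 {}h2].
have -> : f w + g w - (f z + g z) - (w - z) *m (L + L') =
  (f w - f z - (w - z) *m L) + (g w - g z - (w - z) *m L').
  rewrite mulmxDr; move: ((w - z) *m L) ((w - z) *m L') => a b.
  by apply/rowP => i; rewrite !mxE; ring.
apply: le_trans (nmD _ _) _; lra.
Qed.

Lemma hasd_cst n m (c : 'rV[C]_m) (z : 'rV[C]_n) : hasd (fun=> c) z 0.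
Proof.
move=> e e0; exists 1 => // w _; rewrite mulmx0 !subrr nm0.
by rewrite mulr_ge0 ?nm_ge0 // ltW.
Qed.

Lemma hasd_lin n m (L : 'M[C]_(n, m)) (z : 'rV[C]_n) : hasd (mulmx^~ L) z L.
Proof.
move=> e e0; exists 1 => // w _; rewrite /= mulmxBl subrr nm0.
by rewrite mulr_ge0 ?nm_ge0 // ltW.
Qed.

Lemma hasd_id n (z : 'rV[C]_n) : hasd id z 1%:M.
Proof.
move=> e e0; exists 1 => // w _; rewrite mulmx1 subrr nm0.
by rewrite mulr_ge0 ?nm_ge0 // ltW.
Qed.

Lemma hasd_near n m (f g : 'rV[C]_n -> 'rV[C]_m) z L (r : R) : 0 < r ->
  (forall w, nm (w - z) < r -> f w = g w) -> hasd f z L -> hasd g z L.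
Proof.
move=> r0 fg hf e e0; have [d d0 hd] := hf e e0.
exists (Num.min d r); first by rewrite lt_min d0.
move=> w; rewrite lt_min => /andP[w1 w2].
by rewrite -!fg ?subrr ?nm0 //; exact: hd.
Qed.

Lemma hasdB n m (f g : 'rV[C]_n -> 'rV[C]_m) z L L' :
  hasd f z L -> hasd g z L' -> hasd (fun w => f w - g w) z (L - L').
Proof.
move=> hf hg; apply: hasdD => //.
have := hasd_comp hg (hasd_lin (- 1%:M) (g z)); rewrite mulmxN mulmx1.
by apply: (hasd_near ltr01) => w _ /=; rewrite mulmxN mulmx1.
Qed.

Lemma hasd_uniq n m (f : 'rV[C]_n -> 'rV[C]_m) z L L' :
  hasd f z L -> hasd f z L' -> L = L'.
Proof.
move=> hf hg; have H := hasdB hf hg.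
suff Z (v : 'rV[C]_n) : v *m (L - L') = 0.
  apply/eqP; rewrite -subr_eq0; apply/eqP/row_matrixP => i.
  by rewrite rowE Z row0.
apply: nm_eq0; apply/eqP; rewrite eq_le nm_ge0 andbT; apply/ler_addgt0Pr => e e0.
rewrite add0r.
have v1 : 0 < nm v + 1 by have := nm_ge0 v; lra.
have [d d0 hd] := H (e / (nm v + 1)) ltac:(by rewrite divr_gt0).
pose t : R := d / 2 / (nm v + 1).
have t0 : 0 < t by rewrite !divr_gt0.
have nt : nm (z + t%:C *: v - z) = t * nm v by rewrite addrC addKr nmZ nmR gtr0_norm.
have tv : t * nm v < d.
  rewrite /t mulrAC ltr_pdivrMr // ; have := nm_ge0 v; nra.
have := hd (z + t%:C *: v); rewrite nt => /(_ tv).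
have -> : f (z + t%:C *: v) - f (z + t%:C *: v) - (f z - f z)
   - (z + t%:C *: v - z) *m (L - L') = - (t%:C *: (v *m (L - L'))).
  by rewrite !subrr sub0r [z + _]addrC addrK scalemxAl.
rewrite nmN nmZ nmR gtr0_norm // mulrCA ler_pM2l //.
move/le_trans; apply; rewrite mulrAC ler_pdivrMr //.
by rewrite ler_pM2l //; lra.
Qed.

Lemma hasd_line n m (f : 'rV[C]_n -> 'rV[C]_m) z v (t : C) L j :
  hasd f (z + t *: v) L ->
  cderiv (fun s => f (z + s *: v) 0 j) t ((v *m L) 0 j).
Proof.
move=> hf e e0.
have v1 : 0 < nm v + 1 by have := nm_ge0 v; lra.
have [d d0 hd] := hf (e / (nm v + 1)) ltac:(by rewrite divr_gt0).
exists (d / (nm v + 1)); first by rewrite divr_gt0.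
move=> s hs.
have E : z + s *: v - (z + t *: v) = (s - t) *: v.
  by rewrite opprD addrACA subrr add0r scalerBl.
have := hd (z + s *: v); rewrite E nmZ.
have hsd : nm (s - t) * nm v < d.
  move: hs; rewrite ltr_pdivlMr //; have := nm_ge0 (s - t); nra.
move=> /(_ hsd) h.
apply: (@le_trans _ _ (e / (nm v + 1) * (nm (s - t) * nm v))).
  apply: le_trans h; have := nm_entry (f (z + s *: v) - f (z + t *: v) - (s - t) *: v *m L) 0 j.
  by apply: le_trans; rewrite -scalemxAl !mxE [X in nm (_ - X)]mulrC mulrC.
have -> : e / (nm v + 1) * (nm (s - t) * nm v) = e * nm (s - t) * (nm v / (nm v + 1)).
  by field; rewrite gt_eqF.
by apply: ler_piMr; rewrite ?mulr_ge0 ?nm_ge0 ?(ltW e0) // ler_pdivrMr //; lra.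
Qed.

Definition holo n m (f : 'rV[C]_n -> 'rV[C]_m) z0 (r : R) :=
  forall w, nm (w - z0) < r -> exists L, hasd f w L.

Lemma holo_sub n m (f : 'rV[C]_n -> 'rV[C]_m) z0 r z s :
  holo f z0 r -> nm (z - z0) + s <= r -> holo f z s.
Proof.
move=> hf hs w hw; apply: hf; have := nmD (w - z) (z - z0).
by rewrite addrA subrK; lra.
Qed.

(** Cauchy's estimate for each entry of [f] on the complex line through [z0] in the direction
    [v]. *)
Lemma hasd_bound n m (f : 'rV[C]_n -> 'rV[C]_m) z0 L (r M : R) (v : 'rV[C]_n) :
  0 < r -> holo f z0 r -> (forall w, nm (w - z0) < r -> nm (f w) <= M) ->
  hasd f z0 L -> nm (v *m L) <= 12 * M / r * nm v.
Proof.
move=> r0 hf hM hL.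
have M0 : 0 <= M by apply: le_trans (nm_ge0 _) (hM z0 _); rewrite subrr nm0.
have [->|v0] := eqVneq v 0; first by rewrite mul0mx !nm0 mulr0.
have nv : 0 < nm v.
  by rewrite lt_def nm_ge0 andbT; apply: contra v0 => /eqP/nm_eq0->.
apply: nm_le => [|i j]; first by rewrite mulr_ge0 ?divr_ge0 ?mulr_ge0 ?nm_ge0 // ltW.
rewrite ord1.
(* A point of the square of half-side [rho] has modulus at most [2 rho], so [3] keeps its image
   strictly inside the ball; with the [4] of the one-variable estimate this gives the [12]. *)
pose rho : R := r / (3 * nm v).
have rho0 : 0 < rho by rewrite divr_gt0 ?mulr_gt0.
have sm (x y : R) : `|x| <= rho -> `|y| <= rho -> nm (z0 + (x +i* y : C) *: v - z0) < r.
  move=> hx hy; rewrite addrC addKr nmZ.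
  have h : nm (x +i* y : C) <= 2 * rho by apply: le_trans (nm_le_ReIm _) _ => /=; lra.
  apply: le_lt_trans (ler_wpM2r (ltW nv) h) _.
  have -> : 2 * rho * nm v = 2 / 3 * r by rewrite /rho; field; rewrite gt_eqF.
  lra.
have -> : 12 * M / r * nm v = 4 * M / rho by rewrite /rho; field; rewrite !gt_eqF.
apply: (@cauchy_estimate R (fun s => f (z0 + s *: v) 0 j)) => //.
- by apply: hasd_line; rewrite scale0r addr0.
- move=> x y hx hy; have [L' hL'] := hf _ (sm x y hx hy).
  by eexists; apply: hasd_line hL'.
- by move=> x y hx hy; apply: le_trans (nm_entry _ _ _) _; apply: hM; exact: sm.
Qed.

(** For vector values there is no intermediate point; instead the local bounds by [(B + e) |t - s|]
    are chained along the segment and the slack [e] is sent to 0. *)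
Lemma mean_value n m (f : 'rV[C]_n -> 'rV[C]_m) w z B :
  (forall t : R, 0 <= t <= 1 -> exists2 L, hasd f (w + t%:C *: (z - w)) L &
     nm ((z - w) *m L) <= B) ->
  nm (f z - f w) <= B.
Proof.
move=> H.
pose phi (t : R) := f (w + t%:C *: (z - w)).
have -> : f z = phi 1 by rewrite /phi scale1r addrC subrK.
have -> : f w = phi 0 by rewrite /phi scale0r addr0.
apply/ler_addgt0Pr => e e0.
suff : nm (phi 1 - phi 0) <= (B + e) * (1 - 0) by rewrite subr0 mulr1.
apply: (@interval_chain R (fun x y => nm (phi y - phi x) <= (B + e) * (y - x))) => //.
- by move=> x; rewrite !subrr nm0 mulr0.
- move=> x y u xy yu h1 h2.
  apply: le_trans (nm_tri (phi y) _ _) _; apply: le_trans (lerD h2 h1) _.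
  by rewrite -mulrDr addrA subrK.
move=> s hs; have [L hL hB] := H s hs.
have K0 : 0 < nm (z - w) + 1 by have := nm_ge0 (z - w); lra.
have [d d0 hd] := hL (e / (nm (z - w) + 1)) ltac:(by rewrite divr_gt0).
have loc t : `|t - s| < d / (nm (z - w) + 1) -> nm (phi t - phi s - (t - s)%:C *: ((z - w) *m L)) <= e * `|t - s|.
  move=> ht.
  have E : w + t%:C *: (z - w) - (w + s%:C *: (z - w)) = (t - s)%:C *: (z - w).
    by rewrite opprD addrACA subrr add0r -scalerBl rmorphB.
  have := hd (w + t%:C *: (z - w)); rewrite E nmZ nmR -scalemxAl.
  have h : `|t - s| * nm (z - w) < d.
    move: ht; rewrite ltr_pdivlMr //; have := normr_ge0 (t - s); nra.
  move=> /(_ h) /le_trans; apply.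
  have -> : e / (nm (z - w) + 1) * (`|t - s| * nm (z - w)) = e * `|t - s| * (nm (z - w) / (nm (z - w) + 1)).
    by field; rewrite gt_eqF.
  by apply: ler_piMr; rewrite ?mulr_ge0 ?(ltW e0) // ler_pdivrMr //; lra.
have loc2 t : `|t - s| < d / (nm (z - w) + 1) -> nm (phi t - phi s) <= (B + e) * `|t - s|.
  move=> /loc h; rewrite -[phi t - phi s](subrK ((t - s)%:C *: ((z - w) *m L))).
  apply: le_trans (nmD _ _) _; rewrite nmZ nmR.
  rewrite mulrDl addrC; apply: lerD h; by rewrite [leLHS]mulrC ler_wpM2r.
clear loc; clearbody phi.
exists (d / (nm (z - w) + 1)); first by rewrite divr_gt0.
move=> x y _ _ /andP[xs sy] h1 h2.
apply: le_trans (nm_tri (phi s) _ _) _; rewrite (nmBC (phi s)).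
have := lerD (loc2 y _) (loc2 x _); rewrite ger0_norm; last by lra.
rewrite ler0_norm; last by lra.
move=> /(_ ltac:(lra) ltac:(lra)) /le_trans; apply.
by rewrite -mulrDr opprB addrA subrK.
Qed.

Lemma ball_convex n (z0 w z : 'rV[C]_n) (r t : R) : nm (w - z0) < r -> nm (z - z0) < r ->
  0 <= t <= 1 -> nm (w + t%:C *: (z - w) - z0) < r.
Proof.
move=> hw hz ht.
have -> : w + t%:C *: (z - w) - z0 = (1 - t)%:C *: (w - z0) + t%:C *: (z - z0).
  rewrite rmorphB /= !scalerBr !scalerBl !scale1r; apply/rowP => i; rewrite !mxE.
  by move: (w 0 i) (z 0 i) (z0 0 i) => a b c; ring.
apply: le_lt_trans (nmD _ _) _; rewrite !nmZ !nmR !ger0_norm; [|lra|lra].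
have [->|t1] := eqVneq t 1; first by rewrite subrr mul0r mul1r; lra.
have t1' : 0 < 1 - t by rewrite subr_gt0 lt_neqAle t1; lra.
have := ltr_pM2l t1' (nm (w - z0)) r; rewrite hw => e1.
have := ler_wpM2l (x := t) ltac:(lra) (ltW hz); lra.
Qed.

Lemma holo_lip n m (f : 'rV[C]_n -> 'rV[C]_m) z0 (r M : R) :
  0 < r -> holo f z0 r -> (forall w, nm (w - z0) < r -> nm (f w) <= M) ->
  forall w z, nm (w - z0) < r / 2 -> nm (z - z0) < r / 2 ->
  nm (f z - f w) <= 24 * M / r * nm (z - w).
Proof.
move=> r0 hf hM w z hw hz; apply: mean_value => t ht.
have hp := ball_convex hw hz ht; set p := w + _ in hp *.
have [L hL] := hf p ltac:(lra); exists L => //.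
have := @hasd_bound _ _ f p L (r / 2) M (z - w) ltac:(lra).
have -> : 12 * M / (r / 2) = 24 * M / r by field; rewrite gt_eqF.
apply => //; first by apply: holo_sub hf _; lra.
move=> u hu; apply: hM; have := nmD (u - p) (p - z0); rewrite addrA subrK; lra.
Qed.

(** Instead of forming second derivatives: [L' - L] is the derivative at [z0] of
    [u |-> f (u + h) - f u], which [holo_lip] makes small, and Cauchy's estimate applies to it on
    the ball of radius [r / 4]. *)
Lemma hasd_diff_bound n m (f : 'rV[C]_n -> 'rV[C]_m) z0 w L L' (r M : R) (v : 'rV[C]_n) :
  0 < r -> holo f z0 r -> (forall w, nm (w - z0) < r -> nm (f w) <= M) ->
  nm (w - z0) < r / 4 -> hasd f z0 L -> hasd f w L' ->
  nm (v *m (L' - L)) <= 24 * 48 * M / r ^+ 2 * nm (w - z0) * nm v.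
Proof.
move=> r0 hf hM hw hL hL'.
set h := w - z0 in hw *.
have wE : w = z0 + h by rewrite /h addrC subrK.
have sh z K : hasd f (z + h) K -> hasd (fun u => f (u + h)) z K.
  move=> hK e /hK[d d0 hd]; exists d => // u hu.
  have E : u + h - (z + h) = u - z by rewrite opprD addrACA subrr addr0.
  by have := hd (u + h); rewrite E; apply.
have hz u : nm (u - z0) < r / 4 -> nm (u + h - z0) < r / 2.
  by move=> hu; rewrite addrAC; have := nmD (u - z0) h; lra.
have := @hasd_bound _ _ (fun u => f (u + h) - f u) z0 (L' - L) (r / 4)
  (24 * M / r * nm h) v ltac:(lra).
have -> : 12 * (24 * M / r * nm h) / (r / 4) = 24 * 48 * M / r ^+ 2 * nm h.
  by field; rewrite gt_eqF.
apply.
- move=> u hu; have [K1 h1] := hf u ltac:(lra).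
  have [K2 h2] := hf (u + h) ltac:(have := hz u hu; lra).
  by exists (K2 - K1); apply: hasdB => //; exact: sh.
- move=> u hu; have := @holo_lip _ _ f z0 r M r0 hf hM u (u + h) ltac:(lra) (hz u hu).
  by rewrite (addrC u h) addrK.
- by apply: hasdB => //; apply: sh; rewrite -wE.
Qed.

(** The constant depends on [f] through [M] alone, so the bound is uniform over a bounded family and
    survives a uniform limit. *)
Lemma taylor2 n m (f : 'rV[C]_n -> 'rV[C]_m) z0 w L (r M : R) :
  0 < r -> holo f z0 r -> (forall w, nm (w - z0) < r -> nm (f w) <= M) ->
  hasd f z0 L -> nm (w - z0) < r / 4 ->
  nm (f w - f z0 - (w - z0) *m L) <= 24 * 48 * M / r ^+ 2 * nm (w - z0) ^+ 2.
Proof.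
move=> r0 hf hM hL hw.
have M0 : 0 <= M by apply: le_trans (nm_ge0 _) (hM z0 _); rewrite subrr nm0.
have -> : f w - f z0 - (w - z0) *m L = (f w - w *m L) - (f z0 - z0 *m L).
  rewrite mulmxBl; move: (w *m L) (z0 *m L) => a b.
  by apply/rowP => i; rewrite !mxE; ring.
apply: (@mean_value _ _ (fun u => f u - u *m L)) => t ht.
set p := z0 + _.
have pE : nm (p - z0) = t * nm (w - z0).
  by rewrite /p addrC addKr nmZ nmR ger0_norm //; lra.
have n0 := nm_ge0 (w - z0); clearbody p.
have hp : nm (p - z0) <= nm (w - z0) by rewrite pE; apply: ler_piMl => //; lra.
have [L' hL'] := hf p ltac:(lra); exists (L' - L).
  by apply: hasdB => //; exact: hasd_lin.
apply: le_trans (hasd_diff_bound _ r0 hf hM _ hL hL') _; first by lra.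
have K0 : 0 <= 24 * 48 * M / r ^+ 2.
  apply: divr_ge0; first exact: mulr_ge0.
  by apply: exprn_ge0; exact: ltW.
move: (24 * 48 * M / r ^+ 2) K0 (nm (w - z0)) (nm (p - z0)) n0 hp {pE} => K K0 a b n0 hp.
by rewrite expr2 mulrA ler_wpM2r // ler_wpM2l.
Qed.

End Frechet.

(** * Uniform limits of holomorphic maps *)

Section HolomorphicLimits.
Variable R : realType.
Local Notation C := (Cx R).

(** The supremum of the lower ends [a n - e n] lies in each interval [[a k - e k, a k + e k]], since
    any two of these intervals meet. The explicit rate [e] is what later estimates consume. *)
Lemma real_cauchy (a e : nat -> R) :
  (forall k l, (k <= l)%N -> `|a k - a l| <= e k) -> exists x, forall k, `|a k - x| <= e k.
Proof.
move=> H.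
have ab k l : a k - e k <= a l + e l.
  have [kl|/ltnW lk] := leqP k l.
    have := H _ _ kl; have := H l l (leqnn l); rewrite subrr normr0 !ler_norml; lra.
  have := H _ _ lk; have := H k k (leqnn k); rewrite subrr normr0 !ler_norml; lra.
pose S := [set a n - e n | n in [set: nat]].
have hS : has_sup S.
  by split; [exists (a 0%N - e 0%N), 0%N | exists (a 0%N + e 0%N) => _ [n _ <-]].
exists (sup S) => k; rewrite ler_norml.
have h1 : a k - e k <= sup S by apply: ub_le_sup; [case: hS|exists k].
have h2 : sup S <= a k + e k.
  by apply: ge_sup => [|_ [l _ <-]]; [case: hS|exact: ab].
lra.
Qed.

(** The factor 2 comes from treating real and imaginary parts separately. *)
Lemma mx_cauchy m n (a : nat -> 'M[C]_(m, n)) (e : nat -> R) : (forall k, 0 <= e k) ->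
  (forall k l, (k <= l)%N -> nm (a k - a l) <= e k) ->
  exists x, forall k, nm (a k - x) <= 2 * e k.
Proof.
move=> e0 H.
have hr i j : exists x, forall k, `|complex.Re (a k i j) - x| <= e k.
  apply: real_cauchy => k l kl; rewrite -raddfB /=.
  apply: le_trans (Re_le_nm _) _; apply: le_trans (H _ _ kl).
  by have := nm_entry (a k - a l) i j; rewrite !mxE.
have hi i j : exists x, forall k, `|complex.Im (a k i j) - x| <= e k.
  apply: real_cauchy => k l kl; rewrite -raddfB /=.
  apply: le_trans (Im_le_nm _) _; apply: le_trans (H _ _ kl).
  by have := nm_entry (a k - a l) i j; rewrite !mxE.
have [p hp] := choice (fun ij => hr ij.1 ij.2).
have [q hq] := choice (fun ij => hi ij.1 ij.2).
exists (\matrix_(i, j) (p (i, j) +i* q (i, j))) => k.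
apply: nm_le => [|i j]; first by rewrite mulr_ge0.
rewrite !mxE; apply: le_trans (nm_le_ReIm _) _; rewrite !raddfB /=.
have := hp (i, j) k; have := hq (i, j) k => /=; lra.
Qed.

Lemma nm_delta n (i : 'I_n) : nm (delta_mx 0 i : 'rV[C]_n) <= 1.
Proof.
apply: nm_le => // k j; rewrite mxE; case: andP => _; by rewrite ?nm1 ?nm0.
Qed.

Lemma nm_rows n m (L : 'M[C]_(n, m)) B : 0 <= B ->
  (forall v : 'rV[C]_n, nm (v *m L) <= B * nm v) -> nm L <= B.
Proof.
move=> B0 H; apply: nm_le => // i j.
have -> : L i j = ((delta_mx 0 i : 'rV[C]_n) *m L) 0 j by rewrite -rowE mxE.
apply: le_trans (nm_entry _ _ _) _; apply: le_trans (H _) _.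
by rewrite ler_piMr // nm_delta.
Qed.

(** Weierstrass's theorem at the centre of a ball, with a rate. Cauchy's estimate for [F k - F l]
    makes the derivatives a Cauchy sequence; the rate identifies the time derivative of the flow
    later. *)
Lemma holo_limit n m (F : nat -> 'rV[C]_n -> 'rV[C]_m) f z0 (r M : R) (e : nat -> R) :
  0 < r -> (forall k, holo (F k) z0 r) ->
  (forall k w, nm (w - z0) < r -> nm (F k w) <= M) ->
  (forall k w, nm (w - z0) < r -> nm (F k w - f w) <= e k) ->
  (forall k l, (k <= l)%N -> e l <= e k) ->
  (forall eta : R, 0 < eta -> exists k, e k <= eta) ->
  exists L, hasd f z0 L /\
    forall k Lk, hasd (F k) z0 Lk -> nm (Lk - L) <= 48 * e k / r.
Proof.
move=> r0 hF hM he emono elim0.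
have z0r : nm (z0 - z0) < r by rewrite subrr nm0.
have e0 k : 0 <= e k by apply: le_trans (nm_ge0 _) (he k z0 z0r).
have [D hD] := choice (fun k => hF k z0 z0r).
have Dc k l : (k <= l)%N -> nm (D k - D l) <= 24 * e k / r.
  move=> kl; apply: nm_rows => [|v].
    by apply: divr_ge0 (ltW r0); apply: mulr_ge0.
  have := @hasd_bound _ _ _ (fun w => F k w - F l w) z0 (D k - D l) r (2 * e k) v r0.
  have -> : 12 * (2 * e k) / r = 24 * e k / r by ring.
  apply.
  - by move=> w hw; have [K1 h1] := hF k w hw; have [K2 h2] := hF l w hw;
      exists (K1 - K2); apply: hasdB.
  - move=> w hw; apply: le_trans (nm_tri (f w) _ _) _.
    rewrite [X in _ + X]nmBC; apply: le_trans (lerD (he _ _ hw) (he _ _ hw)) _.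
    have := emono _ _ kl; lra.
  - exact: hasdB.
have ge24 k : 0 <= 24 * e k / r by apply: divr_ge0 (ltW r0); apply: mulr_ge0.
have [L hL] := mx_cauchy ge24 Dc.
have {}hL k : nm (D k - L) <= 48 * e k / r.
  have := hL k; have -> // : 2 * (24 * e k / r) = 48 * e k / r by ring.
exists L; split; last first.
  by move=> k Lk hk; rewrite (hasd_uniq hk (hD k)).
have M0 : 0 <= M by apply: le_trans (nm_ge0 _) (hM 0%N _ z0r).
have [K hK] : exists K : R, K = 24 * 48 * M / r ^+ 2 by eexists.
have K0 : 0 <= K.
  rewrite hK; apply: divr_ge0; last by apply: exprn_ge0; apply: ltW.
  by apply: mulr_ge0 => //; apply: mulr_ge0.
(* The Taylor bound, uniform in [k], passes to [f]. The weight [B] collects the ways in which [e k]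
   enters: twice through values and once through the derivative. *)
have tay w : nm (w - z0) < r / 4 -> nm (f w - f z0 - (w - z0) *m L) <= K * nm (w - z0) ^+ 2.
  move=> hw; apply/ler_addgt0Pr => eta eta0.
  have [B hB] : exists B : R, B = 2 + n%:R * nm (w - z0) * (48 / r) by eexists.
  have B0 : 0 < B.
    by rewrite hB; apply: ltr_pwDl => //; rewrite !mulr_ge0 ?nm_ge0 ?invr_ge0 // ltW.
  have [k hk] := elim0 (eta / B) ltac:(by rewrite divr_gt0).
  have hwr : nm (w - z0) < r by lra.
  have T := taylor2 r0 (hF k) (hM k) (hD k) hw; rewrite -hK in T.
  have h1 := he k w hwr; have h2 := he k z0 z0r.
  have h3 := nm_mulmx (w - z0) (D k - L).
  have h4 : nm ((w - z0) *m (D k - L)) <= e k * (n%:R * nm (w - z0) * (48 / r)).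
    apply: le_trans h3 _.
    have -> : e k * (n%:R * nm (w - z0) * (48 / r)) = n%:R * nm (w - z0) * (48 * e k / r).
      by ring.
    by apply: ler_wpM2l (hL k); rewrite mulr_ge0 ?nm_ge0.
  have -> : f w - f z0 - (w - z0) *m L = (F k w - F k z0 - (w - z0) *m D k)
     - ((F k w - f w) - (F k z0 - f z0)) + (w - z0) *m (D k - L).
    rewrite mulmxBr; move: ((w - z0) *m D k) ((w - z0) *m L) => a b.
    by apply/rowP => i; rewrite !mxE; ring.
  apply: le_trans (nmD _ _) _; apply: le_trans (lerD (nmD _ _) h4) _.
  rewrite nmN; apply: le_trans (lerD (lerD T (nmD _ _)) (lexx _)) _; rewrite nmN.
  have : e k * B <= eta by rewrite -ler_pdivlMr.
  move: h1 h2; rewrite hB mulrDr; move: (nm (F k w - f w)) (nm (F k z0 - f z0)).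
  move: (e k * (_ * (48 / r))) (K * _) => p q s t; lra.
move=> eps eps0; exists (Num.min (r / 4) (eps / (K + 1))).
  by rewrite lt_min !divr_gt0 // ltr_wpDl.
move=> w; rewrite lt_min => /andP[w1 w2]; apply: le_trans (tay w w1) _.
rewrite expr2 mulrA; apply: ler_wpM2r; first exact: nm_ge0.
have K1 : 0 < K + 1 by lra.
move: w2; rewrite ltr_pdivlMr // => w2; have := nm_ge0 (w - z0).
move: w2; move: (nm _) => a; lra.
Qed.

End HolomorphicLimits.

(** * The holomorphic inverse function theorem *)

Section InverseFunction.
Variable R : realType.
Local Notation C := (Cx R).

(** Supplies the bound [M] that Cauchy's estimates ask for. *)
Lemma hasd_locally_bounded n m (f : 'rV[C]_n -> 'rV[C]_m) z L : hasd f z L ->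
  exists2 d : R, 0 < d & forall w, nm (w - z) < d -> nm (f w) <= nm (f z) + 1.
Proof.
move=> /hasd_lip[K [d [K0 d0 hd]]].
exists (Num.min d K^-1); first by rewrite lt_min d0 invr_gt0.
move=> w; rewrite lt_min => /andP[w1 w2]; rewrite -[f w](subrK (f z)) addrC.
apply: le_trans (nmD _ _) _; rewrite lerD2l; apply: le_trans (hd _ w1) _.
by rewrite mulrC -ler_pdivlMr // mul1r ltW.
Qed.

(** The derivative is Lipschitz at [z0] by [hasd_diff_bound], so close to [z0] the map [f] followed
    by the inverse of [L0] differs from the identity by a contraction. *)
Lemma near_identity n (f : 'rV[C]_n -> 'rV[C]_n) z0 (r : R) L0 : 0 < r ->
  holo f z0 r -> hasd f z0 L0 -> L0 \in unitmx ->
  exists rho : R, [/\ 0 < rho, rho <= r,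
    forall w L (v : 'rV[C]_n), nm (w - z0) < rho -> hasd f w L ->
      nm (v *m L *m invmx L0 - v) <= 1 / 2 * nm v &
    forall w w', nm (w - z0) < rho -> nm (w' - z0) < rho ->
      nm ((f w - f w') *m invmx L0 - (w - w')) <= 1 / 2 * nm (w - w')].
Proof.
move=> r0 hf hL hU.
have [d d0 hd] := hasd_locally_bounded hL.
have [r1 hr1] : exists r1 : R, r1 = Num.min r d by eexists.
have [r1r r1d r10] : [/\ r1 <= r, r1 <= d & 0 < r1].
  by rewrite hr1 !ge_min !lexx lt_min r0 d0 orbT.
have hf1 : holo f z0 r1 by move=> w hw; apply: hf; apply: lt_le_trans r1r.
have hM w : nm (w - z0) < r1 -> nm (f w) <= nm (f z0) + 1.
  by move=> hw; apply: hd; apply: lt_le_trans r1d.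
have [K hK] : exists K : R, K = 24 * 48 * (nm (f z0) + 1) / r1 ^+ 2 by eexists.
have K0 : 0 <= K.
  rewrite hK; apply: divr_ge0; last by apply: exprn_ge0; apply: ltW.
  by apply: mulr_ge0; [apply: mulr_ge0|apply: addr_ge0 => //; apply: nm_ge0].
have [D hD] : exists D : R, D = n%:R * nm (invmx L0) * K by eexists.
have D0 : 0 <= D by rewrite hD !mulr_ge0 ?nm_ge0.
pose rho := Num.min (r1 / 4) (1 / 2 / (D + 1)).
have rho0 : 0 < rho by rewrite lt_min !divr_gt0 // ltr_wpDl.
have bnd w L (v : 'rV[C]_n) : nm (w - z0) < rho -> hasd f w L ->
    nm (v *m L *m invmx L0 - v) <= 1 / 2 * nm v.
  rewrite lt_min => /andP[w1 w2] hLw.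
  have h := hasd_diff_bound v r10 hf1 hM w1 hL hLw; rewrite -hK in h.
  have -> : v *m L *m invmx L0 - v = v *m (L - L0) *m invmx L0.
    by rewrite mulmxBr mulmxBl -[v *m L0 *m _]mulmxA mulmxV // mulmx1.
  apply: le_trans (nm_mulmx _ _) _.
  have h2 : D * nm (w - z0) <= 1 / 2.
    move: w2; rewrite ltr_pdivlMr ?ltr_wpDl // => w2.
    by move: (nm_ge0 (w - z0)) w2; move: (nm _) => a; lra.
  apply: le_trans (_ : D * nm (w - z0) * nm v <= _); last first.
    by apply: ler_wpM2r h2; apply: nm_ge0.
  rewrite hD mulrAC -!mulrA; apply: ler_wpM2l => //; apply: ler_wpM2l; first exact: nm_ge0.
  by rewrite mulrA.
exists rho; split => //.
  apply: le_trans r1r; rewrite ge_min; apply/orP; left; lra.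
move=> w w' hw hw'.
have -> : (f w - f w') *m invmx L0 - (w - w') =
   (f w *m invmx L0 - w) - (f w' *m invmx L0 - w').
  rewrite mulmxBl; move: (f w *m _) (f w' *m _) => a b.
  by apply/rowP => i; rewrite !mxE; ring.
apply: (mean_value (f := fun u => f u *m invmx L0 - u)) => t ht.
have hp := ball_convex hw' hw ht.
have [L hLp] : exists L, hasd f (w' + t%:C *: (w - w')) L.
  apply: hf; apply: lt_le_trans hp _; apply: le_trans r1r.
  rewrite ge_min; apply/orP; left; lra.
exists (L *m invmx L0 - 1%:M).
  apply: hasdB; last exact: hasd_id.
  exact: (hasd_comp hLp (hasd_lin _ _)).
by rewrite mulmxBr mulmx1 mulmxA; apply: bnd hLp.
Qed.

(** Stated for an arbitrary left inverse [g], because the inverse is later produced by [inverse_on],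
    that is by choice, with no control off the image. *)
Lemma inverse_function n (f : 'rV[C]_n -> 'rV[C]_n) z0 (r : R) L0 : 0 < r ->
  holo f z0 r -> hasd f z0 L0 -> L0 \in unitmx ->
  exists rho0 : R, [/\ 0 < rho0, rho0 <= r & forall rho : R, 0 < rho -> rho <= rho0 ->
    [/\ forall w w', nm (w - z0) < rho -> nm (w' - z0) < rho -> f w = f w' -> w = w',
        open (f @` [set w | nm (w - z0) < rho]) &
        forall g, (forall w, nm (w - z0) < rho -> g (f w) = w) ->
          forall w, nm (w - z0) < rho -> exists L, hasd g (f w) L]].
Proof.
move=> r0 hf hL hU.
have [rho0 [p0 pr hD hlip]] := near_identity r0 hf hL hU.
exists rho0; split => // rho rhop rhole.
set A := invmx L0 in hD hlip *.
have inB w : nm (w - z0) < rho -> nm (w - z0) < rho0 by move/lt_le_trans; apply.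
have inv_lip w w' : nm (w - z0) < rho -> nm (w' - z0) < rho ->
    nm (w - w') <= 2 * nm ((f w - f w') *m A).
  move=> /inB h1 /inB h2; have := hlip _ _ h1 h2.
  have := nm_tri ((f w - f w') *m A) (w - w') 0; rewrite !subr0 nmBC.
  move: (nm _) (nm _) (nm _) => a b c; lra.
have inj w w' : nm (w - z0) < rho -> nm (w' - z0) < rho -> f w = f w' -> w = w'.
  move=> h1 h2 e; apply/eqP; rewrite -subr_eq0; apply/eqP/nm_eq0/eqP.
  have := inv_lip _ _ h1 h2; rewrite e subrr mul0mx nm0 mulr0 => h.
  by rewrite eq_le h nm_ge0.
(* Newton's iteration with frozen derivative [A]. Its steps halve, so they sum to [2 a], and
   [mx_cauchy] doubles this in the limit: hence the quarter of [s]. *)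
have surj w1 y (s : R) : 0 < s -> nm (w1 - z0) + s <= rho -> nm ((f w1 - y) *m A) < s / 4 ->
    exists2 w, nm (w - z0) < rho & f w = y.
  move=> s0 hs; set a := nm _ => ha.
  pose G w := w - (f w - y) *m A.
  have [u [u0 uS]] : exists u : nat -> 'rV[C]_n, u 0%N = w1 /\ forall k, u k.+1 = G (u k).
    by exists (fun k => iter k G w1).
  have a0 : 0 <= a := nm_ge0 _.
  have pow k : 0 < (2 ^+ k)^-1 :> R by rewrite invr_gt0 exprn_gt0.
  have ub k : nm (u k - w1) <= 2 * a * (1 - (2 ^+ k)^-1) /\ nm (u k.+1 - u k) <= a / 2 ^+ k.
    elim: k => [|k [IH1 IH2]].
      rewrite u0 uS u0 subrr nm0 expr0 invr1 subrr mulr0 mulr1 /G addrC addKr nmN.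
      by split.
    have n1 : nm (u k.+1 - w1) <= 2 * a * (1 - (2 ^+ k.+1)^-1).
      apply: le_trans (nm_tri (u k) _ _) _; apply: le_trans (lerD IH2 IH1) _.
      rewrite exprS invfM; move: (_^-1) => q; lra.
    have nb v (q : R) : 0 < q -> nm (v - w1) <= 2 * a * (1 - q) -> nm (v - z0) < rho0.
      move=> q0 hv; apply: inB; apply: le_lt_trans (nm_tri w1 _ _) _.
      move: hs hv; move: (nm (v - w1)) (nm (w1 - z0)) => p1 p2; nra.
    split => //; rewrite {1}uS [in X in _ - X]uS /G.
    have -> : u k.+1 - (f (u k.+1) - y) *m A - (u k - (f (u k) - y) *m A) =
       - ((f (u k.+1) - f (u k)) *m A - (u k.+1 - u k)).
      rewrite !mulmxBl; move: (f _ *m A) (f _ *m A) (y *m A) => b c d.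
      by apply/rowP => i; rewrite !mxE; ring.
    rewrite nmN; apply: le_trans (hlip _ _ (nb _ _ (pow _) n1) (nb _ _ (pow _) IH1)) _.
    rewrite exprS invfM; move: IH2; move: (nm (u k.+1 - u k)) ((2 ^+ k)^-1) => p1 q; lra.
  have uc k l : (k <= l)%N -> nm (u k - u l) <= 2 * a * (2 ^+ k)^-1.
    move=> kl; rewrite -(subnKC kl); move: (l - k)%N => j {kl}.
    suff : nm (u k - u (k + j)%N) <= 2 * a * ((2 ^+ k)^-1 - (2 ^+ (k + j))^-1).
      move/le_trans; apply; apply: ler_wpM2l; first exact: mulr_ge0.
      by have := pow (k + j)%N; lra.
    elim: j => [|j IH]; first by rewrite addn0 !subrr nm0 mulr0.
    rewrite addnS; apply: le_trans (nm_tri (u (k + j)%N) _ _) _.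
    rewrite [X in _ + X]nmBC; have [_ h] := ub (k + j)%N; apply: le_trans (lerD IH h) _.
    rewrite exprS invfM; move: (_^-1) (_^-1) => q1 q2; lra.
  have p2a k : 0 <= 2 * a * (2 ^+ k)^-1.
    by apply: mulr_ge0; [exact: mulr_ge0|exact: ltW].
  have [w hw] := mx_cauchy p2a uc.
  have wB : nm (w - z0) < rho.
    have := hw 0%N; rewrite u0 expr0 invr1 mulr1 nmBC => h.
    apply: le_lt_trans (nm_tri w1 _ _) _; move: hs h ha; move: (nm _) (nm _) => p1 p2; lra.
  exists w => //.
  suff Z : (f w - y) *m A = 0.
    apply/eqP; rewrite -subr_eq0; apply/eqP.
    by rewrite -[f w - y]mulmx1 -(mulVmx hU) mulmxA Z mul0mx.
  apply/nm_eq0/eqP; rewrite eq_le nm_ge0 andbT; apply/ler_addgt0Pr => eta eta0.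
  rewrite add0r.
  have [k hk] : exists k, 9 * a * (2 ^+ k)^-1 <= eta.
    exists (Num.truncn (9 * a / eta)); rewrite ler_pdivrMr ?exprn_gt0 // [eta * _]mulrC.
    rewrite -ler_pdivrMr //; apply: ltW; apply: lt_le_trans (truncnS_gt _) _.
    move: (Num.truncn _) => j; have : (j.+1%:R <= (2 ^ j)%:R :> R) by rewrite ler_nat ltn_expl.
    by rewrite natrX.
  have ukB : nm (u k - z0) < rho.
    have [h _] := ub k; apply: le_lt_trans (nm_tri w1 _ _) _.
    have := pow k; move: h hs; move: (nm _) (nm _) (_^-1) => p1 p2 q; nra.
  have h1 := hlip _ _ (inB _ wB) (inB _ ukB).
  have h2 := hw k; rewrite nmBC in h2; have [_ h3] := ub k.
  have E : (f (u k) - y) *m A = - (u k.+1 - u k) by rewrite uS /G addrAC subrr sub0r opprK.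
  have -> : (f w - y) *m A = ((f w - f (u k)) *m A - (w - u k)) + (w - u k) - (u k.+1 - u k).
    by rewrite -E subrK -mulmxDl addrA subrK.
  apply: le_trans (nmD _ _) _; apply: le_trans (lerD (nmD _ _) (lexx _)) _; rewrite nmN.
  apply: le_trans hk; have := mulr_ge0 a0 (ltW (pow k)); move: h1 h2 h3.
  move: (nm _) (nm (w - u k)) (nm (u k.+1 - u k)) ((2 ^+ k)^-1) => p1 p2 p3 q.
  clearbody a; clear; lra.
have opn : open (f @` [set w | nm (w - z0) < rho]).
  apply/open_nm => _ [w1 /= hw1 <-].
  pose s := rho - nm (w1 - z0).
  have s0 : 0 < s by rewrite subr_gt0.
  have B0 : 0 < n%:R * nm A + 1 by rewrite ltr_wpDl // mulr_ge0 ?nm_ge0.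
  exists (s / 4 / (n%:R * nm A + 1)); first by rewrite !divr_gt0.
  move=> y; rewrite ltr_pdivlMr // => hy.
  have [||w hw e] := @surj w1 y s s0; last by exists w.
    by rewrite /s addrC subrK.
  apply: le_lt_trans (nm_mulmx _ _) _; apply: le_lt_trans hy; rewrite nmBC.
  by rewrite mulrAC mulrC; apply: ler_wpM2l; rewrite ?nm_ge0 // lerDl.
split => // g gf w1 hw1.
have [L1 hL1] := hf w1 (lt_le_trans (inB _ hw1) pr).
(* A kernel vector [v] of [L1] would satisfy [nm v <= nm v / 2]. *)
have U1 : L1 \in unitmx.
  rewrite -row_free_unit; apply: inj_row_free => v v0.
  have := hD _ _ v (inB _ hw1) hL1; rewrite v0 mul0mx sub0r nmN => h.
  apply/nm_eq0/eqP; rewrite eq_le nm_ge0 andbT.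
  by move: h; move: (nm v) => a; lra.
exists (invmx L1) => e e0.
have [c hc] : exists c : R, c = 2 * (n%:R * nm A) + 1 by eexists.
have c0 : 0 < c by rewrite hc ltr_wpDl // !mulr_ge0 ?nm_ge0.
have [b hb] : exists b : R, b = n%:R * nm (invmx L1) + 1 by eexists.
have b0 : 0 < b by rewrite hb ltr_wpDl // !mulr_ge0 ?nm_ge0.
have [d d0 hd] := hL1 (e / b / c) ltac:(by rewrite !divr_gt0).
have [d' d'0 hd'] := (open_nm _).1 opn (f w1) ltac:(by exists w1).
exists (Num.min d' (d / c)); first by rewrite lt_min d'0 divr_gt0.
move=> y; rewrite lt_min => /andP[/hd'[w /= hw <-]] h2.
rewrite !gf //.
have wl : nm (w - w1) <= c * nm (f w - f w1).
  apply: le_trans (inv_lip _ _ hw hw1) _; apply: le_trans (ler_wpM2l _ (nm_mulmx _ _)) _ => //.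
  rewrite hc; move: (nm_ge0 (f w - f w1)); move: (nm (f w - f w1)) (nm A) => p q; lra.
have wd : nm (w - w1) < d.
  by apply: le_lt_trans wl _; rewrite mulrC -ltr_pdivlMr.
have -> : w - w1 - (f w - f w1) *m invmx L1 = - ((f w - f w1 - (w - w1) *m L1) *m invmx L1).
  by rewrite (mulmxBl (f w - f w1)) -[(w - w1) *m L1 *m _]mulmxA mulmxV // mulmx1 opprB.
rewrite nmN; apply: le_trans (nm_mulmx _ _) _.
have h3 := le_trans (hd _ wd) (ler_wpM2l (ltW (divr_gt0 (divr_gt0 e0 b0) c0)) wl).
apply: (@le_trans _ _ (b * (e / b / c * (c * nm (f w - f w1))))).
  rewrite mulrAC; apply: ler_pM; rewrite ?mulr_ge0 ?nm_ge0 //.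
  by rewrite hb lerDl.
by rewrite le_eqVlt; apply/orP; left; apply/eqP; field; rewrite !gt_eqF.
Qed.

End InverseFunction.

(** * Holomorphic dependence of solutions of an ODE *)

Section EulerScheme.
Variable R : realType.
Local Notation C := (Cx R).

(** Error accumulation in a one-step method on a time interval of length 1. With [c <= 1 / 2] the
    amplification of old errors is paid by doubling [b], so the bound stays linear in [j]. *)
Lemma discrete_gronwall (a : nat -> R) (c b q : R) : 0 <= b -> 0 < q -> c <= 1 / 2 ->
  a 0%N <= 0 ->
  (forall j, j.+1%:R * q <= 1 -> a j.+1 <= a j + c * q * a j + b * q ^+ 2) ->
  (forall j, 0 <= a j) ->
  forall j, j%:R * q <= 1 -> a j <= 2 * b * j%:R * q ^+ 2.
Proof.
move=> b0 q0 c2 a0 aS ap; elim=> [|j IH] hj; first by rewrite mulr0 mul0r.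
have hj' : j%:R * q < 1.
  by apply: lt_le_trans hj; rewrite ltr_pM2r // ltr_nat.
apply: le_trans (aS j hj) _.
have {}IH := IH (ltW hj').
have e1 : c * q * a j <= 1 / 2 * q * a j.
  by apply: ler_wpM2r => //; apply: ler_wpM2r => //; apply: ltW.
have e2 : 1 / 2 * q * a j <= 1 / 2 * q * (2 * b * j%:R * q ^+ 2).
  by apply: ler_wpM2l => //; lra.
have e3 : b * q ^+ 2 * (j%:R * q) <= b * q ^+ 2 * 1.
  by apply: ler_wpM2l (ltW hj'); rewrite mulr_ge0 // sqr_ge0.
have e4 : 1 / 2 * q * (2 * b * j%:R * q ^+ 2) = b * q ^+ 2 * (j%:R * q) by field.
have -> : 2 * b * j.+1%:R * q ^+ 2 = 2 * b * j%:R * q ^+ 2 + 2 * (b * q ^+ 2).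
  by rewrite -natr1; ring.
lra.
Qed.

Lemma mul_delta0 n m (v : 'rV[C]_m.+1) (u : 'rV[C]_n) :
  v *m ((delta_mx 0 0 : 'cV[C]_m.+1) *m u) = v 0 0 *: u.
Proof. by rewrite mulmxA -colE [col 0 v]mx11_scalar mul_scalar_mx mxE. Qed.

Lemma hasd_scale_coord n m (F : 'rV[C]_m.+1 -> 'rV[C]_n) (c : C) w L : hasd F w L ->
  hasd (fun u => (c * u 0 0) *: F u) w
    (c *: ((delta_mx 0 0 : 'cV[C]_m.+1) *m F w) + (c * w 0 0) *: L).
Proof.
move=> hF e e0.
have A0 : 0 < nm c * (nm w + 1) + 1.
  by apply: ltr_wpDl => //; apply: mulr_ge0; rewrite ?addr_ge0 ?nm_ge0.
have [A hA] : exists A : R, A = nm c * (nm w + 1) + 1 by eexists.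
have B0 : 0 < nm c * m.+1%:R * nm L + 1.
  by apply: ltr_wpDl => //; rewrite !mulr_ge0 ?nm_ge0.
have [B hB] : exists B : R, B = nm c * m.+1%:R * nm L + 1 by eexists.
rewrite -hA in A0; rewrite -hB in B0.
have [d d0 hd] := hF (e / 2 / A) ltac:(by rewrite !divr_gt0).
exists (Num.min (Num.min d 1) (e / 2 / B)); first by rewrite !lt_min d0 ltr01 !divr_gt0.
move=> u; rewrite !lt_min => /andP[/andP[u1 u2] u3].
have -> : (c * u 0 0) *: F u - (c * w 0 0) *: F w
   - (u - w) *m (c *: ((delta_mx 0 0 : 'cV[C]_m.+1) *m F w) + (c * w 0 0) *: L) =
  (c * u 0 0) *: (F u - F w - (u - w) *m L) + (c * (u - w) 0 0) *: ((u - w) *m L).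
  rewrite mulmxDr -!scalemxAr mul_delta0 !mxE; move: ((u - w) *m L) => t.
  by apply/rowP => i; rewrite !mxE; ring.
have h1 := hd u u1; have h2 := nm_mulmx (u - w) L.
have h3 : nm (u 0 0) <= nm w + 1.
  apply: le_trans (nm_entry _ _ _) _; rewrite -[u](subrK w) addrC.
  by apply: le_trans (nmD _ _) _; rewrite lerD2l ltW.
have h4 := nm_entry (u - w) 0 0.
apply: le_trans (nmD _ _) _; rewrite !nmZ ?nmM (splitr e) mulrDl; apply: lerD.
  apply: (@le_trans _ _ (A * (e / 2 / A * nm (u - w)))).
    apply: ler_pM => //; rewrite ?mulr_ge0 ?nm_ge0 //.
    apply: le_trans (ler_wpM2l (nm_ge0 c) h3) _; by rewrite hA lerDl.
  by rewrite le_eqVlt; apply/orP; left; apply/eqP; field; rewrite gt_eqF.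
apply: (@le_trans _ _ (B * nm (u - w) * nm (u - w))); last first.
  apply: ler_wpM2r; first exact: nm_ge0.
  by rewrite mulrC -ler_pdivlMr // ltW.
apply: (@le_trans _ _ (nm c * nm (u - w) * (m.+1%:R * nm (u - w) * nm L))).
  apply: ler_pM => //; rewrite ?mulr_ge0 ?nm_ge0 //.
  by apply: ler_wpM2l h4; apply: nm_ge0.
have -> : nm c * nm (u - w) * (m.+1%:R * nm (u - w) * nm L) =
  nm c * m.+1%:R * nm L * nm (u - w) * nm (u - w) by ring.
apply: ler_wpM2r; first exact: nm_ge0.
apply: ler_wpM2r; first exact: nm_ge0.
by rewrite hB lerDl.
Qed.

Section Scheme.
Variables (n m : nat) (V : 'rV[C]_n -> 'rV[C]_n) (sigma : 'rV[C]_m.+1 -> 'rV[C]_n).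

Implicit Types (w : 'rV[C]_m.+1) (v : 'rV[C]_n).

(* Euler's method with step q * w_0, started at sigma w; as a composition of
   holomorphic maps it is holomorphic in w. *)
Fixpoint euler (q : R) (j : nat) (w : 'rV[C]_m.+1) : 'rV[C]_n :=
  if j is j'.+1 then euler q j' w + (q%:C * w 0 0) *: V (euler q j' w)
  else sigma w.

Variables (z0 : 'rV[C]_n) (r M rho K Q : R).
Hypotheses (r0 : 0 < r) (rho0 : 0 < rho) (M0 : 0 <= M) (K0 : 0 <= K) (Q0 : 0 <= Q).
Hypothesis hV : holo V z0 r.
Hypothesis V_le : forall z, nm (z - z0) < r -> nm (V z) <= M.
Hypothesis V_lip : forall z z', nm (z - z0) < r -> nm (z' - z0) < r ->
  nm (V z' - V z) <= K * nm (z' - z).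
Hypothesis V_der : forall z L (v : 'rV[C]_n), nm (z - z0) < r -> hasd V z L ->
  nm (v *m L) <= K * nm v.
Hypothesis V_taylor : forall z z' L, nm (z - z0) < r -> nm (z' - z0) < r ->
  hasd V z L -> nm (V z' - V z - (z' - z) *m L) <= Q * nm (z' - z) ^+ 2.
(** Coordinate 0 of [w] is the complex time, the others parametrize initial points; so [sigma] has
    no derivative in direction 0. Of the bounds on [rho] below, one keeps the polygons in the ball
    and the other is the condition of [discrete_gronwall]. *)
Hypothesis sigma_der : forall w, nm w < rho ->
  exists2 L, hasd sigma w L & (delta_mx 0 0 : 'rV_m.+1) *m L = 0.
Hypothesis sigma_near : forall w, nm w < rho -> nm (sigma w - z0) < r / 2.
Hypotheses (rhoM : rho * M <= r / 4) (rhoK : rho * K <= 1 / 2).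

Lemma step_le (q : R) w v : 0 <= q -> nm w < rho ->
  nm ((q%:C * w 0 0) *: v : 'rV[C]_n) <= q * rho * nm v.
Proof.
move=> q0 hw; rewrite nmZ nmM nmR ger0_norm //.
apply: ler_wpM2r; first exact: nm_ge0.
by apply: ler_wpM2l => //; apply: le_trans (nm_entry _ _ _) (ltW hw).
Qed.

Lemma euler_near q j w : 0 < q -> nm w < rho -> j%:R * q <= 1 ->
  nm (euler q j w - z0) < r.
Proof.
move=> q0 hw hj.
suff : nm (euler q j w - z0) < r / 2 + j%:R * q * (rho * M).
  move/lt_le_trans; apply.
  have := ler_wpM2r (mulr_ge0 (ltW rho0) M0) hj; rewrite mul1r.
  by have := rhoM; have := r0; lra.
elim: j hj => [|j IH] hj /=; first by rewrite mul0r mul0r addr0; apply: sigma_near.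
have hj' : j%:R * q <= 1.
  by apply: le_trans hj; rewrite ler_pM2r // ler_nat.
have {}IH := IH hj'.
have xr : nm (euler q j w - z0) < r.
  apply: lt_le_trans IH _; have := ler_wpM2r (mulr_ge0 (ltW rho0) M0) hj'; rewrite mul1r.
  by have := rhoM; have := r0; lra.
rewrite addrAC; apply: le_lt_trans (nmD _ _) _.
have s := le_trans (step_le (V (euler q j w)) (ltW q0) hw)
  (ler_wpM2l (mulr_ge0 (ltW q0) (ltW rho0)) (V_le xr)).
have -> : j.+1%:R * q * (rho * M) = j%:R * q * (rho * M) + q * rho * M.
  by rewrite -natr1; ring.
by rewrite addrA; apply: ltr_leD.
Qed.

(** Two half steps differ from a full step to second order in [q]. For [j * q <= 1] the total is of
    order [q], which is summable over [q = 2^-k]. *)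
Lemma euler_halve q j w : 0 < q -> nm w < rho -> j%:R * q <= 1 ->
  nm (euler q j w - euler (q / 2) j.*2 w) <= 2 * (rho ^+ 2 * K * M) * j%:R * q ^+ 2.
Proof.
move=> q0 hw; move: j.
have b0 : 0 <= rho ^+ 2 * K * M.
  by apply: mulr_ge0 => //; apply: mulr_ge0 => //; apply: sqr_ge0.
apply: (discrete_gronwall (a := fun j => nm (euler q j w - euler (q / 2) j.*2 w))
   b0 q0 rhoK) => [|j hj|j]; first 2 last.
- exact: nm_ge0.
- by rewrite /= subrr nm0.
have q20 : 0 < q / 2 by lra.
have hj1 : j%:R * q <= 1 by apply: le_trans hj; rewrite ler_pM2r // ler_nat.
have xr := euler_near q0 hw hj1.
have hj2 : j.*2.+1%:R * (q / 2) <= 1.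
  apply: le_trans hj.
  have -> : j.*2.+1%:R = 2 * j%:R + 1 :> R by rewrite -natr1 -mul2n natrM.
  have -> : j.+1%:R = j%:R + 1 :> R by rewrite natr1.
  lra.
have yr : nm (euler (q / 2) j.*2 w - z0) < r.
  apply: euler_near => //; apply: le_trans hj2; rewrite ler_pM2r // ler_nat //.
have zr : nm (euler (q / 2) j.*2.+1 w - z0) < r by apply: euler_near.
have E2 : euler (q / 2) j.+1.*2 w = euler (q / 2) j.*2 w +
    ((q / 2)%:C * w 0 0) *: V (euler (q / 2) j.*2 w) +
    ((q / 2)%:C * w 0 0) *: V (euler (q / 2) j.*2.+1 w).
  by rewrite doubleS.
rewrite E2 [euler q j.+1 w]/=.
have dyz : nm (euler (q / 2) j.*2.+1 w - euler (q / 2) j.*2 w) <= q / 2 * rho * M.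
  rewrite [euler _ j.*2.+1 _]/= addrC addKr.
  apply: le_trans (step_le _ (ltW q20) hw) _.
  by apply: ler_wpM2l (V_le yr); rewrite mulr_ge0 // ltW.
have K1 := V_lip yr zr; have K2 := V_lip yr xr.
move: (euler q j w) (euler (q / 2) j.*2 w) (euler (q / 2) j.*2.+1 w) xr yr zr dyz K1 K2.
move=> x y z xr yr zr dyz K1 K2.
have -> : x + (q%:C * w 0 0) *: V x - (y + ((q / 2)%:C * w 0 0) *: V y + ((q / 2)%:C * w 0 0) *: V z)
  = (x - y) + (q%:C * w 0 0) *: (V x - V y) - ((q / 2)%:C * w 0 0) *: (V z - V y).
  have -> : q%:C = (q / 2)%:C + (q / 2)%:C :> C by rewrite -rmorphD -splitr.
  by apply/rowP => i; rewrite !mxE; ring.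
apply: le_trans (nmD _ _) _; rewrite nmN.
apply: le_trans (lerD (nmD _ _) (lexx _)) _.
have s1 := le_trans (step_le (V x - V y) (ltW q0) hw)
  (ler_wpM2l (mulr_ge0 (ltW q0) (ltW rho0)) K2).
have s2 := le_trans (step_le (V z - V y) (ltW q20) hw)
  (ler_wpM2l (mulr_ge0 (ltW q20) (ltW rho0)) K1).
have s3 := ler_wpM2l (mulr_ge0 (mulr_ge0 (ltW q20) (ltW rho0)) K0) dyz.
apply: lerD.
  by rewrite lerD2l; apply: le_trans s1 _; rewrite le_eqVlt; apply/orP; left; apply/eqP; ring.
apply: le_trans s2 _; rewrite mulrA; apply: le_trans s3 _.
have -> : q / 2 * rho * K * (q / 2 * rho * M) = (rho ^+ 2 * K * M * q ^+ 2) / 4 by field.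
by move: (mulr_ge0 b0 (sqr_ge0 q)); move: (_ * q ^+ 2) => p; lra.
Qed.

Lemma euler_hasd q j w : 0 < q -> nm w < rho -> j%:R * q <= 1 ->
  exists L, hasd (euler q j) w L.
Proof.
move=> q0 hw; elim: j => [|j IH] hj.
  by have [L hL _] := sigma_der hw; exists L.
have hj1 : j%:R * q <= 1 by apply: le_trans hj; rewrite ler_pM2r // ler_nat.
have [L hL] := IH hj1; have [D hD] := hV (euler_near q0 hw hj1).
eexists; apply: (hasdD hL); apply: (hasd_scale_coord (F := V \o euler q j)).
exact: hasd_comp hL hD.
Qed.

(** After [j] steps the polygon has reached time [j q w_0], so its derivative in [w_0] should be
    near [j q V]. The defect obeys a Gronwall recursion driven by the Taylor remainder of [V] (the
    [Q] term) and the change of [V] over one step (the [K] term). *)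
Lemma euler_der q j w L : 0 < q -> nm w < rho -> j%:R * q <= 1 ->
  hasd (euler q j) w L ->
  nm ((delta_mx 0 0 : 'rV_m.+1) *m L - (j%:R * q)%:C *: V (euler q j w))
    <= 2 * (Q * (rho * M) ^+ 2 + K * rho * M) * j%:R * q ^+ 2.
Proof.
move=> q0 hw.
have ex i : exists L, i%:R * q <= 1 -> hasd (euler q i) w L.
  have [h|h] := leP (i%:R * q) 1; last by exists 0.
  by have [D hD] := euler_hasd q0 hw h; exists D.
have [G hG] := choice ex.
move=> hj hL; rewrite (hasd_uniq hL (hG j hj)); clear L hL; move: j hj.
have b0 : 0 <= Q * (rho * M) ^+ 2 + K * rho * M.
  apply: addr_ge0; first by apply: mulr_ge0 => //; apply: sqr_ge0.
  by apply: mulr_ge0 => //; apply: mulr_ge0 => //; apply: ltW.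
apply: (discrete_gronwall (a := fun j => nm ((delta_mx 0 0 : 'rV_m.+1) *m G j -
   (j%:R * q)%:C *: V (euler q j w))) b0 q0 rhoK) => [|j hj|j]; first 2 last.
- exact: nm_ge0.
- have h0 : (0%:R * q : R) <= 1 by rewrite mul0r.
  have [L1 hL1 L0] := sigma_der hw.
  by rewrite (hasd_uniq (hG 0%N h0) hL1) L0 mul0r scale0r subrr nm0.
have hj1 : j%:R * q <= 1 by apply: le_trans hj; rewrite ler_pM2r // ler_nat.
have xr := euler_near q0 hw hj1; have yr := euler_near q0 hw hj.
have [D hD] := hV xr.
have hS : hasd (euler q j.+1) w (G j + (q%:C *: ((delta_mx 0 0 : 'cV[C]_m.+1) *m V (euler q j w)) +
   (q%:C * w 0 0) *: (G j *m D))).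
  apply: hasdD (hG j hj1) _; apply: (hasd_scale_coord (F := V \o euler q j)).
  exact: hasd_comp (hG j hj1) hD.
rewrite (hasd_uniq (hG j.+1 hj) hS) !mulmxDr -!scalemxAr mul_delta0 mulmxA !mxE !eqxx scale1r.
have xy : euler q j.+1 w - euler q j w = (q%:C * w 0 0) *: V (euler q j w).
  by rewrite /= addrC addKr.
have T := V_taylor xr yr hD; rewrite xy -scalemxAl in T.
have Lp := V_lip xr yr; rewrite xy in Lp.
have st := le_trans (step_le (V (euler q j w)) (ltW q0) hw)
  (ler_wpM2l (mulr_ge0 (ltW q0) (ltW rho0)) (V_le xr)).
move: (euler q j w) (euler q j.+1 w) xr yr D hD T Lp st (_ *m G j) {xy hS} => x y xr yr D hD T Lp st g.
have [jq hjq] : exists jq : R, jq = j%:R * q by eexists.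
have -> : j.+1%:R * q = jq + q by rewrite hjq -natr1; ring.
rewrite -hjq rmorphD /=.
have jq0 : 0 <= jq by rewrite hjq mulr_ge0 // ltW.
have jq1 : jq <= 1 by rewrite hjq.
have [t ht] : exists t : C, t = q%:C * w 0 0 by eexists.
rewrite -ht in T Lp st *.
have -> : g + (q%:C *: V x + t *: (g *m D)) - (jq%:C + q%:C) *: V y =
   (g - jq%:C *: V x) + t *: ((g - jq%:C *: V x) *m D)
   - jq%:C *: (V y - V x - t *: (V x *m D)) - q%:C *: (V y - V x).
  rewrite mulmxBl -scalemxAl; move: (g *m D) (V x *m D) => p1 p2.
  by apply/rowP => i; rewrite !mxE; ring.
have e1 : nm (t *: ((g - jq%:C *: V x) *m D)) <= rho * K * q * nm (g - jq%:C *: V x).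
  rewrite ht; apply: le_trans (step_le _ (ltW q0) hw) _.
  have -> : rho * K * q * nm (g - jq%:C *: V x) = q * rho * (K * nm (g - jq%:C *: V x)) by ring.
  by apply: ler_wpM2l (V_der _ xr hD); rewrite mulr_ge0 // ltW.
have tV0 := nm_ge0 (t *: V x).
have e2 : nm (jq%:C *: (V y - V x - t *: (V x *m D))) <= Q * (rho * M) ^+ 2 * q ^+ 2.
  rewrite nmZ nmR ger0_norm //; apply: le_trans (ler_piMl (nm_ge0 _) jq1) _.
  apply: le_trans T _; rewrite -mulrA -exprMn; apply: ler_wpM2l => //.
  rewrite lerXn2r ?nnegrE //; first by apply: mulr_ge0 (ltW q0); apply: mulr_ge0 => //; apply: ltW.
  by apply: le_trans st _; rewrite [leRHS]mulrC mulrA.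
have e3 : nm (q%:C *: (V y - V x)) <= K * rho * M * q ^+ 2.
  rewrite nmZ nmR gtr0_norm //; apply: le_trans (ler_wpM2l (ltW q0) Lp) _.
  apply: le_trans (ler_wpM2l (ltW q0) (ler_wpM2l K0 st)) _.
  by rewrite le_eqVlt; apply/orP; left; apply/eqP; ring.
apply: le_trans (nmD _ _) _; rewrite nmN mulrDl addrA; apply: lerD e3.
apply: le_trans (nmD _ _) _; rewrite nmN; apply: lerD e2.
by apply: le_trans (nmD _ _) _; rewrite lerD2l.
Qed.

End Scheme.

Lemma pow2_small (B eta : R) : 0 <= B -> 0 < eta -> exists k, B * (2 ^+ k)^-1 <= eta.
Proof.
move=> B0 eta0; exists (Num.truncn (B / eta)).
rewrite ler_pdivrMr ?exprn_gt0 // [eta * _]mulrC -ler_pdivrMr //.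
apply: ltW; apply: lt_le_trans (truncnS_gt _) _.
move: (Num.truncn _) => j; have : (j.+1%:R <= (2 ^ j)%:R :> R) by rewrite ler_nat ltn_expl.
by rewrite natrX.
Qed.

(** Level [k] takes [2^k] steps of size [2^-k w_0], so every polygon ends at time [w_0].
    [euler_halve] gives the limit, [holo_limit] its derivative, and [euler_der] with [j q = 1] the
    differential equation, expressed as a derivative in direction 0. *)
Theorem holomorphic_flow n m (V : 'rV[C]_n -> 'rV[C]_n) z0 (r : R)
    (sigma : 'rV[C]_m.+1 -> 'rV[C]_n) (r' : R) :
  0 < r -> holo V z0 r -> 0 < r' -> sigma 0 = z0 ->
  (forall w, nm w < r' -> exists2 L, hasd sigma w L & (delta_mx 0 0 : 'rV_m.+1) *m L = 0) ->
  exists rho : R, [/\ 0 < rho, rho <= r' & exists eta : 'rV[C]_m.+1 -> 'rV[C]_n,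
    forall w, nm w < rho ->
    [/\ nm (eta w - z0) < r, w 0 0 = 0 -> eta w = sigma w &
        exists2 L, hasd eta w L & (delta_mx 0 0 : 'rV_m.+1) *m L = V (eta w)]].
Proof.
move=> r0 hV r'0 sig0 hsig.
have z0r : nm (z0 - z0) < r by rewrite subrr nm0.
have [D0 hD0] := hV z0 z0r.
have [d d0 hd] := hasd_locally_bounded hD0.
have [M hM] : exists M : R, M = nm (V z0) + 1 by eexists.
have M0 : 0 < M by rewrite hM ltr_wpDl ?nm_ge0.
rewrite -hM in hd.
have [r2 hr2] : exists r2 : R, r2 = Num.min r d by eexists.
have [r2r r2d r20] : [/\ r2 <= r, r2 <= d & 0 < r2].
  by rewrite hr2 !ge_min !lexx lt_min r0 d0 orbT.
have hV2 : holo V z0 r2 by move=> w hw; apply: hV; apply: lt_le_trans r2r.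
have V2M w : nm (w - z0) < r2 -> nm (V w) <= M.
  by move=> hw; apply: hd; apply: lt_le_trans r2d.
have [K hK] : exists K : R, K = 24 * M / r2 by eexists.
have K0 : 0 < K by rewrite hK; apply: divr_gt0 => //; apply: mulr_gt0.
have [Q hQ] : exists Q : R, Q = 24 * 48 * M / (r2 / 2) ^+ 2 by eexists.
have Q0 : 0 <= Q.
  rewrite hQ; apply: divr_ge0; last exact: sqr_ge0.
  by apply: mulr_ge0 (ltW M0); apply: mulr_ge0.
(* Two points within [r2 / 16] of [z0] are less than [(r2 / 2) / 4] apart, as [taylor2] on a ball of
   radius [r2 / 2] demands. *)
have [r3 hr3] : exists r3 : R, r3 = r2 / 16 by eexists.
have r30 : 0 < r3 by lra.
have hV3 : holo V z0 r3 by move=> w hw; apply: hV2; lra.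
have V_le z : nm (z - z0) < r3 -> nm (V z) <= M by move=> hz; apply: V2M; lra.
have V_lip z z' : nm (z - z0) < r3 -> nm (z' - z0) < r3 -> nm (V z' - V z) <= K * nm (z' - z).
  by move=> hz hz'; rewrite hK; apply: (holo_lip r20 hV2 V2M); lra.
have sub z : nm (z - z0) < r3 -> holo V z (r2 / 2) /\
    forall w, nm (w - z) < r2 / 2 -> nm (V w) <= M.
  move=> hz; split; first by apply: holo_sub hV2 _; lra.
  by move=> w hw; apply: V2M; apply: le_lt_trans (nm_tri z _ _) _; lra.
have r220 : 0 < r2 / 2 by lra.
have V_der z L (v : 'rV[C]_n) : nm (z - z0) < r3 -> hasd V z L -> nm (v *m L) <= K * nm v.
  move=> /sub[h1 h2] hL; have := hasd_bound v r220 h1 h2 hL.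
  by have -> // : 12 * M / (r2 / 2) = K by rewrite hK; field; rewrite gt_eqF.
have V_taylor z z' L : nm (z - z0) < r3 -> nm (z' - z0) < r3 -> hasd V z L ->
    nm (V z' - V z - (z' - z) *m L) <= Q * nm (z' - z) ^+ 2.
  move=> hz hz' hL; have [h1 h2] := sub z hz; rewrite hQ; apply: (taylor2 r220 h1 h2 hL).
  by apply: le_lt_trans (nm_tri z0 _ _) _; rewrite [X in _ + X]nmBC; lra.
have [d' d'0 hd'] : exists2 d' : R, 0 < d' & forall w, nm w < d' -> nm (sigma w - z0) < r3 / 2.
  have n00 : nm (0 : 'rV[C]_m.+1) < r' by rewrite nm0.
  have [L hL _] := hsig 0 n00.
  have [k [e [k0 e0 he]]] := hasd_lip hL.
  exists (Num.min e (r3 / 2 / k)); first by rewrite lt_min e0 !divr_gt0.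
  move=> w; rewrite lt_min => /andP[w1 w2]; rewrite -sig0.
  have := he w; rewrite subr0 => /(_ w1) h; apply: le_lt_trans h _.
  by rewrite mulrC -ltr_pdivlMr.
have [rho hrho] : exists rho : R, rho = Num.min (Num.min r' d') (Num.min (r3 / 4 / M) (1 / 2 / K)).
  by eexists.
have [rho0 rhor' rhod' rhoM rhoK] : [/\ 0 < rho, rho <= r', rho <= d', rho * M <= r3 / 4 & rho * K <= 1 / 2].
  rewrite hrho -!ler_pdivlMr // !ge_min !lexx !lt_min r'0 d'0 !divr_gt0 //.
  by rewrite !orbT.
have sder w : nm w < rho -> exists2 L, hasd sigma w L & (delta_mx 0 0 : 'rV_m.+1) *m L = 0.
  by move=> hw; apply: hsig; apply: lt_le_trans rhor'.
have snear w : nm w < rho -> nm (sigma w - z0) < r3 / 2.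
  by move=> hw; apply: hd'; apply: lt_le_trans rhod'.
exists rho; split => //.
pose q k : R := (2 ^+ k)^-1.
have q0 k : 0 < q k by rewrite invr_gt0 exprn_gt0.
have Nq k : (2 ^ k)%:R * q k = 1 by rewrite natrX /q divff // expf_neq0.
have Nq1 k : (2 ^ k)%:R * q k <= 1 by rewrite Nq.
pose X k w := euler V sigma (q k) (2 ^ k) w.
have qS k : q k.+1 = q k / 2 by rewrite /q exprS invfM mulrC.
have [B hB] : exists B : R, B = rho ^+ 2 * K * M by eexists.
have B0 : 0 <= B.
  by rewrite hB; apply: mulr_ge0 (ltW M0); apply: mulr_ge0 (ltW K0); apply: sqr_ge0.
have Xnear k w : nm w < rho -> nm (X k w - z0) < r3.
  by move=> hw; apply: (euler_near (n := n) r30 rho0 (ltW M0) V_le snear rhoM (q0 k) hw (Nq1 k)).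
have XS k w : nm w < rho -> nm (X k w - X k.+1 w) <= 2 * B * q k.
  move=> hw; have := euler_halve r30 rho0 (ltW M0) (ltW K0) V_le V_lip snear rhoM rhoK
    (q0 k) hw (Nq1 k).
  rewrite -hB /X qS expnS mul2n; move/le_trans; apply.
  have -> : 2 * B * (2 ^ k)%:R * q k ^+ 2 = 2 * B * q k * ((2 ^ k)%:R * q k) by ring.
  by rewrite Nq mulr1.
have Xc w : nm w < rho -> forall k l, (k <= l)%N -> nm (X k w - X l w) <= 4 * B * q k.
  move=> hw k l kl; rewrite -(subnKC kl); move: (l - k)%N => j {kl}.
  suff : nm (X k w - X (k + j)%N w) <= 4 * B * (q k - q (k + j)%N).
    move/le_trans; apply; apply: ler_wpM2l; first exact: mulr_ge0.
    by have := q0 (k + j)%N; lra.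
  elim: j => [|j IH]; first by rewrite addn0 !subrr nm0 mulr0.
  rewrite addnS; apply: le_trans (nm_tri (X (k + j)%N w) _ _) _.
  apply: le_trans (lerD IH (XS _ _ hw)) _; rewrite qS.
  by rewrite le_eqVlt; apply/orP; left; apply/eqP; field.
have lim w : exists y, nm w < rho -> forall k, nm (X k w - y) <= 8 * B * q k.
  have [hw|] := boolP (nm w < rho); last by exists 0.
  have p4 k : 0 <= 4 * B * q k by apply: mulr_ge0 (ltW (q0 k)); apply: mulr_ge0.
  have [y hy] := mx_cauchy p4 (Xc w hw); exists y => _ k; apply: le_trans (hy k) _.
  by rewrite le_eqVlt; apply/orP; left; apply/eqP; ring.
have [eta heta] := choice lim.
exists eta => w hw.
have B8 : 0 <= 8 * B by apply: mulr_ge0.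
have eta_near : nm (eta w - z0) < r2 / 2.
  apply: (@le_lt_trans _ _ (r3 + r3)); last by lra.
  have [k hk] := pow2_small B8 r30.
  apply: le_trans (nm_tri (X k w) _ _) _; apply: lerD.
    by rewrite nmBC; apply: le_trans (heta w hw k) hk.
  exact: ltW (Xnear k w hw).
split.
- lra.
- move=> w0; have X0 k : X k w = sigma w.
    rewrite /X; move: (2 ^ k)%N => j; elim: j => [//|j IH] /=.
    by rewrite IH w0 mulr0 scale0r addr0.
  apply/eqP; rewrite -subr_eq0; apply/eqP/nm_eq0/eqP; rewrite eq_le nm_ge0 andbT.
  apply/ler_addgt0Pr => e e0; rewrite add0r; have [k hk] := pow2_small B8 e0.
  by rewrite nmBC -(X0 k); apply: le_trans (heta w hw k) hk.
pose s := rho - nm w.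
have s0 : 0 < s by rewrite subr_gt0.
have inrho u : nm (u - w) < s -> nm u < rho.
  move=> hu; rewrite -[u](subrK w); apply: le_lt_trans (nmD _ _) _.
  by move: hu; rewrite /s; move: (nm _) (nm _) => a b; lra.
have Xd k u : nm u < rho -> exists L, hasd (X k) u L.
  move=> hu; apply: (euler_hasd r30 rho0 (ltW M0) hV3 V_le sder snear rhoM (q0 k) hu (Nq1 k)).
have [|k u /inrho hu|k u hu|k l kl|e e0|L [hL hLk]] :=
  @holo_limit R m.+1 n X eta w s (r3 + nm z0) (fun k => 8 * B * q k) s0.
- by move=> k u hu; apply: Xd; apply: inrho.
- rewrite -[X k u](subrK z0); apply: le_trans (nmD _ _) _.
  by rewrite lerD2r; apply: ltW; apply: Xnear.
- by apply: heta; apply: inrho.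
- apply: ler_wpM2l => //; rewrite /q lef_pV2 ?posrE ?exprn_gt0 //.
  by rewrite ler_eXn2l // ltr1n.
- by have [k hk] := pow2_small B8 e0; exists k.
exists L => //.
apply/eqP; rewrite -subr_eq0; apply/eqP/nm_eq0/eqP; rewrite eq_le nm_ge0 andbT.
apply/ler_addgt0Pr => e e0; rewrite add0r.
have [c hc] : exists c : R, c = m.+1%:R * (48 * (8 * B) / s)
   + 2 * (Q * (rho * M) ^+ 2 + K * rho * M) + K * (8 * B) by eexists.
have rM0 : 0 <= K * rho * M by rewrite !mulr_ge0 // ltW.
have c0 : 0 <= c.
  rewrite hc; apply: addr_ge0; last by apply: mulr_ge0 => //; apply: ltW.
  apply: addr_ge0; last by apply: mulr_ge0 => //; apply: addr_ge0 => //; apply: mulr_ge0 => //; apply: sqr_ge0.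
  by apply: mulr_ge0 => //; apply: divr_ge0 (ltW s0); apply: mulr_ge0.
have [k hk] := pow2_small c0 e0; apply: le_trans hk.
have [D hD] := Xd k w hw.
have h1 := hLk k D hD.
have h2 := euler_der r30 rho0 (ltW M0) (ltW K0) Q0 hV3 V_le V_lip V_der V_taylor sder snear
  rhoM rhoK (q0 k) hw (Nq1 k) hD.
rewrite -/(X k w) Nq scale1r in h2.
have h3 : nm (V (X k w) - V (eta w)) <= K * (8 * B * q k).
  apply: le_trans (ler_wpM2l (ltW K0) (heta w hw k)).
  rewrite hK; apply: (holo_lip r20 hV2 V2M) eta_near _.
  by have := Xnear k w hw; lra.
set e0v := delta_mx 0 0 : 'rV_m.+1.
have -> : e0v *m L - V (eta w) = - (e0v *m (D - L)) + (e0v *m D - V (X k w)) + (V (X k w) - V (eta w)).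
  by rewrite mulmxBr opprB !addrA !subrK.
apply: le_trans (nmD _ _) _; apply: le_trans (lerD (nmD _ _) h3) _; rewrite nmN.
rewrite -/(q k).
have -> : c * q k = m.+1%:R * (48 * (8 * B) / s) * q k
  + 2 * (Q * (rho * M) ^+ 2 + K * rho * M) * q k + K * (8 * B * q k) by rewrite hc; ring.
apply: lerD => //.
apply: lerD.
  apply: (@le_trans _ _ (m.+1%:R * (48 * (8 * B * q k) / s))); last first.
    by rewrite le_eqVlt; apply/orP; left; apply/eqP; ring.
  apply: le_trans (nm_mulmx _ _) _; rewrite -mulrA; apply: ler_wpM2l => //.
  apply: le_trans h1; rewrite -[leRHS]mul1r.
  by apply: ler_wpM2r (nm_delta _ _); apply: nm_ge0.
apply: le_trans h2 _.
have -> : 2 * (Q * (rho * M) ^+ 2 + K * rho * M) * (2 ^ k)%:R * q k ^+ 2 =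
  2 * (Q * (rho * M) ^+ 2 + K * rho * M) * q k * ((2 ^ k)%:R * q k) by ring.
by rewrite Nq mulr1.
Qed.

End EulerScheme.

(** * Comparison with the differential of the library *)

Section Bridge.
Variable R : realType.
Local Notation C := (Cx R).

Lemma diff_eps (V W : normedModType C) (f : V -> W) z : differentiable f z ->
  forall e : R, 0 < e -> exists2 d : R, 0 < d &
    forall w, nm (w - z) < d -> nm (f w - f z - 'd f z (w - z)) <= e * nm (w - z).
Proof.
move=> /diff_locallyP[_ /eqaddoP H] e e0.
have e0C : 0 < e%:C :> C by rewrite ltcR.
have /nbhs_nm[d d0 hd] := H _ e0C; exists d => // w hw.
have := hd (w - z); rewrite subr0 => /(_ hw) /=.
rewrite !fctE /= subrK !normE -rmorphM lecR; apply: le_trans.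
by rewrite opprD addrA.
Qed.

Lemma eps_diff (V W : normedModType C) (f : V -> W) z (df : {linear V -> W}) :
  continuous df ->
  (forall e : R, 0 < e -> exists2 d : R, 0 < d &
    forall w, nm (w - z) < d -> nm (f w - f z - df (w - z)) <= e * nm (w - z)) ->
  differentiable f z /\ 'd f z = df :> (V -> W).
Proof.
move=> cdf H.
have E : f \o shift z = cst (f z) + df +o_ (0 : V) id.
  apply/eqaddoP => e e0.
  have eE : e = (complex.Re e)%:C by apply/esym/RRe_real/ger0_real/ltW.
  have [d d0 hd] := H (complex.Re e) ltac:(by rewrite -ltcR -eE).
  apply/nbhs_nm; exists d => // w; rewrite subr0 => hw.
  rewrite !fctE /= eE !normE -rmorphM lecR.
  have := hd (w + z); rewrite addrK => /(_ hw); apply: le_trans.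
  by rewrite opprD addrA.
have D := diff_unique cdf E; split => //.
by apply/diff_locallyP; rewrite D.
Qed.

Lemma continuous_mulmxr n m (L : 'M[C]_(n, m)) :
  continuous (mulmxr L : 'rV[C]_n -> 'rV[C]_m).
Proof.
move=> z; apply/continuous_nm => e e0.
have B0 : 0 < n%:R * nm L + 1 by rewrite ltr_wpDl // mulr_ge0 ?nm_ge0.
exists (e / (n%:R * nm L + 1)); first by rewrite divr_gt0.
move=> w; rewrite ltr_pdivlMr // => h /=; rewrite -mulmxBl.
apply: le_lt_trans (nm_mulmx _ _) _; apply: le_lt_trans h.
by rewrite mulrAC mulrC; apply: ler_wpM2l; rewrite ?nm_ge0 // lerDl.
Qed.

Lemma hasd_diff n m (f : 'rV[C]_n -> 'rV[C]_m) z L : hasd f z L ->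
  differentiable f z /\ forall v, 'd f z v = v *m L.
Proof.
move=> h; have [h1 h2] := @eps_diff _ _ f z (mulmxr L) (@continuous_mulmxr _ _ L) h.
by split => // v; rewrite h2.
Qed.

Lemma diff_hasd n m (f : 'rV[C]_n -> 'rV[C]_m) z : differentiable f z ->
  exists2 L, hasd f z L & forall v, 'd f z v = v *m L.
Proof.
move=> /diff_eps h; exists (lin1_mx ('d f z)) => [e e0|v]; last by rewrite mul_rV_lin1.
have [d d0 hd] := h e e0; exists d => // w /hd.
by rewrite mul_rV_lin1.
Qed.

Lemma diff_hasd_row n (h : 'rV[C]_n -> C) z : differentiable h z ->
  exists2 a : 'cV[C]_n, hasd (fun w => (h w)%:M : 'rV[C]_1) z a &
    forall v, 'd h z v = (v *m a) 0 0.
Proof.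
move=> dh; pose df (v : 'rV[C]_n) : 'rV[C]_1 := ('d h z v)%:M.
have lin : linear df.
  move=> a u v; rewrite /df linearP; apply/rowP => i; rewrite !mxE ord1.
  by rewrite !eqxx !mulr1n.
pose dfl : {linear 'rV[C]_n -> 'rV[C]_1} := HB.pack df (GRing.isLinear.Build _ _ _ _ df lin).
exists (lin1_mx dfl) => [e e0|v]; last first.
  by rewrite mul_rV_lin1 /= /df mxE eqxx mulr1n.
have [d d0 hd] := diff_eps dh e0; exists d => // w /hd {}hd.
rewrite mul_rV_lin1 /= /df; apply: nm_le => [|i j].
  by rewrite mulr_ge0 ?nm_ge0 // ltW.
by rewrite !mxE !ord1 !eqxx !mulr1n.
Qed.

Lemma derive_eps (W : normedModType C) (f : C -> W) z l : is_derive z (1 : C) f l ->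
  forall e : R, 0 < e -> exists2 d : R, 0 < d &
    forall w : C, nm (w - z) < d -> nm (f w - f z - (w - z) *: l) <= e * nm (w - z).
Proof.
case=> /derivable_nbhsP /eqaddoP H <- e e0.
have e0C : 0 < e%:C :> C by rewrite ltcR.
have /nbhs_nm[d d0 hd] := H _ e0C; exists d => // w hw.
have := hd (w - z); rewrite subr0 => /(_ hw) /=.
rewrite !fctE /= !normE -rmorphM lecR; apply: le_trans.
by rewrite [_ *: 1]mulr1 subrK opprD addrA.
Qed.

End Bridge.

(** * Straightening a vector field tangent to the levels of a function *)

Section LinearAlgebra.
Variable F : fieldType.

(** A transposition brings a nonzero entry to place [i] and a rank-one change of the identity clears
    the others. The last clause, that zero entries leave their rows alone, allows a second
    normalization without spoiling a first. *)
Lemma unit_col_delta n (a : 'cV[F]_n) (i : 'I_n) : a != 0 ->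
  exists2 S : 'M[F]_n, S \in unitmx & S *m a = delta_mx i 0 /\
    forall j, j != i -> a j 0 = 0 ->
      (delta_mx 0 j : 'rV[F]_n) *m S = delta_mx 0 j.
Proof.
move=> a0; have [p ap] : exists p, a p 0 != 0.
  apply: contrapT => H; case/negP: a0; apply/eqP/colP => p; rewrite mxE.
  by apply/eqP; apply/negPn/negP => ap; apply: H; exists p.
have [b hb] : exists b, b = tperm_mx p i *m a by eexists.
have bE j : b j 0 = a (tperm p i j) 0 by rewrite hb -row_permE mxE.
have bi : b i 0 != 0 by rewrite bE tpermR.
pose e : 'rV[F]_n := delta_mx 0 i.
have [u hu] : exists u : 'cV[F]_n, u = (b i 0)^-1 *: (delta_mx i 0 - b) by eexists.
have uE k : u k 0 = (b i 0)^-1 * ((k == i)%:R - b k 0) by rewrite hu !mxE eqxx andbT.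
have eu (w : 'cV[F]_n) : e *m w = (w i 0)%:M by rewrite -rowE [row i w]mx11_scalar mxE.
have eb : e *m u = ((b i 0)^-1 - 1)%:M.
  by rewrite eu uE eqxx mulrBr mulr1 mulVf.
have U : (1%:M + u *m e) \in unitmx.
  have : (1%:M + u *m e) *m (1%:M - (b i 0) *: (u *m e)) = 1%:M.
    rewrite mulmxDl mul1mx mulmxBr mulmx1 -scalemxAr mulmxA -[u *m e *m u]mulmxA eb.
    rewrite mul_mx_scalar -scalemxAl scalerA.
    move: (u *m e) => T; by apply/matrixP => x y; rewrite !mxE; field; exact: bi.
  by case/mulmx1_unit.
exists ((1%:M + u *m e) *m tperm_mx p i).
  by rewrite unitmx_mul U unitmx_perm.
split=> [|j ji aj].
  rewrite -mulmxA -hb mulmxDl mul1mx -mulmxA eu mul_mx_scalar hu scalerA mulfV // scale1r.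
  by rewrite addrC subrK.
have jp : j != p by apply: contraNneq ap => <-; rewrite aj.
have tj : tperm p i j = j by rewrite tpermD // eq_sym.
rewrite mulmxA mulmxDr mulmx1 mulmxA -rowE.
have -> : row j u = 0.
  by apply/rowP => k; rewrite ord1 !mxE uE (negbTE ji) (bE j) tj aj subrr mulr0.
rewrite mul0mx addr0; apply/rowP => k; rewrite -xcolE !mxE.
by rewrite -{1}tj (inj_eq perm_inj).
Qed.

(** Linear model of a flow box: [v] is the field, [a] the differential of the function, and [M]
    makes them the first basis vector and the last coordinate. Once [v] is normalized, [v *m a = 0]
    says that entry [i] of the covector vanishes, so normalizing [a] fixes [v]. *)
Lemma unit_row_col n (v : 'rV[F]_n) (a : 'cV[F]_n) (i j : 'I_n) : i != j ->
  v != 0 -> a != 0 -> v *m a = 0 ->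
  exists2 M : 'M[F]_n, M \in unitmx &
    v *m M = delta_mx 0 i /\ M *m delta_mx j 0 = a.
Proof.
move=> ij v0 a0 va.
have vT0 : v^T != 0 by apply: contra v0 => /eqP h; rewrite -[v]trmxK h trmx0.
have [S1 U1 [S1v _]] := unit_col_delta i vT0.
have UT : S1^T \in unitmx by rewrite unitmx_tr.
have vS : v *m S1^T = delta_mx 0 i.
  by rewrite -[LHS]trmxK trmx_mul trmxK S1v trmx_delta.
pose a' := invmx S1^T *m a.
have a'E : S1^T *m a' = a by rewrite /a' mulKVmx.
have a'0 : a' != 0.
  by apply: contra a0 => /eqP h; rewrite -a'E h mulmx0.
have a'i : a' i 0 = 0.
  have : (delta_mx 0 i : 'rV[F]_n) *m a' = 0 by rewrite -vS -mulmxA a'E.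
  by rewrite -rowE => /rowP /(_ 0); rewrite !mxE.
have [S U2 [Sa Si]] := unit_col_delta j a'0.
exists (S1^T *m invmx S); first by rewrite unitmx_mul UT unitmx_inv.
split; first by rewrite mulmxA vS -{1}(Si i ij a'i) mulmxK.
by rewrite -mulmxA -Sa mulKmx.
Qed.

End LinearAlgebra.

Section Straightening.
Variable R : realType.
Local Notation C := (Cx R).

Lemma inverse_on (S T : Type) (D : set S) (f : S -> T) (s0 : S) :
  (forall x y, D x -> D y -> f x = f y -> x = y) ->
  exists g, forall x, D x -> g (f x) = x.
Proof.
move=> inj.
have ex y : exists x, forall x', D x' -> f x' = y -> x = x'.
  have [[x [Dx fx]]|H] := pselect (exists x, D x /\ f x = y).
    by exists x => x' Dx' fx'; apply: inj => //; rewrite fx fx'.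
  by exists s0 => x' Dx' fx'; exfalso; apply: H; exists x'.
have [g hg] := choice ex; exists g => x Dx; exact: hg.
Qed.

Lemma nm_mul_proj n (w : 'rV[C]_n) i : nm (w *m (1%:M - delta_mx i i)) <= nm w.
Proof.
apply: nm_le => [|k j]; first exact: nm_ge0.
rewrite mulmxBr mulmx1 !mxE ord1.
have -> : \sum_j0 w 0 j0 * delta_mx i i j0 j = if j == i then w 0 i else 0.
  rewrite (bigD1 i) //= big1 => [|l li]; last by rewrite mxE (negbTE li) mulr0.
  by rewrite mxE eqxx addr0 /=; case: (j == i); rewrite ?mulr1 ?mulr0.
have [->|ji] := eqVneq j i; first by rewrite subrr nm0 nm_ge0.
by rewrite subr0; apply: nm_entry.
Qed.

Lemma mul_proj_coord n (w : 'rV[C]_n) i j :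
  (w *m (1%:M - delta_mx i i)) 0 j = if j == i then 0 else w 0 j.
Proof.
rewrite mulmxBr mulmx1 !mxE.
have -> : \sum_j0 w 0 j0 * delta_mx i i j0 j = if j == i then w 0 i else 0.
  rewrite (bigD1 i) //= big1 => [|l li]; last by rewrite mxE (negbTE li) mulr0.
  by rewrite mxE eqxx addr0 /=; case: (j == i); rewrite ?mulr1 ?mulr0.
by have [->|ji] := eqVneq j i; rewrite ?subrr ?subr0.
Qed.

Lemma mul_proj_id n (i : 'I_n) :
  (1%:M - delta_mx i i : 'M[C]_n) *m (1%:M - delta_mx i i) = 1%:M - delta_mx i i.
Proof.
by rewrite mulmxBr mulmx1 mulmxBl mul1mx mul_delta_mx subrr subr0.
Qed.

(** [eta w] is the point reached at time [w 0 0] from a transversal parametrized by the other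
    coordinates; [theta] is its inverse. As [h] is constant along the flow, it suffices that the
    last coordinate on the transversal is [h - h z0]. *)
Lemma straighten m (V : 'rV[C]_m.+2 -> 'rV[C]_m.+2) (h : 'rV[C]_m.+2 -> C) z0 (r : R) :
  0 < r -> holo V z0 r ->
  (forall z, nm (z - z0) < r -> exists a : 'cV[C]_m.+2,
     hasd (fun w => (h w)%:M : 'rV[C]_1) z a /\ V z *m a = 0) ->
  (forall a, hasd (fun w => (h w)%:M : 'rV[C]_1) z0 a -> a != 0) ->
  V z0 != 0 ->
  exists rho (eta theta : 'rV[C]_m.+2 -> 'rV[C]_m.+2), [/\ 0 < rho, eta 0 = z0,
    open (eta @` [set w | nm w < rho]) &
    forall w, nm w < rho ->
    [/\ nm (eta w - z0) < r, theta (eta w) = w, h (eta w) = h z0 + w 0 ord_max,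
        exists2 L, hasd eta w L & (delta_mx 0 0 : 'rV_m.+2) *m L = V (eta w) &
        exists L, hasd theta (eta w) L]].
Proof.
move=> r0 hV hh h0 V0.
have z0r : nm (z0 - z0) < r by rewrite subrr nm0.
have [a0 [ha0 Va0]] := hh z0 z0r; have a00 := h0 a0 ha0.
have n0l : (0 : 'I_m.+2) != ord_max by [].
have [M UM [VM Ma]] := unit_row_col n0l V0 a00 Va0.
pose l : 'I_m.+2 := ord_max.
pose el : 'rV[C]_m.+2 := delta_mx 0 l.
pose P : 'M[C]_m.+2 := 1%:M - delta_mx l l.
pose P0 : 'M[C]_m.+2 := 1%:M - delta_mx 0 0.
(* The linear coordinates [M] with the last one replaced by [h - h z0]. Since [M] was chosen to
   agree with [dh] there, the derivative at [z0] is still [M]. *)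
pose K z := (z - z0) *m (M *m P) + ((h z - h z0)%:M : 'rV[C]_1) *m el.
have Kd z a : hasd (fun w => (h w)%:M : 'rV[C]_1) z a -> hasd K z (M *m P + a *m el).
  move=> ha; apply: hasdD.
    have := hasd_comp (hasdB (hasd_id z) (hasd_cst z0 z)) (hasd_lin (M *m P) (z - z0)).
    by rewrite subr0 mul1mx.
  have ha' := hasdB ha (hasd_cst ((h z0)%:M : 'rV[C]_1) z); rewrite subr0 in ha'.
  have := hasd_comp ha' (hasd_lin el _); apply: (hasd_near ltr01) => w _ /=.
  by rewrite raddfB.
have K0 : K z0 = 0 by rewrite /K !subrr mul0mx raddf0 mul0mx addr0.
have Kl z : K z 0 l = h z - h z0.
  rewrite /K mxE mulmxA mul_proj_coord eqxx add0r mul_scalar_mx !mxE !eqxx /=.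
  by rewrite mulr1.
have DK : M *m P + a0 *m el = M.
  by rewrite -Ma -mulmxA mul_delta_mx -mulmxDr /P subrK mulmx1.
have hK : holo K z0 r.
  by move=> z /hh[a [ha _]]; eexists; apply: Kd ha.
have dK0 : hasd K z0 M by rewrite -DK; apply: Kd.
have [rho1 [rho10 rho1r IK]] := inverse_function r0 hK dK0 UM.
have [injK opK invK] := IK rho1 rho10 (lexx _).
have [kap hkap] := inverse_on z0 injK.
have hk := invK kap hkap.
have z0B : nm (z0 - z0) < rho1 by rewrite subrr nm0.
have [s s0 hs] := (open_nm _).1 opK 0 ltac:(by exists z0).
have kap0 : kap 0 = z0 by rewrite -K0 hkap.
pose sig w := kap (w *m P0).
have sigK w : nm w < s -> nm (sig w - z0) < rho1 /\ K (sig w) = w *m P0.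
  move=> hw; have /hs[z /= hz e] : nm (w *m P0 - 0) < s.
    by rewrite subr0; apply: le_lt_trans hw; apply: nm_mul_proj.
  by rewrite /sig -e hkap.
have hsig w : nm w < s -> exists2 L, hasd sig w L & (delta_mx 0 0 : 'rV_m.+2) *m L = 0.
  move=> hw; have [h1 h2] := sigK w hw; have [L hL] := hk _ h1; rewrite h2 in hL.
  exists (P0 *m L); first exact: (hasd_comp (hasd_lin P0 w) hL).
  by rewrite mulmxA mulmxBr mulmx1 mul_delta_mx subrr mul0mx.
have sig0 : sig 0 = z0 by rewrite /sig mul0mx kap0.
have [rho2 [rho20 rho2s [eta heta]]] := holomorphic_flow r0 hV s0 sig0 hsig.
have etaP w : nm w < rho2 -> eta (w *m P0) = sig w.
  move=> hw; have hwP : nm (w *m P0) < rho2 by apply: le_lt_trans hw; apply: nm_mul_proj.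
  have [_ e _] := heta _ hwP; rewrite e; first by rewrite /sig -mulmxA mul_proj_id.
  by rewrite mul_proj_coord eqxx.
have eta0 : eta 0 = z0 by rewrite -[X in eta X](mul0mx _ P0) etaP ?nm0.
have heq w : nm w < rho2 -> h (eta w) = h z0 + w 0 l.
  move=> hw; have hwP : nm (w *m P0) < rho2 by apply: le_lt_trans hw; apply: nm_mul_proj.
  have E : h (eta w) = h (sig w).
    rewrite -etaP //; apply/eqP; rewrite -subr_eq0; apply/eqP/nm_eq0/eqP.
    rewrite eq_le nm_ge0 andbT.
    (* On the segment from [w *m P0] to [w] only the time varies, and the derivative of [h] is a
       multiple of [V *m a = 0]. *)
    have mv : nm ((h (eta w))%:M - (h (eta (w *m P0)))%:M : 'rV[C]_1) <= 0.
      apply: (mean_value (f := fun u => (h (eta u))%:M : 'rV[C]_1)) => t ht.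
      have hp : nm (w *m P0 + t%:C *: (w - w *m P0)) < rho2.
        have := @ball_convex R _ 0 (w *m P0) w rho2 t; rewrite !subr0; exact.
      have [e1 _ [L hL Le]] := heta _ hp.
      have [a [ha Va]] := hh _ e1.
      exists (L *m a); first exact: hasd_comp hL ha.
      rewrite mulmxA /P0 mulmxBr mulmx1 opprB addrC subrK.
      have -> : w *m delta_mx 0 0 = w 0 0 *: (delta_mx 0 0 : 'rV[C]_m.+2).
        by rewrite -[delta_mx 0 0 in LHS](mul_delta_mx (0 : 'I_1)) mul_delta0.
      by rewrite -scalemxAl Le -scalemxAl Va scaler0 nm0.
    apply: le_trans mv; rewrite -raddfB.
    by have := nm_entry ((h (eta w) - h (eta (w *m P0)))%:M : 'rV[C]_1) 0 0; rewrite mxE eqxx mulr1n.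
  have ws : nm w < s by apply: lt_le_trans hw rho2s.
  have [_ Kw] := sigK w ws.
  have := Kl (sig w); rewrite Kw mul_proj_coord eq_sym (negbTE n0l) -E => ->.
  by rewrite addrC subrK.
have n00 : nm (0 : 'rV[C]_m.+2) < rho2 by rewrite nm0.
have [_ _ [L hL Le]] := heta 0 n00.
(* Row 0 of [L] is [V z0] by the flow equation, the other rows are those of the derivative of [kap],
   with which [eta] agrees on the transversal. Both match [invmx M]. *)
have LM : L = invmx M.
  have [D hD] := hk z0 z0B; rewrite K0 in hD.
  have MD : M *m D = 1%:M.
    apply: hasd_uniq (hasd_id z0).
    have hKz : hasd kap (K z0) D by rewrite K0.
    apply: (hasd_near rho10 _ (hasd_comp dK0 hKz)) => z hz /=; exact: hkap.
  have DM : D = invmx M by rewrite -[D](mulKmx UM) MD mulmx1.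
  have PL : P0 *m L = P0 *m D.
    have h1 : hasd (eta \o mulmx^~ P0) 0 (P0 *m L).
      by apply: hasd_comp (hasd_lin P0 0) _; rewrite /= mul0mx.
    have h2 : hasd (kap \o mulmx^~ P0) 0 (P0 *m D).
      by apply: hasd_comp (hasd_lin P0 0) _; rewrite /= mul0mx.
    apply: hasd_uniq h2; apply: (hasd_near rho20 _ h1) => w; rewrite subr0 => hw /=.
    exact: etaP.
  have split0 (T : 'M[C]_m.+2) : T = (delta_mx 0 0 : 'cV_m.+2) *m ((delta_mx 0 0 : 'rV_m.+2) *m T) + P0 *m T.
    by rewrite mulmxA mul_delta_mx -mulmxDl addrC subrK mul1mx.
  rewrite (split0 L) (split0 (invmx M)) PL DM; congr (_ *m _ + _).
  by rewrite Le eta0 -VM mulmxK.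
have heta2 : holo eta 0 rho2.
  by move=> w; rewrite subr0 => /heta[_ _ [L' hL' _]]; exists L'.
have UL : L \in unitmx by rewrite LM unitmx_inv.
have [rho [rhop rhole I]] := inverse_function rho20 heta2 hL UL.
have [inj op inv] := I rho rhop (lexx _).
have [theta hth] := inverse_on (0 : 'rV[C]_m.+2) inj.
have hdth := inv theta hth.
exists rho, eta, theta; split => //.
  rewrite (_ : [set w | nm w < rho] = [set w | nm (w - 0) < rho]) //.
  by apply/seteqP; split => w /=; rewrite subr0.
move=> w hw; have hw0 : nm (w - 0) < rho by rewrite subr0.
have hw2 : nm w < rho2 by apply: lt_le_trans rhole.
have [h1 _ h3] := heta w hw2.
split => //; [exact: hth|exact: heq|exact: hdth].
Qed.

End Straightening.

(** * Flow box charts *)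

Section Charts.
Variables (R : realType) (X : topologicalType) (n : nat).
Local Notation C := (Cx R).
Implicit Types (c : chart R X n) (A : set (chart R X n)) (x y : X).

Lemma hasd_continuous k m (f : 'rV[C]_k -> 'rV[C]_m) z L :
  hasd f z L -> {for z, continuous f}.
Proof. by move=> /hasd_diff[h _]; apply: differentiable_continuous. Qed.

Lemma chart_inv_dom c z : is_chart c -> (c @` dom c) z ->
  dom c (cinv c z) /\ c (cinv c z) = z.
Proof. by move=> [_ _ cK _ _] [x dx <-]; rewrite cK. Qed.

Lemma open_chart_image c (U : set X) : is_chart c -> open U -> open (c @` (dom c `&` U)).
Proof.
move=> hc oU; have [od oi cK cc ci] := hc; rewrite openE => _ [x [dx Ux] <-].
have zi : (c @` dom c) (c x) by exists x.
have N : nbhs (c x) (cinv c @^-1` U).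
  by apply: (ci _ zi); rewrite cK //; apply: open_nbhs_nbhs.
have M : nbhs (c x) (c @` dom c) by apply: open_nbhs_nbhs.
apply: filterS2 M N => z zi' Uz; have [d e] := chart_inv_dom hc zi'.
by exists (cinv c z).
Qed.

Lemma holomorphic_on_hasd m (D : set 'rV[C]_n) (f : 'rV[C]_n -> 'rV[C]_m) z :
  holomorphic_on D f -> D z -> exists L, hasd f z L.
Proof. by move=> h /h /diff_hasd[L hL _]; exists L. Qed.

Lemma transition_hasd c1 c2 x : holomorphic_transition c1 c2 -> dom c1 x -> dom c2 x ->
  exists L, hasd (transition c1 c2) (c1 x) L.
Proof. by move=> h d1 d2; apply: (holomorphic_on_hasd h); exists x. Qed.

Lemma transition_comp c1 c2 c3 x L L' : is_chart c1 -> is_chart c2 ->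
  dom c1 x -> dom c2 x ->
  hasd (transition c1 c2) (c1 x) L -> hasd (transition c2 c3) (c2 x) L' ->
  hasd (transition c1 c3) (c1 x) (L *m L').
Proof.
move=> h1 h2 d1 d2 hL hL'.
have t12 : transition c1 c2 (c1 x) = c2 x.
  by rewrite /transition /=; case: h1 => _ _ -> //.
have oI : open (c1 @` (dom c1 `&` dom c2)) by apply: open_chart_image => //; case: h2.
have [e e0 he] := (open_nm _).1 oI (c1 x) ltac:(by exists x).
have := hasd_comp hL; rewrite t12 => /(_ _ _ _ hL'); apply: (hasd_near e0) => w.
move=> /he[y [y1 y2] <-]; rewrite /transition /=.
by case: h1 => _ _ -> // _ _; case: h2 => _ _ ->.
Qed.

Lemma transition_id c x : is_chart c -> dom c x -> hasd (transition c c) (c x) 1%:M.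
Proof.
move=> hc dx; have [_ oi cK _ _] := hc.
have [e e0 he] := (open_nm _).1 oi (c x) ltac:(by exists x).
apply: (hasd_near e0) (hasd_id (c x)) => w /he[y dy <-].
by rewrite /transition /= cK.
Qed.

Lemma transition_inverse c1 c2 x L L' : is_chart c1 -> is_chart c2 ->
  dom c1 x -> dom c2 x ->
  hasd (transition c1 c2) (c1 x) L -> hasd (transition c2 c1) (c2 x) L' -> L *m L' = 1%:M.
Proof.
move=> h1 h2 d1 d2 hL hL'.
exact: hasd_uniq (transition_comp h1 h2 d1 d2 hL hL') (transition_id h1 d1).
Qed.

Lemma holomorphic_chart_mem A c : complex_atlas A -> A c -> holomorphic_chart A c.
Proof. by move=> [h1 h2 _] Ac; split; [exact: h1|move=> c' Ac'; split; exact: h2]. Qed.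

Lemma holomorphic_chart_transition A c1 c2 : complex_atlas A ->
  holomorphic_chart A c1 -> holomorphic_chart A c2 -> holomorphic_transition c1 c2.
Proof.
move=> [h1 h2 h3] [k1 H1] [k2 H2] _ [x [d1 d2] <-].
have [c Ac dc] := h3 x; have [t1 _] := H1 c Ac; have [_ t2] := H2 c Ac.
have [L hL] := transition_hasd t1 d1 dc; have [L' hL'] := transition_hasd t2 dc d2.
have := transition_comp k1 (h1 _ Ac) d1 dc hL hL'.
by case/hasd_diff.
Qed.

End Charts.

Section FlowBoxes.
Variables (R : realType) (m : nat) (X : topologicalType).
Local Notation C := (Cx R).
Local Notation n := m.+2.
Variables (A : set (chart R X n)) (Omega : chart R X n -> X -> 'M[C]_n).
Variables (H : X -> C) (XH : chart R X n -> X -> 'rV[C]_n) (E : C).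

(* A chart onto a polydisc in which X_H = d/dz_0 and whose last coordinate is H - E. *)
Definition flow_box (c : chart R X n) (r : R) :=
  [/\ holomorphic_chart A c, 0 < r, c @` dom c = [set w | nm w < r],
      forall x, dom c x -> c x 0 ord_max = H x - E &
      forall x c', dom c x -> A c' -> dom c' x ->
        exists2 L, hasd (transition c c') (c x) L &
          (delta_mx 0 0 : 'rV[C]_n) *m L = XH c' x].

Hypothesis hsys : holomorphic_hamiltonian_system A Omega H.
Hypothesis hXH : hamiltonian_vfield A Omega H XH.
Hypothesis hE : regular_value A H E.

Lemma form_at_self c x v : A c -> dom c x -> form_at Omega c x v v = 0.
Proof.
move=> Ac dx; have [_ [anti _ _] _ _ _] := hsys.
rewrite /form_at; set q := (v *m Omega c x *m v^T) 0 0.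
have : q = - q.
  rewrite {1}/q -[v *m _ *m _]trmxK [in LHS]mxE trmx_mul trmxK trmx_mul.
  by rewrite anti // mulNmx mulmxN mulmxA mxE.
by move=> /eqP; rewrite -addr_eq0 -mulr2n mulrn_eq0 /= => /eqP.
Qed.

(** The equation [dH = - Omega(X_H, .)] supplies the hypotheses of [straighten]: a skew form
    vanishes on [(X_H, X_H)], so [dH(X_H) = 0], and a zero of [X_H] would be a zero of [dH]. *)
Lemma flow_box_exists p : H p = E -> exists c r, flow_box c r /\ dom c p.
Proof.
move=> Hp; have [[_ _ atl] _ _ _ holH] := hsys; have [[lawV holV] hamV] := hXH.
have [isC tr cov] := atl; have [c0 A0 d0] := cov p.
have ch0 := isC _ A0; have [od0 oi0 cK0 cc0 ci0] := ch0.
have z0i : (c0 @` dom c0) (c0 p) by exists p.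
have [r r0 hr] := (open_nm _).1 oi0 _ z0i.
pose V z := XH c0 (cinv c0 z); pose h z := H (cinv c0 z).
have hV : holo V (c0 p) r by move=> w /hr wi; apply: (holomorphic_on_hasd (holV c0 A0)).
have hder z : (c0 @` dom c0) z -> exists2 a : 'cV[C]_n,
    hasd (fun w => (h w)%:M : 'rV[C]_1) z a & forall v, dfun H c0 (cinv c0 z) v = (v *m a) 0 0.
  move=> zi.
  have dz := holH c0 A0 z zi.
  have [a ha e] := diff_hasd_row dz.
  exists a.
    exact: ha.
  move=> v; rewrite /dfun.
  have [_ ->] := chart_inv_dom ch0 zi.
  exact: e.
have hh z : nm (z - c0 p) < r -> exists a : 'cV[C]_n,
    hasd (fun w => (h w)%:M : 'rV[C]_1) z a /\ V z *m a = 0.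
  move=> /hr zi; have [a ha e] := hder z zi; exists a; split => //.
  have [dz cz] := chart_inv_dom ch0 zi.
  rewrite [LHS]mx11_scalar -e -[dfun _ _ _ _]opprK -hamV // form_at_self // oppr0.
  by rewrite raddf0.
have cp : cinv c0 (c0 p) = p by apply: cK0.
have h0 a : hasd (fun w => (h w)%:M : 'rV[C]_1) (c0 p) a -> a != 0.
  move=> ha; have [b hb e] := hder _ z0i; rewrite (hasd_uniq ha hb).
  have [v] := hE Hp A0 d0 1; rewrite -{1}cp e => h1.
  by apply/eqP => b0; move: h1; rewrite b0 mulmx0 mxE => /esym/eqP; rewrite oner_eq0.
have V0 : V (c0 p) != 0.
  have [v hv] := hE Hp A0 d0 1; apply/eqP => v0.
  have := hamV c0 p A0 d0 v; rewrite hv; move: v0; rewrite /V cp => ->.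
  rewrite /form_at !mul0mx mxE => /eqP.
  by rewrite eq_sym oppr_eq0 oner_eq0.
have [rho [eta [theta [rho0 eta0 op heta]]]] := straighten r0 hV hh h0 V0.
have eta_in w : nm w < rho -> (c0 @` dom c0) (eta w).
  by move=> /heta[h1 _ _ _ _]; apply: hr.
pose c := Chart (dom c0 `&` [set x | (eta @` [set w | nm w < rho]) (c0 x)])
  (theta \o c0) (cinv c0 \o eta).
have cE x : dom c x -> exists w, [/\ nm w < rho, eta w = c0 x & c x = w].
  move=> [dx [w hw e]]; exists w; split => //=; rewrite -e.
  by have [_ -> _ _ _] := heta w hw.
have img : c @` dom c = [set w | nm w < rho].
  apply/seteqP; split => [_ [x dx <-]|w /= hw]; first by have [w [? _ ->]] := cE x dx.
  have [d1 e1] := chart_inv_dom ch0 (eta_in w hw).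
  exists (cinv c0 (eta w)); first by split => //; rewrite /= e1; exists w.
  by rewrite /= e1; have [_ -> _ _ _] := heta w hw.
have isc : is_chart c.
  split.
  - rewrite openE => x [dx hx]; apply: filterI; first exact: (open_nbhs_nbhs (conj od0 dx)).
    exact: (cc0 x dx (eta @` _) (open_nbhs_nbhs (conj op hx))).
  - rewrite img; apply/open_nm => z /= hz; exists (rho - nm z); first by rewrite subr_gt0.
    move=> w hw /=; rewrite -[w](subrK z); apply: le_lt_trans (nmD _ _) _.
    by rewrite -ltrBrDr.
  - move=> x dx; have [w [hw e ew]] := cE x dx.
    by rewrite /= in ew *; rewrite ew e; apply: cK0; case: dx.
  - move=> x dx; have [w [hw e ew]] := cE x dx; have [_ _ _ _ [L hL]] := heta w hw.
    apply: continuous_comp; first by apply: cc0; case: dx.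
    by rewrite -e; apply: hasd_continuous hL.
  - rewrite img => w hw; have [_ _ _ [L hL _] _] := heta w hw.
    by apply: continuous_comp; [exact: hasd_continuous hL|apply: ci0; exact: eta_in].
exists c, rho; split; last first.
  by split => //=; exists 0; rewrite /= ?nm0.
split => //.
- split => // c' Ac'; split => [_ [x [dx d'x] <-]|_ [x [d'x dx] <-]].
    have [w [hw e ew]] := cE x dx; have [_ _ _ [L hL _] _] := heta w hw.
    have [D hD] := transition_hasd (tr _ _ A0 Ac') (proj1 dx) d'x.
    rewrite -e in hD; have := hasd_comp hL hD; rewrite -ew.
    by case/hasd_diff.
  have [w [hw e ew]] := cE x dx; have [_ _ _ _ [L hL]] := heta w hw.
  have [D hD] := transition_hasd (tr _ _ Ac' A0) d'x (proj1 dx).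
  have t : transition c' c0 (c' x) = eta w.
    by rewrite e /transition /=; have [_ _ -> //] := isC _ Ac'.
  by rewrite -t in hL; have := hasd_comp hD hL; case/hasd_diff.
- move=> x dx; have [w [hw e ew]] := cE x dx; have [_ _ hw2 _ _] := heta w hw.
  rewrite ew; move: hw2; rewrite /h e cK0 ?cp ?Hp; last by case: dx.
  by move=> ->; rewrite addrC addKr.
- move=> x c' dx Ac' d'x; have [w [hw e ew]] := cE x dx.
  have [_ _ _ [L hL Le] _] := heta w hw.
  have [D hD De] := diff_hasd (tr _ _ A0 Ac' _ (ex_intro2 _ _ x (conj (proj1 dx) d'x) erefl)).
  exists (L *m D).
    have hD' : hasd (transition c0 c') (eta w) D by rewrite e.
    by rewrite ew; exact: (hasd_comp hL hD').
  rewrite mulmxA Le -De /V e cK0; last by case: dx.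
  by rewrite -lawV //; case: dx.
Qed.

End FlowBoxes.

(** * Integral curves in flow boxes *)

Section RealDerivative.
Variable R : realType.
Local Notation C := (Cx R).
Local Notation tangent n := ('rV[R]_n * 'rV[R]_n)%type.

Lemma of_realK n : cancel (@to_real R n) (@of_real R n).
Proof. by move=> z; apply/rowP => j; rewrite !mxE; case: (z 0 j). Qed.

Lemma to_realK n : cancel (@of_real R n) (@to_real R n).
Proof. by move=> [a b]; congr (_, _); apply/rowP => j; rewrite !mxE. Qed.

Lemma mx_norm_entry n (v : 'rV[R]_n) j : `|v 0 j| <= `|v|.
Proof.
have h : (`|v 0 j|%:nng <= \big[Order.max/0%:nng]_ij `|v ij.1 ij.2|%:nng).
  exact: (@le_bigmax _ _ _ 0%:nng (fun ij : 'I_1 * 'I_n => `|v ij.1 ij.2|%:nng) (0, j)).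
by rewrite -num_le in h.
Qed.

Lemma mx_norm_le n (v : 'rV[R]_n) (B : R) : 0 <= B -> (forall j, `|v 0 j| <= B) -> `|v| <= B.
Proof.
move=> B0 h; have [->|v0] := eqVneq v 0; first by rewrite normr0.
have [i Hi] : exists i, mx_norm v = `|v i.1 i.2| by apply: mx_norm_neq0; move: v0; rewrite -normr_eq0.
by rewrite [`|v|]Hi; case: i {Hi} => i j; rewrite ord1.
Qed.

Lemma norm_to_real n (z : 'rV[C]_n) : `|to_real z| <= nm z.
Proof.
rewrite prod_normE ge_max; apply/andP; split; apply: mx_norm_le; rewrite ?nm_ge0 // => j;
  rewrite mxE; apply: le_trans (nm_entry z 0 j); [exact: Re_le_nm|exact: Im_le_nm].
Qed.

Lemma nm_le_to_real n (z : 'rV[C]_n) : nm z <= 2 * `|to_real z|.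
Proof.
apply: nm_le => [|i j]; first by rewrite mulr_ge0.
rewrite ord1; apply: le_trans (nm_le_ReIm _) _; rewrite mulr_natl mulr2n.
have h1 : `|(to_real z).1| <= `|to_real z| by rewrite [leRHS]prod_normE le_max lexx.
have h2 : `|(to_real z).2| <= `|to_real z| by rewrite [leRHS]prod_normE le_max lexx orbT.
apply: lerD.
  by apply: le_trans h1; have := mx_norm_entry (to_real z).1 j; rewrite mxE.
by apply: le_trans h2; have := mx_norm_entry (to_real z).2 j; rewrite mxE.
Qed.

Lemma to_realB n (z w : 'rV[C]_n) : to_real (z - w) = to_real z - to_real w.
Proof. by congr (_, _); apply/rowP => j; rewrite !mxE raddfB. Qed.

Lemma to_realZ n (s : R) (z : 'rV[C]_n) : to_real (s%:C *: z) = s *: to_real z.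
Proof.
by congr (_, _); apply/rowP => j; rewrite !mxE; case: (z 0 j) => a b /=; ring.
Qed.

Definition rderiv n (f : R -> 'rV[C]_n) t (v : 'rV[C]_n) :=
  forall e : R, 0 < e -> exists2 d : R, 0 < d & forall s, `|s - t| < d ->
    nm (f s - f t - (s - t)%:C *: v) <= e * `|s - t|.

(** Brings the derivative of a real curve into the same form of estimate as a complex derivative, so
    that one argument serves real flow lines and holomorphic trajectories. *)
Lemma rderivP n (f : R -> 'rV[C]_n) t v :
  is_derive t (1 : R) ((@to_real R n \o f) : R -> tangent n) (to_real v) <-> rderiv f t v.
Proof.
split=> [[/derivable_nbhsP /eqaddoP h hv]|h].
  rewrite hv in h => e e0.
  have e20 : 0 < e / 2 by lra.
  have /nbhs_ballP[d d0 hd] := h _ e20; exists d => // s hs.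
  have bs : ball (0 : R) d (s - t) by rewrite -ball_normE /ball_ /= sub0r normrN.
  have := hd (s - t) bs.
  rewrite !fctE /= [(s - t) *: 1]mulr1 subrK => hst.
  apply: le_trans (nm_le_to_real _) _; rewrite to_realB to_realB to_realZ.
  move: hst; rewrite opprD addrA => hst.
  have := ler_wpM2l (x := 2) ltac:(by []) hst.
  by have -> : 2 * (e / 2 * `|s - t|) = e * `|s - t| by field.
suff L : (fun u => u^-1 *: ((((@to_real R n \o f) : R -> tangent n) \o shift t) (u *: 1) -
     ((@to_real R n \o f) : R -> tangent n) t)) @ 0^' --> to_real v.
  by apply: DeriveDef; [apply/cvg_ex; exists (to_real v)|exact: cvg_lim L].
apply/cvgrPdist_le => e e0; have [d d0 hd] := h e e0.
apply/nbhs_ballP; exists d => // u; rewrite -ball_normE /ball_ /= sub0r normrN => hu u0.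
rewrite [u *: 1]mulr1.
have un : 0 < `|u| by rewrite normr_gt0.
have := hd (u + t); rewrite addrK => /(_ hu) hq.
have -> : to_real v - u^-1 *: (to_real (f (u + t)) - to_real (f t)) =
   - (u^-1 *: to_real (f (u + t) - f t - u%:C *: v)).
  by rewrite !to_realB to_realZ [in RHS]scalerBr scalerA mulVf // scale1r opprB.
rewrite normrN normrZ normfV ler_pdivrMl // mulrC.
exact: le_trans (norm_to_real _) hq.
Qed.

End RealDerivative.

Section Curves.
Variables (R : realType) (m : nat) (X : topologicalType).
Local Notation C := (Cx R).
Local Notation n := m.+2.
Variables (A : set (chart R X n)) (Omega : chart R X n -> X -> 'M[C]_n).
Variables (H : X -> C) (XH : chart R X n -> X -> 'rV[C]_n) (E : C).
Variable XR : chart R X n -> X -> 'rV[R]_n * 'rV[R]_n.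
Hypothesis hsys : holomorphic_hamiltonian_system A Omega H.
Hypothesis hXH : hamiltonian_vfield A Omega H XH.
Hypothesis hXR : real_field_of A XH XR.
Hypothesis hE : regular_value A H E.

Let e0 : 'rV[C]_n := delta_mx 0 0.

(** The [d/dx] components of the defining identity determine everything: they read
    [X_H = p1 + i p2]. *)
Lemma XRE c x : A c -> dom c x -> XR c x = to_real (XH c x).
Proof.
move=> Ac dx; have [_ /(_ c x Ac dx)] := hXR; rewrite /Jfield.
case: (XR c x) => p1 p2 [] h _; apply: (can_inj (@to_realK _ _)).
rewrite of_realK; apply/rowP => j.
have := congr1 (fun u : 'rV[C]_n => u 0 j) h; rewrite !mxE /=.
have two : (2^-1 : C) != 0 by rewrite invr_eq0 pnatr_eq0.
move=> /(mulfI two) ->; rewrite rmorphN mulrN opprK.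
exact: complexDi.
Qed.

Lemma JXRE c x : A c -> dom c x -> Jfield XR c x = to_real ('i%C *: XH c x).
Proof.
move=> Ac dx; rewrite /Jfield XRE // /Jvec /to_real /=.
by congr (_, _); apply/rowP => j; rewrite !mxE; case: (XH c x 0 j) => a b /=; ring.
Qed.

(* Curves g with derivative X_H along a set D of complex times: D is a line for
   the real flows and everything for holomorphic trajectories. *)
Definition dcurve (D : set C) (g : C -> X) (s : C) :=
  (forall N, nbhs (g s) N -> exists2 d : R, 0 < d & forall t, D t -> nm (t - s) < d -> N (g t))
  /\ forall c, A c -> dom c (g s) -> forall e : R, 0 < e -> exists2 d : R, 0 < d &
      forall t, D t -> nm (t - s) < d ->
        nm (c (g t) - c (g s) - (t - s) *: XH c (g s)) <= e * nm (t - s).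

Definition star (D : set C) (t : C) := forall s (u : R), D s -> 0 <= u <= 1 ->
  D (t + u%:C * (s - t)).

(** The chain rule for the transition from a chart of the atlas into the box. Its derivative inverts
    the one in [flow_box] and hence takes [X_H] to [e0]. *)
Lemma dcurve_box D g s c r : flow_box A H XH E c r -> D s -> dcurve D g s -> dom c (g s) ->
  forall e : R, 0 < e -> exists2 d : R, 0 < d &
      forall t, D t -> nm (t - s) < d ->
        nm (c (g t) - c (g s) - (t - s) *: e0) <= e * nm (t - s).
Proof.
move=> [hc r0 img _ hV] Ds [gc gd] dg e ep.
have [[_ _ [isC tr cov]] _ _ _ _] := hsys.
have [c' Ac' d'] := cov (g s).
have [isc hc'] := hc; have [t1 t2] := hc' c' Ac'.
have [L hL Le] := hV (g s) c' dg Ac' d'.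
have [K hK] := transition_hasd t2 d' dg.
have LK := transition_inverse isc (isC _ Ac') dg d' hL hK.
have VK : XH c' (g s) *m K = e0 by rewrite -Le -mulmxA LK mulmx1.
have [B hB] : exists B : R, B = nm (XH c' (g s)) + 1 by eexists.
have B0 : 0 < B by rewrite hB ltr_wpDl ?nm_ge0.
have [B' hB'] : exists B : R, B = n%:R * nm K + 1 by eexists.
have B'0 : 0 < B' by rewrite hB' ltr_wpDl // mulr_ge0 ?nm_ge0.
have [d1 d10 h1] := gd c' Ac' d' 1 ltr01.
have [d2 d20 h2] := gd c' Ac' d' (e / 2 / B') ltac:(by rewrite !divr_gt0).
have [d3 d30 h3] := hK (e / 2 / B) ltac:(by rewrite !divr_gt0).
have od : nbhs (g s) (dom c' ).
  by apply: open_nbhs_nbhs; split => //; have [] := isC _ Ac'.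
have [d4 d40 h4] := gc _ od.
exists (Num.min (Num.min d1 d2) (Num.min d4 (d3 / B))).
  by rewrite !lt_min d10 d20 d40 divr_gt0.
move=> t Dt; rewrite !lt_min => /andP[/andP[w1 w2] /andP[w4 w3]].
have {}h1 := h1 t Dt w1; have {}h2 := h2 t Dt w2; have {}h4 := h4 t Dt w4.
have trE x : dom c' x -> transition c' c (c' x) = c x.
  by move=> dx; rewrite /transition /=; have [_ _ -> //] := isC _ Ac'.
have lip : nm (c' (g t) - c' (g s)) <= B * nm (t - s).
  rewrite -[_ - c' (g s)](subrK ((t - s) *: XH c' (g s))); apply: le_trans (nmD _ _) _.
  rewrite nmZ hB mulrDl mul1r addrC; apply: lerD; first by rewrite mulrC.
  by rewrite mul1r in h1.
have hd3 : nm (c' (g t) - c' (g s)) < d3.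
  by apply: le_lt_trans lip _; rewrite mulrC -ltr_pdivlMr.
have {}h3 := h3 _ hd3; rewrite !trE // in h3.
have -> : c (g t) - c (g s) - (t - s) *: e0 =
  (c (g t) - c (g s) - (c' (g t) - c' (g s)) *m K)
  + (c' (g t) - c' (g s) - (t - s) *: XH c' (g s)) *m K.
  by rewrite [in RHS](mulmxBl (c' (g t) - c' (g s))) -scalemxAl VK addrA subrK.
apply: le_trans (nmD _ _) _; rewrite (splitr e) mulrDl; apply: lerD.
  apply: le_trans h3 _; apply: le_trans (ler_wpM2l _ lip) _.
    by rewrite ltW // !divr_gt0.
  by rewrite mulrA divfK // gt_eqF.
apply: le_trans (nm_mulmx _ _) _; rewrite mulrAC.
apply: (@le_trans _ _ (B' * (e / 2 / B' * nm (t - s)))).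
  by apply: ler_pM => //; rewrite ?mulr_ge0 ?nm_ge0 // hB' lerDl.
by rewrite le_eqVlt; apply/orP; left; apply/eqP; field; rewrite gt_eqF.
Qed.

(** Local uniqueness of integral curves: after subtracting the straight line, the curve has
    derivative 0 along the segment of times from [t] to [s], hence is constant there. *)
Lemma curve_in_box D g t c r (rho : R) : flow_box A H XH E c r -> 0 < rho ->
  D t -> star D t -> (forall s, D s -> nm (s - t) < rho -> dcurve D g s) -> dom c (g t) ->
  exists2 d : R, 0 < d & forall s, D s -> nm (s - t) < d ->
    dom c (g s) /\ c (g s) = c (g t) + (s - t) *: e0.
Proof.
move=> hb rho0 Dt st hd dg.
have [[[od _ _ _ _] _] _ _ _ _] := hb.
have tt : nm (t - t) < rho by rewrite subrr nm0.
have [gc _] := hd t Dt tt.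
have [d d0 h1] := gc _ (open_nbhs_nbhs (conj od dg)).
exists (Num.min d rho); first by rewrite lt_min d0.
move=> s Ds; rewrite lt_min => /andP[sd sr]; split; first exact: h1.
pose p (u : R) : C := t + u%:C * (s - t).
have pt u : p u - t = u%:C * (s - t) by rewrite /p addrC addKr.
have pp u u' : p u - p u' = (u - u')%:C * (s - t) by rewrite /p rmorphB /=; ring.
have pn u : 0 <= u <= 1 -> nm (p u - t) <= nm (s - t).
  move=> hu; rewrite pt nmM nmR ger0_norm; last by lra.
  by apply: ler_piMl; rewrite ?nm_ge0 //; lra.
have Dp u : 0 <= u <= 1 -> D (p u) by move=> hu; apply: st.
pose phi (u : R) := c (g (p u)) - p u *: e0.
suff Z : nm (phi 1 - phi 0) <= 0.
  have {}Z : phi 1 = phi 0.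
    apply/eqP; rewrite -subr_eq0; apply/eqP/nm_eq0/eqP.
    by rewrite eq_le Z nm_ge0.
  have p1 : p 1 = s by rewrite /p mul1r addrC subrK.
  have p0 : p 0 = t by rewrite /p mul0r addr0.
  move: Z; rewrite /phi p1 p0 => Z.
  by rewrite -[c (g s)](subrK (s *: e0)) Z scalerBl -addrA; congr (_ + _); rewrite addrC.
apply/ler_addgt0Pr => eps eps0; rewrite add0r.
suff : nm (phi 1 - phi 0) <= eps * (1 - 0) by rewrite subr0 mulr1.
apply: (@interval_chain R (fun x y => nm (phi y - phi x) <= eps * (y - x))) => //.
- by move=> x; rewrite !subrr nm0 mulr0.
- move=> x y z _ _ q1 q2; apply: le_trans (nm_tri (phi y) _ _) _.
  by apply: le_trans (lerD q2 q1) _; rewrite -mulrDr addrA subrK.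
move=> u hu.
have dcu : dcurve D g (p u) by apply: hd (Dp _ hu) _; apply: le_lt_trans (pn _ hu) sr.
have dgu : dom c (g (p u)) by apply: h1 (Dp _ hu) _; apply: le_lt_trans (pn _ hu) sd.
have K0 : 0 < nm (s - t) + 1 by rewrite ltr_wpDl ?nm_ge0.
have [b b0 hb'] := dcurve_box hb (Dp _ hu) dcu dgu (e := eps / (nm (s - t) + 1)) ltac:(by rewrite divr_gt0).
have near v : 0 <= v <= 1 -> `|v - u| < b / (nm (s - t) + 1) -> nm (phi v - phi u) <= eps * `|v - u|.
  move=> hv hvu.
  have := hb' (p v) (Dp _ hv); rewrite pp nmM nmR.
  have h : `|v - u| * nm (s - t) < b.
    move: hvu; rewrite ltr_pdivlMr //; apply: le_lt_trans.
    by apply: ler_wpM2l => //; rewrite lerDl.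
  move=> /(_ h); rewrite -pp.
  have -> : c (g (p v)) - c (g (p u)) - (p v - p u) *: e0 = phi v - phi u.
    rewrite /phi scalerBl; move: (p v *: e0) (p u *: e0) => a1 a2.
    by apply/rowP => i; rewrite !mxE; ring.
  move/le_trans; apply.
  have -> : eps / (nm (s - t) + 1) * (`|v - u| * nm (s - t)) =
     eps * `|v - u| * (nm (s - t) / (nm (s - t) + 1)) by field; rewrite gt_eqF.
  by apply: ler_piMr; rewrite ?mulr_ge0 ?(ltW eps0) // ler_pdivrMr // mul1r lerDl.
exists (b / (nm (s - t) + 1)); first by rewrite divr_gt0.
clear hb' dcu dgu hd h1 hb; clearbody phi.
move=> x y x0 y1 /andP[xu uy] hx hy.
have near1 := near y ltac:(lra); have near2 := near x ltac:(lra).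
rewrite ger0_norm in near1; last by lra.
rewrite ler0_norm in near2; last by lra.
apply: le_trans (nm_tri (phi u) _ _) _; rewrite (nmBC (phi u)).
have := lerD (near1 ltac:(lra)) (near2 ltac:(lra)).
by rewrite -mulrDr opprB addrA subrK.
Qed.

End Curves.

(** * Leaves as classes generated by plaques *)

Section Leaves.
Variables (R : realType) (m : nat) (X : topologicalType).
Local Notation C := (Cx R).
Local Notation n := m.+2.
Variables (A : set (chart R X n)) (Omega : chart R X n -> X -> 'M[C]_n).
Variables (H : X -> C) (XH : chart R X n -> X -> 'rV[C]_n) (E : C).
Variable XR : chart R X n -> X -> 'rV[R]_n * 'rV[R]_n.
Hypothesis hsys : holomorphic_hamiltonian_system A Omega H.
Hypothesis hXH : hamiltonian_vfield A Omega H XH.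
Hypothesis hXR : real_field_of A XH XR.
Hypothesis hE : regular_value A H E.

Local Notation e0 := (delta_mx 0 0 : 'rV[C]_n).
Local Notation box := (flow_box A H XH E).

Definition same_plaque (x y : X) := exists c r,
  [/\ box c r, dom c x, dom c y, H x = E & forall j : 'I_n, j != 0 -> c x 0 j = c y 0 j].

Lemma box_chart c r : box c r -> is_chart c.
Proof. by case=> -[]. Qed.

Lemma box_mem c r z : box c r -> nm z < r -> dom c (cinv c z) /\ c (cinv c z) = z.
Proof.
move=> hb hz; have [_ _ img _ _] := hb; apply: chart_inv_dom (box_chart hb) _.
by rewrite img.
Qed.

Lemma box_nm c r x : box c r -> dom c x -> nm (c x) < r.
Proof. by move=> [_ _ img _ _] dx; have : (c @` dom c) (c x) by [exists x]; rewrite img. Qed.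

Lemma box_inv c r x : box c r -> dom c x -> cinv c (c x) = x.
Proof. by move=> /box_chart[_ _ cK _ _]; apply: cK. Qed.

Lemma plaque_level c r x y : box c r -> dom c x -> dom c y ->
  (forall j : 'I_n, j != 0 -> c x 0 j = c y 0 j) -> H x = E -> H y = E.
Proof.
move=> [_ _ _ hH _] dx dy h Hx; have := h ord_max isT; rewrite !hH // Hx.
by rewrite subrr => /esym/eqP; rewrite subr_eq0 => /eqP.
Qed.

Lemma same_plaque_sym x y : same_plaque x y -> same_plaque y x.
Proof.
move=> [c [r [hb dx dy Hx h]]]; exists c, r; split => //.
  exact: plaque_level hb dx dy h Hx.
by move=> j /h.
Qed.

Lemma same_plaque_refl x : H x = E -> same_plaque x x.
Proof.
by move=> Hx; have [c [r [hb dx]]] := flow_box_exists hsys hXH hE Hx; exists c, r.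
Qed.

Lemma nm_e0 : nm e0 <= 1. Proof. exact: nm_delta. Qed.

Lemma add_e0 (z w : 'rV[C]_n) : (forall j : 'I_n, j != 0 -> z 0 j = w 0 j) ->
  z + (w 0 0 - z 0 0) *: e0 = w.
Proof.
move=> h; apply/rowP => j; rewrite !mxE eqxx /=.
have [->|j0] := eqVneq j 0; first by rewrite mulr1 addrC subrK.
by rewrite mulr0 addr0 h.
Qed.

Lemma add_e0_coord (z : 'rV[C]_n) s (j : 'I_n) : (z + s *: e0) 0 j = z 0 j + (if j == 0 then s else 0).
Proof. by rewrite !mxE eqxx /=; case: (j == 0); rewrite ?mulr1 ?mulr0. Qed.

Lemma box_dcurve c r x s : box c r -> dom c x -> nm (c x + s *: e0) < r ->
  dcurve A XH [set: C] (fun t => cinv c (c x + t *: e0)) s.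
Proof.
move=> hb dx hs; have [hc r0 img _ hV] := hb.
have zi : (c @` dom c) (c x + s *: e0) by rewrite img.
have step t : c x + t *: e0 - (c x + s *: e0) = (t - s) *: e0.
  by rewrite opprD addrACA subrr add0r scalerBl.
have nst t : nm ((t - s) *: e0) <= nm (t - s) by rewrite nmZ ler_piMr ?nm_ge0 ?nm_e0.
split=> [N hN|c' Ac' d' e ep].
  have [_ _ _ _ ci] := box_chart hb.
  have /nbhs_nm[d d0 hd] := ci _ zi N hN; exists d => // t _ ht; apply: hd.
  by rewrite step; apply: le_lt_trans ht.
have [ds cs] := box_mem hb hs.
have [L hL Le] := hV _ c' ds Ac' d'; rewrite cs in hL.
have [d d0 hd] := hL e ep; exists d => // t _ ht.
have := hd (c x + t *: e0); rewrite step -scalemxAl Le => h.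
apply: le_trans (h _) _; first exact: le_lt_trans ht.
by apply: ler_wpM2l => //; apply: ltW.
Qed.

(* The two real fields X_H^R and J X_H^R correspond to theta = 1 and theta = i. *)
Variant real_flow_dir (theta : C) (V : chart R X n -> X -> 'rV[R]_n * 'rV[R]_n) : Prop :=
  RealFlowDir of nm theta = 1 & (forall c x, A c -> dom c x -> V c x = to_real (theta *: XH c x)).

Lemma dir_XR : real_flow_dir 1 XR.
Proof.
by split; [exact: nm1|move=> c x Ac dx; rewrite scale1r; exact: XRE hXR _ _ Ac dx].
Qed.

Lemma dir_JXR : real_flow_dir 'i%C (Jfield XR).
Proof. by split; [exact: nmi|move=> c x Ac dx; exact: JXRE hXR _ _ Ac dx]. Qed.

Section OneField.
Variables (theta : C) (V : chart R X n -> X -> 'rV[R]_n * 'rV[R]_n).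
Hypothesis dir : real_flow_dir theta V.

Lemma nm_dir (u v : R) : nm (u%:C * theta - v%:C * theta) = `|u - v|.
Proof. by case: dir => h _; rewrite -mulrBl -rmorphB nmM h mulr1 nmR. Qed.

(** The flow line is the coordinate line in direction [theta]; its times form an interval because
    the ball is convex. *)
Lemma box_flow c r x (s : R) : box c r -> dom c x -> nm (c x + (s%:C * theta) *: e0) < r ->
  flow A V s x (cinv c (c x + (s%:C * theta) *: e0)).
Proof.
move=> hb dx hs; case: (dir) => _ VE.
pose I := [set u : R | nm (c x + (u%:C * theta) *: e0) < r].
have step (u v : R) : nm (c x + (u%:C * theta) *: e0 - (c x + (v%:C * theta) *: e0)) <= `|u - v|.
  rewrite opprD addrACA subrr add0r -scalerBl nmZ nm_dir.
  by rewrite ler_piMr // nm_e0.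
exists I, (fun u => cinv c (c x + (u%:C * theta) *: e0)); split; split.
- rewrite openE => u /= hu; apply/nbhs_ballP; exists (r - nm (c x + (u%:C * theta) *: e0)).
    by rewrite /= subr_gt0.
  move=> v; rewrite -ball_normE /ball_ /= => huv; rewrite /I /=.
  rewrite -[c x + (v%:C * theta) *: e0](subrK (c x + (u%:C * theta) *: e0)).
  apply: le_lt_trans (nmD _ _) _; rewrite -ltrBrDr; apply: le_lt_trans (step v u) _.
  by rewrite distrC.
- move=> u v hu hv w /andP[uw wv].
  have [e|uv] := eqVneq u v.
    have -> : w = u by apply/eqP; rewrite eq_le uw e wv.
    exact: hu.
  have uv' : 0 < v - u by rewrite subr_gt0 lt_neqAle uv (le_trans uw wv).
  have := @ball_convex R _ 0 (c x + (u%:C * theta) *: e0) (c x + (v%:C * theta) *: e0) r ((w - u) / (v - u)).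
  rewrite !subr0 => /(_ hu hv).
  have t01 : 0 <= (w - u) / (v - u) <= 1.
    by rewrite divr_ge0 ?(ltW uv') ?subr_ge0 //= ler_pdivrMr // mul1r lerD2r.
  move=> /(_ t01); congr (nm _ < r).
  rewrite opprD addrACA subrr add0r -scalerBl scalerA -addrA -scalerDl.
  congr (_ + _ *: _).
  rewrite -mulrBl -rmorphB mulrA -rmorphM divfK ?gt_eqF // -mulrDl -rmorphD.
  by rewrite addrC subrK.
- by rewrite /I /= mul0r scale0r addr0; apply: box_nm hb dx.
- exact: hs.
- move=> u hu; have [gc gd] := box_dcurve hb dx hu; split.
    move=> N /gc[d d0 hd]; apply/nbhs_ballP; exists d => // v.
    rewrite -ball_normE /ball_ /= => huv; apply: hd => //.
    by rewrite nm_dir distrC.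
  move=> c' Ac' d'; rewrite VE //; apply/rderivP => e ep.
  have [d d0 hd] := gd c' Ac' d' e ep; exists d => // v hv.
  have := hd (v%:C * theta) Logic.I; rewrite nm_dir => /(_ hv).
  by rewrite scalerA rmorphB mulrBl.
- by rewrite mul0r scale0r addr0; apply: box_inv hb dx.
- by [].
Qed.

(** Real time [v] is placed at [v theta] on a line in [C], where velocity [theta X_H] becomes
    derivative [X_H]; [complex.Re (s / theta)] recovers the real time. *)
Lemma flow_dcurve (I : set R) (g : R -> X) u : integral_curve A V I g -> I u ->
  dcurve A XH [set s | exists v : R, s = v%:C * theta]
    (fun s => g (complex.Re (s / theta))) (u%:C * theta).
Proof.
case: (dir) => n1 VE ic Iu; have [gc gd] := ic u Iu.
have t0 : theta != 0 by apply/eqP => h; move: n1; rewrite h nm0 => /eqP; rewrite eq_sym oner_eq0.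
have red (v : R) : complex.Re (v%:C * theta / theta) = v by rewrite mulfK.
split=> [N|c Ac]; rewrite red.
  move=> /gc /nbhs_ballP[d d0 hd]; exists d => // _ [v ->]; rewrite nm_dir red => h.
  by apply: hd; rewrite -ball_normE /ball_ /= distrC.
move=> dg e ep; have := gd c Ac dg; rewrite VE // => /rderivP /(_ e ep)[d d0 hd].
exists d => // _ [v ->]; rewrite nm_dir red => /hd.
by rewrite scalerA rmorphB mulrBl.
Qed.

Lemma flow_local (I : set R) (g : R -> X) u : open I -> integral_curve A V I g -> I u ->
  H (g u) = E ->
  exists2 d : R, 0 < d & forall v w, `|v - u| < d -> `|w - u| < d -> same_plaque (g v) (g w).
Proof.
case: (dir) => n1 VE oI ic Iu Hu.
have t0 : theta != 0 by apply/eqP => h; move: n1; rewrite h nm0 => /eqP; rewrite eq_sym oner_eq0.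
have red (v : R) : complex.Re (v%:C * theta / theta) = v by rewrite mulfK.
have [c [r [hb dc]]] := flow_box_exists hsys hXH hE Hu.
move: oI; rewrite openE => /(_ u Iu) /nbhs_ballP[rho rho0 hrho].
pose D := [set s : C | exists v : R, s = v%:C * theta].
have Du : D (u%:C * theta) by exists u.
have st : star D (u%:C * theta).
  move=> _ k [v ->] hk; exists (u + k * (v - u)).
  by rewrite !rmorphD !rmorphM rmorphB /=; ring.
have [||d d0 hd] := curve_in_box hsys hb rho0 Du st (g := fun s => g (complex.Re (s / theta))).
- move=> _ [v ->]; rewrite nm_dir => hv; apply: flow_dcurve ic _.
  by apply: hrho; rewrite -ball_normE /ball_ /= distrC.
- by rewrite red.
exists d => // v w hv hw.
have [|dv cv] := hd (v%:C * theta) (ex_intro _ v erefl); first by rewrite nm_dir.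
have [|dw cw] := hd (w%:C * theta) (ex_intro _ w erefl); first by rewrite nm_dir.
rewrite !red in dv cv dw cw.
exists c, r; split => //.
  apply: plaque_level hb dc dv _ Hu => j j0.
  by rewrite cv add_e0_coord (negbTE j0) addr0.
by move=> j j0; rewrite cv cw !add_e0_coord (negbTE j0).
Qed.

End OneField.

Lemma H_continuous x : {for x, continuous H}.
Proof.
have [[_ _ [isC _ cov]] _ _ _ holH] := hsys.
have [c Ac dc] := cov x; have [od oi cK cc ci] := isC c Ac.
have zi : (c @` dom c) (c x) by exists x.
have dh := holH c Ac (c x) zi.
have k : {for x, continuous ((H \o cinv c) \o c)}.
  apply: continuous_comp; first exact: cc.
  exact: differentiable_continuous dh.
move=> N; rewrite -{1}(cK x dc) => /k hN.
have od' : nbhs x (dom c) by apply: open_nbhs_nbhs.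
have hN' : nbhs x [set y | N (H (cinv c (c y)))] := hN.
suff : nbhs x [set y | N (H y)] by [].
by apply: filterS2 hN' od' => y /= hy dy; move: hy; rewrite cK.
Qed.

Lemma level_neq_nbhs x : H x <> E -> nbhs x [set y | H y <> E].
Proof.
move=> Hx; have := @H_continuous x [set z | z <> E]; apply.
apply/nbhs_nm; exists (nm (H x - E)).
  rewrite lt_def nm_ge0 andbT; apply/negP => /eqP/nm_eq0/eqP.
  by rewrite subr_eq0 => /eqP.
by move=> w hw we; move: hw; rewrite we nmBC ltxx.
Qed.

Section PlaqueInduction.
(** An induction principle: a transitive relation that holds along plaques of the level holds along
    flow lines, flow words and holomorphic trajectories. *)
Variable Q : X -> X -> Prop.
Hypothesis Qtrans : forall x y z, Q x y -> Q y z -> Q x z.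
Hypothesis Qplaque : forall x y, same_plaque x y -> Q x y.

Lemma flow_ind theta V t x y : real_flow_dir theta V -> H x = E -> flow A V t x y ->
  [/\ Q x y, Q y x & H y = E].
Proof.
move=> dir Hx [I [g [[oI iI I0 It] [ic g0 gt]]]].
(* Membership in the level is propagated together with [Q], as it is known at one end only. Both
   directions of [Q] are carried because [t] may be negative. *)
pose S a b := (H (g a) = E <-> H (g b) = E) /\
   (H (g a) = E -> Q (g a) (g b) /\ Q (g b) (g a)).
have chain a b : a <= b -> I a -> I b -> S a b.
  move=> ab Ia Ib; apply: interval_chain ab _ _ _.
  - move=> u; split => // /same_plaque_refl h; split; exact: Qplaque.
  - move=> u v w _ _ [e1 q1] [e2 q2]; split; first by rewrite e1.
    move=> hu; have [h1 h2] := q1 hu; have [h3 h4] := q2 (e1.1 hu).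
    by split; [exact: Qtrans h1 h3|exact: Qtrans h4 h2].
  move=> s hs; have Is : I s by apply: iI Ia Ib s hs.
  have [Hs|Hs] := pselect (H (g s) = E).
    have [d d0 hd] := flow_local dir oI ic Is Hs.
    exists d => // u v au vb /andP[us sv] h1 h2.
    have pl : same_plaque (g u) (g v) by apply: hd; rewrite ltr_norml; lra.
    have [_ [_ [_ _ _ Hu _]]] := pl; have [_ [_ [_ _ _ Hv _]]] := same_plaque_sym pl.
    by split => // _; split; apply: Qplaque => //; apply: same_plaque_sym.
  (* Off the level, continuity of [H] keeps nearby times off it, where both parts of [S] hold
     vacuously. *)
  have [gc _] := ic s Is.
  have /nbhs_ballP[d d0 hd] := gc _ (level_neq_nbhs Hs).
  exists d => // u v au vb /andP[us sv] h1 h2.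
  have Hu : H (g u) <> E by apply: hd; rewrite -ball_normE /ball_ /= ltr_norml; lra.
  have Hv : H (g v) <> E by apply: hd; rewrite -ball_normE /ball_ /= ltr_norml; lra.
  by split.
rewrite -gt -g0; rewrite -g0 in Hx; have [h|h] := leP 0 t.
  by have [e q] := chain _ _ h I0 It; have [? ?] := q Hx; split => //; apply: (e.1 Hx).
have [e q] := chain _ _ (ltW h) It I0; have Ht := e.2 Hx.
by have [? ?] := q Ht; split.
Qed.

Lemma leaf_ind x y : H x = E -> hamiltonian_leaf A XR x y -> [/\ Q x y, Q y x & H y = E].
Proof.
move=> Hx [ts]; elim: ts y => [y ->|[t s] ts IH y [x1 [x2 [/IH[q1 q1' H1] f1 f2]]]].
  by have h := Qplaque (same_plaque_refl Hx); split.
have [q2 q2' H2] := flow_ind dir_JXR H1 f1.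
have [q3 q3' H3] := flow_ind dir_XR H2 f2.
by split => //; [apply: Qtrans q1 (Qtrans q2 q3)|apply: Qtrans q3' (Qtrans q2' q1')].
Qed.

(** Near each time the trajectory stays in a plaque, so the times related to [z1] are open and
    closed in [U]; connectedness of [U] takes the place of subdividing an interval. *)
Lemma trajectory_ind U g z1 z2 : holomorphic_trajectory A XH U g ->
  (forall z, U z -> H (g z) = E) -> U z1 -> U z2 -> Q (g z1) (g z2).
Proof.
move=> [oU cU _ hg] HgE U1 U2.
have dc z : U z -> dcurve A XH [set: C] g z.
  move=> Uz; have [gc gd] := hg z Uz; split=> [N /gc /nbhs_nm[d d0 hd]|c Ac dg e ep].
    by exists d => // t _; apply: hd.
  by have [d d0 hd] := derive_eps (gd c Ac dg) ep; exists d => // t _; apply: hd.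
have loc z : U z -> exists2 d : R, 0 < d & forall w, nm (w - z) < d ->
    U w /\ same_plaque (g z) (g w).
  move=> Uz; have [c [r [hb dg]]] := flow_box_exists hsys hXH hE (HgE z Uz).
  have [rho rho0 hrho] := (open_nm _).1 oU z Uz.
  have st : star [set: C] z by [].
  have [|d d0 hd] := curve_in_box hsys hb rho0 I st (g := g) _ dg.
    by move=> s _ /hrho/dc.
  exists (Num.min rho d); first by rewrite lt_min rho0.
  move=> w; rewrite lt_min => /andP[w1 w2]; split; first exact: hrho.
  have [dw cw] := hd w I w2; exists c, r; split => //; first exact: HgE.
  by move=> j j0; rewrite cw add_e0_coord (negbTE j0) addr0.
pose B := U `&` [set z | Q (g z1) (g z)].
suff BU : B = U by have : B z2 by [rewrite BU]; case.
apply: cU.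
- exists z1; split => //; apply: Qplaque; apply: same_plaque_refl; exact: HgE.
- exists B; last by apply/seteqP; split => z //=; [case|case].
  apply/open_nm => z [Uz qz]; have [d d0 hd] := loc z Uz; exists d => // w /hd[Uw pl].
  by split => //; apply: Qtrans qz (Qplaque pl).
- exists (~` (U `&` [set z | ~ Q (g z1) (g z)])).
    apply: open_closedC; apply/open_nm => z [Uz qz].
    have [d d0 hd] := loc z Uz; exists d => // w /hd[Uw pl]; split => // qw; apply: qz.
    by apply: Qtrans qw _; apply: Qplaque; apply: same_plaque_sym.
  apply/seteqP; split => z [Uz qz]; split => //; first by case.
  by apply: contrapT => nq; apply: qz.
Qed.

End PlaqueInduction.

Local Notation leaf := (hamiltonian_leaf A XR).

Lemma leaf_refl x : leaf x x. Proof. by exists [::]. Qed.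

Lemma leaf_trans x y z : leaf x y -> leaf y z -> leaf x z.
Proof.
move=> [ts1 h1] [ts2 h2]; exists (ts2 ++ ts1); elim: ts2 z h2 => [z ->//|[t s] ts IH z].
by move=> [x1 [x2 [h f1 f2]]]; exists x1, x2; split => //; apply: IH.
Qed.

(** A plaque is a disc in coordinate 0, moved through by the two flows horizontally and vertically.
    The route [a, Re a, 0, Re b, b] stays inside the disc, whereas the corner of a direct route from
    [a] to [b] may lie outside. *)
Lemma plaque_leaf x y : same_plaque x y -> leaf x y.
Proof.
move=> [c [r [hb dx dy _ h]]]; have [_ r0 _ _ _] := hb.
pose p (a : C) := cinv c (c x + (a - c x 0 0) *: e0).
have pr a : nm a < r -> nm (c x + (a - c x 0 0) *: e0) < r.
  move=> ha; apply: (@le_lt_trans _ _ (Num.max (nm a) (nm (c x)))).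
    apply: nm_le => [|i j]; first by rewrite le_max nm_ge0.
    rewrite ord1 add_e0_coord le_max; have [->|j0] := eqVneq j 0.
      by rewrite addrC subrK lexx.
    by rewrite addr0 nm_entry orbT.
  by rewrite gt_max ha (box_nm hb dx).
have move1 theta V a b (s : R) : real_flow_dir theta V -> nm a < r -> nm b < r ->
    b = a + s%:C * theta -> flow A V s (p a) (p b).
  move=> dir ha hb' e; have [da ca] := box_mem hb (pr a ha).
  have E1 : c (p a) + (s%:C * theta) *: e0 = c x + (b - c x 0 0) *: e0.
    by rewrite ca -addrA -scalerDl e; congr (_ + _ *: _); ring.
  have := box_flow dir hb da (s := s); rewrite E1; apply; exact: pr.
have xE : x = p (c x 0 0) by rewrite /p subrr scale0r addr0 (box_inv hb dx).
have yE : y = p (c y 0 0) by rewrite /p add_e0 // (box_inv hb dy).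
have ax : nm (c x 0 0) < r by apply: le_lt_trans (nm_entry _ _ _) (box_nm hb dx).
have ay : nm (c y 0 0) < r by apply: le_lt_trans (nm_entry _ _ _) (box_nm hb dy).
have z0 : nm (0 : C) < r by rewrite nm0.
have re a : nm a < r -> nm ((complex.Re a)%:C : C) < r.
  by rewrite nmR; apply: le_lt_trans; apply: Re_le_nm.
rewrite xE yE; move: (c x 0 0) (c y 0 0) ax ay => a b ha hb'.
apply: (@leaf_trans _ (p 0)).
  exists [:: (- complex.Re a, - complex.Im a)], (p a), (p (complex.Re a)%:C); split => //.
    apply: (move1 _ _ _ _ _ dir_JXR) => //; first exact: re.
    by rewrite {2}(complexE a) rmorphN /=; ring.
  apply: (move1 _ _ _ _ _ dir_XR) => //; first exact: re.
  by rewrite rmorphN /=; ring.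
apply: (@leaf_trans _ (p (complex.Re b)%:C)).
  exists [:: (complex.Re b, 0)], (p 0), (p 0); split => //.
    by apply: (move1 _ _ _ _ _ dir_JXR) => //; rewrite mul0r addr0.
  apply: (move1 _ _ _ _ _ dir_XR) => //; first exact: re.
  by rewrite add0r mulr1.
exists [:: (0, complex.Im b)], (p (complex.Re b)%:C), (p b); split => //.
  apply: (move1 _ _ _ _ _ dir_JXR) => //; first exact: re.
  by rewrite {1}(complexE b) /=; ring.
by apply: (move1 _ _ _ _ _ dir_XR) => //; rewrite mul0r addr0.
Qed.

(** Symmetry is inherited from the plaques instead of being obtained by reversing flow words. *)
Lemma leaf_sym x y : H x = E -> leaf x y -> leaf y x /\ H y = E.
Proof.
move=> Hx h; have [_ ? ?] := leaf_ind leaf_trans plaque_leaf Hx h.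
by split.
Qed.

End Leaves.

(** * Slices *)

Section SubspaceTopology.
Variables (T : topologicalType) (S : set T).

Lemma nbhs_set_val (y : set_type S) (N : set T) : nbhs (set_val y) N -> nbhs y (set_val @^-1` N).
Proof. by move=> hN; apply: (@initial_continuous _ _ (set_val : set_type S -> T) y). Qed.

Lemma nbhs_subtypeP (y : set_type S) (N : set (set_type S)) : nbhs y N ->
  exists2 M, nbhs (set_val y) M & forall x, M (set_val x) -> N x.
Proof.
rewrite nbhsE => -[B [[W oW <-] By] BN]; exists W; last by move=> x; apply: BN.
by exists W.
Qed.

Lemma set_val_inj : injective (set_val : set_type S -> T).
Proof. exact: val_inj. Qed.

Lemma set_valS (y : set_type S) : S (set_val y).
Proof. exact: set_mem (valP y). Qed.

Lemma set_type_of x : S x -> exists y : set_type S, set_val y = x.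
Proof. by move=> Sx; exists (exist _ x (mem_set Sx)). Qed.

Lemma subtype_hausdorff : hausdorff_space T -> hausdorff_space (set_type S).
Proof.
move=> hT p q pq; apply: set_val_inj; apply: hT => P Q hP hQ.
have [z [Pz Qz]] := pq _ _ (nbhs_set_val hP) (nbhs_set_val hQ).
by exists (set_val z).
Qed.

Lemma subtype_second_countable : @second_countable T -> @second_countable (set_type S).
Proof.
move=> [B cB [oB bB]]; exists [set set_val @^-1` b | b in B].
  exact: sub_countable (card_image_le _ _) cB.
split=> [_ [b Bb <-]|y N /nbhs_subtypeP[M hM MN]].
  by exists b => //; apply: oB.
have [b [Bb by_] bM] := bB _ M hM; exists (set_val @^-1` b).
  by split => //; exists b.
by move=> x bx; apply: MN; apply: bM.
Qed.

End SubspaceTopology.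

Section SliceAtlas.
Variables (R : realType) (X : topologicalType) (n m : nat) (le_mn : (m <= n)%N).
Local Notation C := (Cx R).
Variables (A : set (chart R X n)) (S : set X).
Hypothesis atl : complex_atlas A.

(** Inclusion as the first [m] coordinates; its transpose is the projection. *)
Definition pad_mx : 'M[C]_(m, n) := \matrix_(i, j) (i == j :> nat)%:R.

Lemma padE_lt (w : 'rV[C]_m) i : (w *m pad_mx) 0 (widen_ord le_mn i) = w 0 i.
Proof.
rewrite mxE (bigD1 i) //= mxE eqxx mulr1 big1 ?addr0 // => k ki.
by rewrite mxE /= -val_eqE /= in ki *; rewrite (negbTE ki) mulr0.
Qed.

Lemma padE_ge (w : 'rV[C]_m) (j : 'I_n) : (m <= j)%N -> (w *m pad_mx) 0 j = 0.
Proof.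
move=> mj; rewrite mxE big1 // => k _; rewrite mxE.
have [e|] := eqVneq (k : nat) j; last by rewrite mulr0.
by move: (ltn_ord k); rewrite e ltnNge mj.
Qed.

Lemma truncE (z : 'rV[C]_n) i : (z *m pad_mx^T) 0 i = z 0 (widen_ord le_mn i).
Proof.
rewrite mxE (bigD1 (widen_ord le_mn i)) //= !mxE eqxx mulr1 big1 ?addr0 // => k ki.
rewrite !mxE; have [e|] := eqVneq (i : nat) k; last by rewrite mulr0.
by case/eqP: ki; apply: val_inj => /=.
Qed.

Lemma nm_pad (w : 'rV[C]_m) : nm (w *m pad_mx) <= nm w.
Proof.
apply: nm_le => [|i j]; first exact: nm_ge0.
rewrite ord1; have [jm|mj] := ltnP j m.
  have -> : j = widen_ord le_mn (Ordinal jm) by apply: val_inj.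
  by rewrite padE_lt; apply: nm_entry.
by rewrite padE_ge // nm0 nm_ge0.
Qed.

Lemma pad_trunc (z : 'rV[C]_n) : (forall j : 'I_n, (m <= j)%N -> z 0 j = 0) ->
  z *m pad_mx^T *m pad_mx = z.
Proof.
move=> h; apply/rowP => j; have [jm|mj] := ltnP j m; last by rewrite padE_ge // h.
have -> : j = widen_ord le_mn (Ordinal jm) by apply: val_inj.
by rewrite padE_lt truncE.
Qed.

Lemma trunc_pad (w : 'rV[C]_m) : w *m pad_mx *m pad_mx^T = w.
Proof. by apply/rowP => i; rewrite truncE padE_lt. Qed.

Definition slice_of (c : chart R X n) (k : chart R (set_type S) m) :=
  [/\ forall x, dom c x -> S x <-> (forall j : 'I_n, (m <= j)%N -> c x 0 j = 0),
     dom k = [set y | dom c (set_val y)],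
     forall y, dom k y -> forall i, k y 0 i = c (set_val y) 0 (widen_ord le_mn i) &
     forall y, dom k y -> cinv k (k y) = y].

Section OneSlice.
Variables (c : chart R X n) (k : chart R (set_type S) m).
Hypothesis hck : slice_of c k.
Hypothesis hc : is_chart c.

Lemma slice_dom y : dom k y <-> dom c (set_val y).
Proof. by case: hck => _ -> _ _. Qed.

Lemma slice_trunc y : dom k y -> k y = c (set_val y) *m pad_mx^T.
Proof. by move=> dy; apply/rowP => i; rewrite truncE; case: hck => _ _ -> //. Qed.

Lemma slice_pad y : dom k y -> k y *m pad_mx = c (set_val y).
Proof.
move=> dy; rewrite slice_trunc // pad_trunc //.
case: hck => h _ _ _; apply: (h _ ((slice_dom y).1 dy)).1; exact: set_valS.
Qed.

Lemma slice_val y : dom k y -> set_val y = cinv c (k y *m pad_mx).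
Proof. by move=> dy; rewrite slice_pad //; case: hc => _ _ -> //; apply/slice_dom. Qed.

Lemma slice_image w : (c @` dom c) (w *m pad_mx) -> exists2 y, dom k y & k y = w.
Proof.
move=> [x dx e]; have Sx : S x.
  case: hck => h _ _ _; apply/(h x dx) => j mj; rewrite e; exact: padE_ge.
have [y ye] := set_type_of Sx; have dy : dom k y by apply/slice_dom; rewrite ye.
by exists y => //; rewrite slice_trunc // ye e trunc_pad.
Qed.

Lemma slice_is_chart : is_chart k.
Proof.
have [od oi cK cc ci] := hc; have [_ dE _ kK] := hck.
have dopen : open (dom k) by rewrite dE; exists (dom c).
split => //.
- apply/open_nm => _ [y dy <-].
  have zi : (c @` dom c) (k y *m pad_mx).
    by rewrite slice_pad //; exists (set_val y) => //; apply/slice_dom.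
  have [e e0 he] := (open_nm _).1 oi _ zi; exists e => // w hw.
  have [|y' dy' <-] := @slice_image w; last by exists y'.
  by apply: he; rewrite -mulmxBl; apply: le_lt_trans (nm_pad _) hw.
- move=> y dy N; rewrite slice_trunc // => hN.
  have cont : {for set_val y, continuous ((fun z => z *m pad_mx^T) \o c)}.
    apply: continuous_comp; first by apply: cc; apply/slice_dom.
    exact: hasd_continuous (hasd_lin (pad_mx^T) (c (set_val y))).
  have h1 := nbhs_set_val (cont N hN).
  have h2 : nbhs y (dom k) by apply: open_nbhs_nbhs.
  suff : nbhs y [set x | N (k x)] by [].
  by apply: filterS2 h1 h2 => x /= h dx; rewrite slice_trunc.
- move=> _ [y dy <-] N; rewrite kK // => /nbhs_subtypeP[M hM MN].
  have zi : (c @` dom c) (k y *m pad_mx).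
    by rewrite slice_pad //; exists (set_val y) => //; apply/slice_dom.
  have hM' : nbhs (k y *m pad_mx) (cinv c @^-1` M).
    by apply: (ci _ zi); rewrite -slice_val.
  have [e1 e10 h1] := (open_nm _).1 oi _ zi.
  have [e2 e20 h2] := (nbhs_nm _ _).1 hM'.
  apply/nbhs_nm; exists (Num.min e1 e2); first by rewrite lt_min e10.
  move=> w; rewrite lt_min => /andP[w1 w2].
  have pw : nm (w *m pad_mx - k y *m pad_mx) <= nm (w - k y) by rewrite -mulmxBl nm_pad.
  have [|y' dy' e] := @slice_image w; first by apply: h1; apply: le_lt_trans pw w1.
  rewrite /= -e kK //; apply: MN; rewrite slice_val // e.
  by apply: h2; apply: le_lt_trans pw w2.
Qed.

End OneSlice.

(** The induced transition is the ambient one between padding and truncation, both linear. *)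
Lemma slice_transition c1 c2 k1 k2 : holomorphic_chart A c1 -> holomorphic_chart A c2 ->
  slice_of c1 k1 -> slice_of c2 k2 -> holomorphic_transition k1 k2.
Proof.
move=> h1 h2 s1 s2 _ [y [d1 d2] <-].
have [i1 _] := h1; have [i2 _] := h2.
have D1 : dom c1 (set_val y) by apply/(slice_dom s1).
have D2 : dom c2 (set_val y) by apply/(slice_dom s2).
have [L hL] := transition_hasd (holomorphic_chart_transition atl h1 h2) D1 D2.
have k1c := slice_is_chart s1 i1; have k2c := slice_is_chart s2 i2.
have oI : open (k1 @` (dom k1 `&` dom k2)) by apply: open_chart_image => //; case: k2c.
have [e e0 he] := (open_nm _).1 oI (k1 y) ltac:(by exists y).
have hp : hasd (transition c1 c2 \o mulmx^~ pad_mx) (k1 y) (pad_mx *m L).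
  apply: hasd_comp (hasd_lin _ _) _; rewrite /= (slice_pad s1) //.
have := hasd_comp hp (hasd_lin (pad_mx^T) _) => /(hasd_near e0 _) hn.
have /hn : forall w, nm (w - k1 y) < e ->
    (mulmx^~ pad_mx^T \o (transition c1 c2 \o mulmx^~ pad_mx)) w = transition k1 k2 w.
  move=> w /he[x [x1 x2] <-]; rewrite /transition /= -(slice_val s1 i1) // -(slice_trunc s2) //.
  by case: k1c => _ _ ->.
by case/hasd_diff.
Qed.

Lemma slice_complex_atlas :
  (forall y, exists2 k, slice_atlas le_mn A S k & dom k y) ->
  complex_atlas (slice_atlas le_mn A S).
Proof.
move=> cov; split => // [k [c [isc _] s]|k1 k2 [c1 h1 s1] [c2 h2 s2]].
  exact: slice_is_chart s isc.
exact: slice_transition h1 h2 s1 s2.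
Qed.

Lemma slice_chart_exists c (y0 : set_type S) : holomorphic_chart A c ->
  (forall x, dom c x -> S x <-> (forall j : 'I_n, (m <= j)%N -> c x 0 j = 0)) ->
  exists k, slice_of c k.
Proof.
move=> [isc _] hS.
(* An inverse with values in the subtype must be total; [y0] is its default value off the slice. *)
have ex (w : 'rV[C]_m) : exists y : set_type S, S (cinv c (w *m pad_mx)) -> set_val y = cinv c (w *m pad_mx).
  have [h|h] := pselect (S (cinv c (w *m pad_mx))); last by exists y0.
  by have [y ye] := set_type_of h; exists y.
have [inv hinv] := choice ex.
exists (Chart [set y | dom c (set_val y)] (fun y => c (set_val y) *m pad_mx^T) inv).
split => // [y dy i|y dy /=]; first by rewrite /= truncE.
have e : cinv c (c (set_val y) *m pad_mx^T *m pad_mx) = set_val y.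
  rewrite pad_trunc; last by apply: (hS _ dy).1; apply: set_valS.
  by case: isc => _ _ ->.
by apply: set_val_inj; rewrite hinv e //; apply: set_valS.
Qed.

End SliceAtlas.

(** * A leaf meets a flow box in countably many plaques *)

Section Countability.
Variable R : realType.

(** Cantor's nested intervals: between two distinct points there would be a point of [S] different
    from every enumerated one. *)
Lemma countable_interval (S : set R) a b : countable S -> S a -> S b -> is_interval S -> a = b.
Proof.
move=> cS Sa Sb iS; wlog ab : a b Sa Sb / a < b.
  by move=> hw; have [ab|ba|//] := ltgtP a b; [exact: hw|apply/esym; exact: hw].
have [code inj] := countable_injP _ cS.
have ex (k : nat) : exists x : R, forall y, S y -> code y = k -> y = x.
  have [[x [Sx cx]]|h] := pselect (exists x, S x /\ code x = k).
    by exists x => y Sy cy; apply: inj; rewrite ?inE // cx.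
  by exists 0 => y Sy cy; exfalso; apply: h; exists y.
have [f hf] := choice ex.
(* Keep the third of the interval that avoids the k-th element of S. *)
pose step (k : nat) (t : R * R) : R * R :=
  (if f k <= t.1 + t.2 / 2 then t.1 + t.2 * 2 / 3 else t.1, t.2 / 3).
have [u [u0 uS]] : exists u : nat -> R * R, u 0%N = (a, b - a) /\ forall k, u k.+1 = step k (u k).
  by exists (fun k => iteri k step (a, b - a)).
have up k : 0 < (u k).2.
  by elim: k => [|k IH]; rewrite ?u0 ?uS /= ?subr_gt0 // divr_gt0.
have [x hx] : exists x, forall k, (u k).1 <= x <= (u k).1 + (u k).2.
  apply: (@nested_intervals R (fun k => (u k).1) (fun k => (u k).2)) => k.
  - by rewrite uS /=; have := up k; case: ifP => _; lra.
  - by rewrite uS /=; have := up k; case: ifP => _; lra.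
  - exact: ltW.
have Sx : S x by apply: iS Sa Sb _ _; have := hx 0%N; rewrite u0 /= addrC subrK.
have := hf (code x) x Sx erefl => xf.
have := hx (code x).+1; rewrite uS /= -xf; have := up (code x).
by case: ifP => [h|/negbT]; rewrite -?ltNge; lra.
Qed.

Local Notation C := (Cx R).

Definition rational_point (q : rat * rat) : C := ratr q.1 +i* ratr q.2.

Lemma rational_dense (z : C) (d : R) : 0 < d -> exists q, nm (rational_point q - z) < d.
Proof.
move=> d0; case: z => a b.
have [p1 h1] := rat_in_itvoo (x := a - d / 2) (y := a + d / 2) ltac:(lra).
have [p2 h2] := rat_in_itvoo (x := b - d / 2) (y := b + d / 2) ltac:(lra).
rewrite in_itv /= in h1; rewrite in_itv /= in h2.
exists (p1, p2); apply: le_lt_trans (nm_le_ReIm _) _ => /=.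
have : `|ratr p1 - a| < d / 2 by rewrite ltr_norml; lra.
have : `|ratr p2 - b| < d / 2 by rewrite ltr_norml; lra.
lra.
Qed.

End Countability.

Section LeafCountable.
Variables (R : realType) (m : nat) (X : topologicalType).
Local Notation C := (Cx R).
Local Notation n := m.+2.
Variables (A : set (chart R X n)) (Omega : chart R X n -> X -> 'M[C]_n).
Variables (H : X -> C) (XH : chart R X n -> X -> 'rV[C]_n) (E : C).
Variable XR : chart R X n -> X -> 'rV[R]_n * 'rV[R]_n.
Hypothesis hsys : holomorphic_hamiltonian_system A Omega H.
Hypothesis hXH : hamiltonian_vfield A Omega H XH.
Hypothesis hXR : real_field_of A XH XR.
Hypothesis hE : regular_value A H E.

Local Notation e0 := (delta_mx 0 0 : 'rV[C]_n).
Local Notation box := (flow_box A H XH E).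
Local Notation leaf := (hamiltonian_leaf A XR).

(** One box is chosen for each basic open set that fits into some box. A point of the level has such
    a basic neighbourhood, and the box chosen for it covers the point. *)
Lemma countable_boxes x0 : H x0 = E -> exists b : nat -> chart R X n * R,
  (forall i, box (b i).1 (b i).2) /\ forall y, H y = E -> exists i, dom (b i).1 y.
Proof.
move=> Hx0; have [c0 [r0 [hb0 _]]] := flow_box_exists hsys hXH hE Hx0.
have [[_ [B cB [oB bB]] _] _ _ _ _] := hsys.
have [code inj] := countable_injP _ cB.
have ex (i : nat) : exists cr : chart R X n * R, box cr.1 cr.2 /\
    forall c r b, box c r -> B b -> code b = i -> b `<=` dom c -> b `<=` dom cr.1.
  have [[c [r [b [hb Bb cb sub]]]]|h] :=
    pselect (exists c r b, [/\ box c r, B b, code b = i & b `<=` dom c]).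
    exists (c, r); split => // c' r' b' _ Bb' cb' _.
    by have -> : b' = b by apply: inj; rewrite ?inE // cb.
  exists (c0, r0); split => // c r b hb Bb cb sub; exfalso; apply: h.
  by exists c, r, b.
have [b hb] := choice ex; exists b; split => [i|y Hy]; first by case: (hb i).
have [c [r [hc dy]]] := flow_box_exists hsys hXH hE Hy.
have od : nbhs y (dom c).
  by apply: open_nbhs_nbhs; split => //; have [] := box_chart hc.
have [V [BV Vy] Vc] := bB y _ od.
by exists (code V); have [_ h] := hb (code V); apply: (h c r V).
Qed.

(** The field is [e0] in both boxes, so a short move along it is the same translation in either. *)
Lemma box_compat c1 r1 c2 r2 y : box c1 r1 -> box c2 r2 -> dom c1 y -> dom c2 y ->
  exists2 d : R, 0 < d & forall s, nm s < d ->
    [/\ nm (c1 y + s *: e0) < r1, dom c2 (cinv c1 (c1 y + s *: e0)) &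
        c2 (cinv c1 (c1 y + s *: e0)) = c2 y + s *: e0].
Proof.
move=> h1 h2 d1 d2.
have rho0 : 0 < r1 - nm (c1 y) by rewrite subr_gt0; apply: box_nm h1 d1.
have near s : nm s < r1 - nm (c1 y) -> nm (c1 y + s *: e0) < r1.
  move=> hs; apply: le_lt_trans (nmD _ _) _; rewrite -ltrBrDl; apply: le_lt_trans hs.
  by rewrite nmZ ler_piMr ?nm_ge0 ?nm_e0.
have g0 : cinv c1 (c1 y + 0 *: e0) = y by rewrite scale0r addr0 (box_inv h1 d1).
have st : star [set: C] 0 by [].
have [||d d0 hd] := curve_in_box hsys h2 rho0 Logic.I st (g := fun s => cinv c1 (c1 y + s *: e0)).
- move=> s _; rewrite subr0 => /near hs; exact: box_dcurve h1 d1 hs.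
- by rewrite g0.
exists (Num.min d (r1 - nm (c1 y))); first by rewrite lt_min d0.
move=> s; rewrite lt_min => /andP[s1 s2]; have := hd s Logic.I; rewrite subr0 => /(_ s1)[ds cs].
split => //; first exact: near.
by move: cs; rewrite g0.
Qed.

(** [Z] is indexed by finite words of box numbers and rational times. The invariant [G y] says that
    in some chosen box the plaque of [y] meets [Z]; it passes along plaques, hence along the
    leaf. *)
Theorem leaf_plaques_countable x0 : H x0 = E -> exists2 Z : set X, countable Z &
  forall c r y, box c r -> dom c y -> leaf x0 y ->
    exists2 z, Z z & dom c z /\ forall j : 'I_n, j != 0 -> c z 0 j = c y 0 j.
Proof.
move=> Hx0; have [b [hb cov]] := countable_boxes Hx0.
(* A total map: where the move leaves the box its value is arbitrary, which does not affect
   countability. *)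
pose step (w : nat * (rat * rat)) z :=
  cinv (b w.1).1 ((b w.1).1 z + rational_point R w.2 *: e0).
pose Z := [set foldr step x0 w | w in [set: seq (nat * (rat * rat))]].
exists Z; first exact: sub_countable (card_image_le _ _) (countableP _).
have Zstep w z : Z z -> Z (step w z) by move=> [u _ <-]; exists (w :: u).
pose G y := exists i z, [/\ Z z, dom (b i).1 z, dom (b i).1 y &
   forall j : 'I_n, j != 0 -> (b i).1 z 0 j = (b i).1 y 0 j].
(* Moving [z] by a rational approximation of the difference of the 0-th coordinates lands close to
   [y] on its plaque, where [box_compat] passes to any other box around [y]. *)
have reach c r y : box c r -> dom c y -> G y ->
    exists2 z, Z z & dom c z /\ forall j : 'I_n, j != 0 -> c z 0 j = c y 0 j.
  move=> hc dy [i [z [Zz dz dyi hzy]]].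
  have [d d0 hd] := box_compat (hb i) hc dyi dy.
  have [q hq] := rational_dense ((b i).1 y 0 0 - (b i).1 z 0 0) d0.
  have [q1 q2 q3] := hd _ hq.
  have e : step (i, q) z = cinv (b i).1 ((b i).1 y + (rational_point R q -
      ((b i).1 y 0 0 - (b i).1 z 0 0)) *: e0).
    rewrite /step /= -(add_e0 hzy) -addrA -scalerDl; congr (cinv _ (_ + _ *: _)).
    by rewrite add_e0 // addrC subrK.
  exists (step (i, q) z); first exact: Zstep.
  rewrite e; split => // j j0.
  by rewrite q3 add_e0_coord (negbTE j0) addr0.
have Gx0 : G x0.
  have [i di] := cov x0 Hx0; exists i, x0; split => //.
  by exists [::].
suff G_plaque x y : same_plaque A H XH E x y -> G x -> G y.
  move=> c r y hc dy hl; apply: (reach c r y hc dy).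
  by have [h _ _] := leaf_ind hsys hXH hXR hE (fun x y z h1 h2 h => h2 (h1 h)) G_plaque Hx0 hl; apply: h.
move=> [c [r [hc dx dy Hx hxy]]] /(reach c r x hc dx)[z Zz [dz hz]].
have Hz : H z = E by apply: plaque_level hc dx dz _ Hx => j j0; rewrite hz.
have Gz : G z by have [i di] := cov z Hz; exists i, z.
(* The box [c] need not be a chosen one. The segment from [z] to [y] in its plaque is covered by
   chosen boxes, and [interval_chain] hands [G] from one to the next. *)
pose p (u : R) := cinv c (c z + (u%:C * (c y 0 0 - c z 0 0)) *: e0).
have hzy j : j != 0 -> c z 0 j = c y 0 j by move=> j0; rewrite hz // hxy.
have pin u : 0 <= u <= 1 -> nm (c z + (u%:C * (c y 0 0 - c z 0 0)) *: e0) < r.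
  move=> hu; rewrite -scalerA.
  have := @ball_convex R _ 0 (c z) (c y) r u; rewrite !subr0.
  move=> /(_ (box_nm hc dz) (box_nm hc dy) hu); congr (nm (_ + _ *: _) < r).
  by rewrite -{1}(add_e0 hzy) addrC addKr.
have p0 : p 0 = z by rewrite /p mul0r scale0r addr0 (box_inv hc dz).
have p1 : p 1 = y by rewrite /p mul1r add_e0 // (box_inv hc dy).
suff : G (p 0) -> G (p 1) by rewrite p0 p1; apply.
apply: (@interval_chain R (fun u v => G (p u) -> G (p v))) => //.
  by move=> u v w _ _ h1 h2 /h1/h2.
move=> s hs; have [dp cp] := box_mem hc (pin s hs).
have Hp : H (p s) = E.
  apply: plaque_level hc dz dp _ Hz => j j0.
  by rewrite cp add_e0_coord (negbTE j0) addr0.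
have [i di] := cov _ Hp.
have [d d0 hd] := box_compat hc (hb i) dp di.
have K0 : 0 < nm (c y 0 0 - c z 0 0) + 1 by rewrite ltr_wpDl ?nm_ge0.
have near u : `|u - s| < d / (nm (c y 0 0 - c z 0 0) + 1) ->
    dom (b i).1 (p u) /\ forall j : 'I_n, j != 0 -> (b i).1 (p u) 0 j = (b i).1 (p s) 0 j.
  rewrite ltr_pdivlMr // => hu.
  have [|_ h2 h3] := hd ((u - s)%:C * (c y 0 0 - c z 0 0)).
    rewrite nmM nmR; apply: le_lt_trans hu; apply: ler_wpM2l => //.
    by rewrite lerDl.
  have e : cinv c (c (p s) + ((u - s)%:C * (c y 0 0 - c z 0 0)) *: e0) = p u.
    by rewrite cp -addrA -scalerDl -mulrDl -rmorphD [s + _]addrC subrK.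
  rewrite e in h2 h3; split => // j j0.
  by rewrite h3 add_e0_coord (negbTE j0) addr0.
exists (d / (nm (c y 0 0 - c z 0 0) + 1)); first by rewrite divr_gt0.
move=> u v _ _ /andP[us sv] h1 h2.
have [du eu] := near u ltac:(rewrite ltr_norml; lra).
have [dv ev] := near v ltac:(rewrite ltr_norml; lra).
move=> /(reach _ _ _ (hb i) du)[z' Zz' [dz' hz']]; exists i, z'; split => // j j0.
by rewrite hz' // eu // ev.
Qed.

End LeafCountable.

(** * The foliation *)

Section Paths.
Variables (R : realType) (Y : topologicalType).

Definition path_in (L : set Y) (x y : Y) := exists f : R -> Y,
  [/\ {within `[0, 1], continuous f}, f 0 = x, f 1 = y &
      forall t, `[0, 1]%classic t -> L (f t)].

Lemma within01P (f : R -> Y) : {within `[0, 1], continuous f} <->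
  forall t, 0 <= t <= 1 -> forall N, nbhs (f t) N -> exists2 d : R, 0 < d &
    forall s, 0 <= s <= 1 -> `|s - t| < d -> N (f s).
Proof.
rewrite subspace_continuousP; split=> [h t ht N hN|h t /= ht N hN].
  have ht' : `[0, 1]%classic t by rewrite /= in_itv.
  have /nbhs_ballP[d d0 hd] := h t ht' N hN; exists d => // s hs hst.
  apply: hd; last by rewrite /= in_itv.
  by rewrite -ball_normE /ball_ /= distrC.
rewrite in_itv /= in ht; have [d d0 hd] := h t ht N hN.
apply/nbhs_ballP; exists d => // s; rewrite -ball_normE /ball_ /= distrC in_itv /= => hst hs.
exact: hd.
Qed.

Lemma path_in_trans L x y z : path_in L x y -> path_in L y z -> path_in L x z.
Proof.
move=> [f [/within01P cf f0 f1 fL]] [g [/within01P cg g0 g1 gL]].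
pose h (t : R) := if t <= 1 / 2 then f (2 * t) else g (2 * t - 1).
have hf t : t <= 1 / 2 -> h t = f (2 * t) by rewrite /h => ->.
have hg t : 1 / 2 <= t -> h t = g (2 * t - 1).
  rewrite le_eqVlt => /orP[/eqP<-|ht]; last by rewrite /h leNgt ht.
  rewrite /h lexx; have -> : 2 * (1 / 2) = 1 :> R by field.
  by rewrite subrr f1 g0.
exists h; split; first 1 last.
- by rewrite hf ?mulr0 ?f0 //; lra.
- by rewrite hg; [have -> : 2 * 1 - 1 = 1 :> R by ring|lra].
- move=> t; rewrite /= in_itv /= => ht; have [h1|/ltW h1] := leP t (1 / 2).
    by rewrite hf //; apply: fL; rewrite /= in_itv /=; lra.
  by rewrite hg //; apply: gL; rewrite /= in_itv /=; lra.
apply/within01P => t ht N hN.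
have F : exists2 d : R, 0 < d & forall s, 0 <= s <= 1 -> s <= 1 / 2 -> `|s - t| < d -> N (h s).
  have [h1|h1] := leP t (1 / 2).
    rewrite hf // in hN; have [d d0 hd] := cf (2 * t) ltac:(lra) N hN.
    exists (d / 2); first by lra.
    move=> s hs s2 hst; rewrite hf //; apply: hd; first by lra.
    by rewrite -mulrBr normrM ger0_norm //; lra.
  exists (t - 1 / 2); first by lra.
  by move=> s hs s2; rewrite ltr_norml; lra.
have G : exists2 d : R, 0 < d & forall s, 0 <= s <= 1 -> 1 / 2 <= s -> `|s - t| < d -> N (h s).
  have [h1|h1] := leP (1 / 2) t.
    rewrite hg // in hN; have [d d0 hd] := cg (2 * t - 1) ltac:(lra) N hN.
    exists (d / 2); first by lra.
    move=> s hs s2 hst; rewrite hg //; apply: hd; first by lra.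
    have -> : 2 * s - 1 - (2 * t - 1) = 2 * (s - t) by ring.
    by rewrite normrM ger0_norm //; lra.
  exists (1 / 2 - t); first by lra.
  by move=> s hs s2; rewrite ltr_norml; lra.
have [d1 d10 h1] := F; have [d2 d20 h2] := G.
exists (Num.min d1 d2); first by rewrite lt_min d10.
move=> s hs; rewrite lt_min => /andP[s1 s2].
by have [k|/ltW k] := leP s (1 / 2); [exact: h1|exact: h2].
Qed.

Lemma path_connected_set (L : set Y) x : L x -> (forall y, L y -> path_in L x y) ->
  (forall y, L y -> path_in L y x) -> path_connected R L.
Proof.
move=> Lx to from; split; first by exists x.
by move=> y z Ly Lz; apply: path_in_trans (from y Ly) (to z Lz).
Qed.

End Paths.

Section Foliation.
Variables (R : realType) (m : nat) (X : topologicalType).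
Local Notation C := (Cx R).
Local Notation n := m.+2.
Variables (A : set (chart R X n)) (Omega : chart R X n -> X -> 'M[C]_n).
Variables (H : X -> C) (XH : chart R X n -> X -> 'rV[C]_n) (E : C).
Variable XR : chart R X n -> X -> 'rV[R]_n * 'rV[R]_n.
Hypothesis hsys : holomorphic_hamiltonian_system A Omega H.
Hypothesis hXH : hamiltonian_vfield A Omega H XH.
Hypothesis hXR : real_field_of A XH XR.
Hypothesis hE : regular_value A H E.

Local Notation e0 := (delta_mx 0 0 : 'rV[C]_n).
Local Notation box := (flow_box A H XH E).
Local Notation leaf := (hamiltonian_leaf A XR).
Local Notation S := (H @^-1` [set E]).
Local Notation Y := (set_type S).
Local Notation AY := (slice_atlas (leq_pred n) A S).

Let atl : complex_atlas A. Proof. by case: hsys => -[]. Qed.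

Lemma val_level (y : Y) : H (set_val y) = E.
Proof. exact: (set_valS y). Qed.

(** The last coordinate is the only one cut to 0 by a slice of dimension [m.+1], and in a box it is
    [H - E]. *)
Lemma box_slice c r (y : Y) : box c r -> dom c (set_val y) ->
  exists2 k : chart R Y m.+1, slice_of (leq_pred n) c k & dom k y.
Proof.
move=> hb dy; have [hc r0 img hH _] := hb.
have [|k hk] := @slice_chart_exists R X n m.+1 (leq_pred n) A S c y hc.
  move=> x dx; split=> [Hx j mj|h].
    have -> : j = ord_max.
      by apply: val_inj => /=; apply/eqP; rewrite eqn_leq mj andbT -ltnS.
    by rewrite hH //; rewrite /= in Hx; rewrite Hx subrr.
  by have := h ord_max (leqnn _); rewrite hH // => /eqP; rewrite subr_eq0 => /eqP.
by exists k => //; apply/(slice_dom hk).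
Qed.

Lemma slice_manifold : complex_manifold AY.
Proof.
have [[hT sc _] _ _ _ _] := hsys.
split; [exact: subtype_hausdorff|exact: subtype_second_countable|].
apply: slice_complex_atlas => // y.
have [c [r [hb dy]]] := flow_box_exists hsys hXH hE (val_level y).
by have [k hk dk] := box_slice hb dy; exists k => //; exists c => //; case: hb.
Qed.

Section Box.
Variables (c : chart R X n) (r : R) (k : chart R Y m.+1).
Hypothesis hb : box c r.
Hypothesis hk : slice_of (leq_pred n) c k.

Lemma slice_same_plaque x y : dom k x -> dom k y ->
  (forall j : 'I_m.+1, (1 <= j)%N -> k x 0 j = k y 0 j) ->
  forall j : 'I_n, j != 0 -> c (set_val x) 0 j = c (set_val y) 0 j.
Proof.
move=> dx dy h j j0; rewrite -(slice_pad hk dx) -(slice_pad hk dy).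
have [jm|mj] := ltnP j m.+1; last by rewrite !padE_ge.
have -> : j = widen_ord (leq_pred n) (Ordinal jm) by apply: val_inj.
by rewrite !padE_lt; apply: h; rewrite lt0n.
Qed.

Lemma slice_plaque x y : dom k x -> dom k y ->
  (forall j : 'I_m.+1, (1 <= j)%N -> k x 0 j = k y 0 j) ->
  same_plaque A H XH E (set_val x) (set_val y).
Proof.
move=> dx dy h; exists c, r; split => //.
- exact/(slice_dom hk).
- exact/(slice_dom hk).
- exact: val_level.
- exact: slice_same_plaque.
Qed.

Lemma slice_ball z : nm z < r -> exists2 y, dom k y & k y = z.
Proof.
move=> hz; apply: (slice_image hk); have [_ _ -> _ _] := hb.
exact: le_lt_trans (nm_pad (leq_pred n) _) hz.
Qed.

Lemma slice_nm y : dom k y -> nm (k y) < r.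
Proof.
move=> dy; apply: le_lt_trans (box_nm hb ((slice_dom hk y).1 dy)).
apply: nm_le => [|i j]; first exact: nm_ge0.
rewrite ord1; case: (hk) => _ _ -> // _; exact: nm_entry.
Qed.

Lemma plaque_path x y : dom k x -> plaque 1 k (k x) y -> path_in R (plaque 1 k (k x)) x y.
Proof.
move=> dx [dy hxy]; have isk := slice_is_chart hk (box_chart hb).
have [_ _ kK _ ci] := isk.
pose p (t : R) := k x + t%:C *: (k y - k x).
have pin t : 0 <= t <= 1 -> nm (p t) < r.
  move=> ht; have := @ball_convex R _ 0 (k x) (k y) r t; rewrite !subr0; apply => //; exact: slice_nm.
have inv t : 0 <= t <= 1 -> dom k (cinv k (p t)) /\ k (cinv k (p t)) = p t.
  by move=> ht; have [z dz <-] := slice_ball (pin t ht); rewrite kK.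
exists (fun t => cinv k (p t)); split.
- apply/within01P => t ht N hN.
  have pi : (k @` dom k) (p t) by have [d e] := inv t ht; exists (cinv k (p t)).
  have /nbhs_nm[d d0 hd] := ci _ pi N hN.
  have K0 : 0 < nm (k y - k x) + 1 by rewrite ltr_wpDl ?nm_ge0.
  exists (d / (nm (k y - k x) + 1)); first by rewrite divr_gt0.
  move=> s hs; rewrite ltr_pdivlMr // => hst; apply: hd.
  rewrite /p opprD addrACA subrr add0r -scalerBl -rmorphB nmZ nmR.
  by apply: le_lt_trans hst; apply: ler_wpM2l => //; rewrite lerDl.
- by rewrite /p scale0r addr0 kK.
- by rewrite /p scale1r addrC subrK kK.
- move=> t; rewrite /= in_itv /= => ht; have [dt et] := inv t ht; split => // j j1.
  by rewrite et /p !mxE hxy // subrr mulr0 addr0.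
Qed.

Lemma plaque_connected x : dom k x -> connected (plaque 1 k (k x)).
Proof.
move=> dx.
have ex y : exists f : R -> Y, plaque 1 k (k x) y ->
    [/\ {within `[0, 1], continuous f}, f 0 = x, f 1 = y &
      forall t, `[0, 1]%classic t -> plaque 1 k (k x) (f t)].
  have [py|npy] := pselect (plaque 1 k (k x) y); last by exists (fun=> x).
  by have [f hf] := plaque_path dx py; exists f.
have [f hf] := choice ex.
have I0 : `[0, 1]%classic (0 : R) by rewrite /= in_itv /= lexx ler01.
have I1 : `[0, 1]%classic (1 : R) by rewrite /= in_itv /= lexx ler01.
have -> : plaque 1 k (k x) = \bigcup_(y in plaque 1 k (k x)) (f y @` `[0, 1]).
  apply/seteqP; split=> [y py|_ [y py [t ht <-]]].
    by exists y => //; have [_ _ f1 _] := hf y py; exists 1.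
  by have [_ _ _ h] := hf y py; apply: h.
apply: bigcup_connected.
  by exists x => y py; have [_ f0 _ _] := hf y py; exists 0.
move=> y py; have [cf _ _ _] := hf y py.
by apply: connected_continuous_connected cf; apply: segment_connected.
Qed.

(* A connected subset of a leaf inside a box projects to a connected countable
   set of transversal coordinates, hence to a point. *)
Lemma connected_leaf_plaque (K : set Y) x0 x y : H x0 = E -> connected K ->
  (forall z, K z -> dom k z /\ leaf x0 (set_val z)) -> K x -> K y ->
  forall j : 'I_m.+1, (1 <= j)%N -> k x 0 j = k y 0 j.
Proof.
move=> Hx0 cK hK Kx Ky j j1.
have [Z cZ hZ] := leaf_plaques_countable hsys hXH hXR hE Hx0.
have [_ _ kE _] := hk; have [_ _ _ ck _] := slice_is_chart hk (box_chart hb).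
pose J := widen_ord (leq_pred n) j.
have J0 : J != 0 by rewrite -val_eqE /= -lt0n.
(* Real and imaginary part are treated separately, so that the image lies in [R], where connected
   sets are intervals. *)
have key (phi : C -> R) : (forall z w : C, `|phi z - phi w| <= nm (z - w)) ->
    phi (k x 0 j) = phi (k y 0 j).
  move=> lip; pose psi (z : Y) := phi (k z 0 j).
  have cont : {in K, continuous psi}.
    move=> z; rewrite inE => Kz; have [dz _] := hK z Kz.
    move=> N /nbhs_ballP[e e_gt0 he].
    have hN : nbhs (k z) [set w | nm (w - k z) < e] by apply/nbhs_nm; exists e.
    have hN' : nbhs z [set w | nm (k w - k z) < e] := ck z dz _ hN.
    suff : nbhs z [set w | N (psi w)] by [].
    apply: filterS hN' => w /= hw; apply: he.
    rewrite -ball_normE /ball_ /= distrC; apply: le_lt_trans (lip _ _) _.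
    by have := nm_entry (k w - k z) 0 j; rewrite !mxE => /le_lt_trans; apply.
  have cpsi : connected (psi @` K).
    apply: connected_continuous_connected => //.
    exact: continuous_in_subspaceT.
  apply: (@countable_interval R (psi @` K)).
  - apply: (@sub_countable _ _ _ ((fun z => phi (c z 0 J)) @` Z)).
      apply: subset_card_le => _ [z Kz <-]; have [dz lz] := hK z Kz.
      have [w Zw [dw hw]] := hZ c r _ hb ((slice_dom hk z).1 dz) lz.
      by exists w => //; rewrite hw // /psi kE.
    exact: sub_countable (card_image_le _ _) cZ.
  - by exists x.
  - by exists y.
  - exact/connected_intervalP.
have hRe := key (@complex.Re R) _; have hIm := key (@complex.Im R) _.
apply/eqP; rewrite eq_complex; apply/andP; split; apply/eqP.
  by apply: hRe => z w; rewrite -raddfB; apply: Re_le_nm.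
by apply: hIm => z w; rewrite -raddfB; apply: Im_le_nm.
Qed.

End Box.

Definition leaf_of (x : Y) : set Y := [set y | leaf (set_val x) (set_val y)].

Lemma leaf_of_image x : set_val @` (leaf_of x) = leaf (set_val x).
Proof.
apply/seteqP; split=> [_ [y hy <-] //|y hy].
have [_ Hy] := leaf_sym hsys hXH hXR hE (val_level x) hy.
have Sy : S y by [].
by have [z ez] := set_type_of Sy; exists z => //; rewrite /leaf_of /= ez.
Qed.

Lemma leaf_of_eq x y : leaf_of x y -> leaf_of x = leaf_of y.
Proof.
move=> h; have [h' _] := leaf_sym hsys hXH hXR hE (val_level x) h.
by apply/seteqP; split=> z hz; [exact: leaf_trans h' hz|exact: leaf_trans h hz].
Qed.

Lemma leaf_of_path x y : leaf_of x y -> path_in R (leaf_of x) x y.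
Proof.
move=> hy.
suff P a b : same_plaque A H XH E a b -> forall u v : Y, set_val u = a -> set_val v = b ->
    (* The path must run in the subtype, while the induction is over points of [X]; hence the
       relation [Q'] speaks of all lifts of its endpoints and carries their membership in the level
       and the leaf. *)
    leaf (set_val x) a -> leaf (set_val x) b /\ path_in R (leaf_of x) u v.
  pose Q' (a b : X) := H a = E -> leaf (set_val x) a -> [/\ H b = E, leaf (set_val x) b &
    forall u v : Y, set_val u = a -> set_val v = b -> path_in R (leaf_of x) u v].
  have Qt a b d : Q' a b -> Q' b d -> Q' a d.
    move=> h1 h2 Ha la; have [Hb lb p1] := h1 Ha la; have [Hd ld p2] := h2 Hb lb.
    split => // u v eu ev; have Sb : S b by [].
    have [w ew] := set_type_of Sb; exact: path_in_trans (p1 u w eu ew) (p2 w v ew ev).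
  have Qp a b : same_plaque A H XH E a b -> Q' a b.
    move=> pl Ha la; have [_ [_ [_ _ _ Hb _]]] := same_plaque_sym pl.
    have Sa : S a by []. have Sb : S b by [].
    have [u0 eu0] := set_type_of Sa; have [v0 ev0] := set_type_of Sb.
    split => //; first by have [] := P a b pl u0 v0 eu0 ev0 la.
    by move=> u v eu ev; have [] := P a b pl u v eu ev la.
  have [h _ _] := leaf_ind hsys hXH hXR hE Qt Qp (val_level x) hy.
  by have [_ _ h'] := h (val_level x) (leaf_refl _ _ _); apply: h'.
move=> pl u v eu ev la; have [c [r [hb da db _ hab]]] := pl.
have du : dom c (set_val u) by rewrite eu.
have [k hk dku] := box_slice hb du.
have dkv : dom k v by apply/(slice_dom hk); rewrite ev.
have lb : leaf (set_val x) b.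
  exact: leaf_trans la (plaque_leaf hXR pl).
split => //.
have pv : plaque 1 k (k u) v.
  split => // j j1; have [_ _ kE _] := hk; rewrite !kE // eu ev; apply/esym/hab.
  by rewrite -val_eqE /= -lt0n.
have [f [cf f0 f1 hf]] := plaque_path hb hk dku pv; exists f; split => // t ht.
have [dt et] := hf t ht; apply: leaf_trans la _; rewrite -eu; apply: (plaque_leaf hXR).
by apply: (slice_plaque hb hk dku dt) => j j1; rewrite et.
Qed.

Definition leaves : set (set Y) := [set L | exists x, L = leaf_of x].

Lemma leaves_foliation : holomorphic_foliation AY 1 leaves.
Proof.
split => //.
- split.
  + apply/seteqP; split=> // y _; exists (leaf_of y); first by exists y.
    exact: leaf_refl.
  + move=> _ _ [x ->] [y ->] [z [xz yz]] /=.
    by rewrite (leaf_of_eq xz) (leaf_of_eq yz).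
  + by move=> _ [x ->]; exists x; apply: leaf_refl.
- move=> _ [x ->]; apply: (@path_connected_set R Y (leaf_of x) x).
  + exact: leaf_refl.
  + exact: leaf_of_path.
  + move=> y xy; rewrite (leaf_of_eq xy); apply: leaf_of_path.
    by rewrite -(leaf_of_eq xy); apply: leaf_refl.
move=> y; have [c [r [hb dy]]] := flow_box_exists hsys hXH hE (val_level y).
have [k hk dk] := box_slice hb dy.
exists k.
  split => //; apply: holomorphic_chart_mem; first by case: slice_manifold.
  by exists c => //; case: hb.
move=> _ [x0 ->] x [dx lx]; exists (k x).
have sub : plaque 1 k (k x) `<=` dom k `&` leaf_of x0.
  move=> z [dz hz]; split => //; apply: leaf_trans lx _; apply: (plaque_leaf hXR).
  by apply: (slice_plaque hb hk dx dz) => j j1; rewrite hz.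
(* Maximality of the component gives one inclusion, since the plaque is connected and inside the
   leaf; countability of the transversal coordinates gives the other. *)
apply/seteqP; split=> [z hz|]; last first.
  by apply: (connected_component_max _ sub (plaque_connected hb hk dx)).
have cc : connected (connected_component (dom k `&` leaf_of x0) x).
  exact: component_connected.
have [dz lz] := connected_component_sub hz; split => // j j1.
have xx : connected_component (dom k `&` leaf_of x0) x x by apply: connected_component_refl.
apply/esym; apply: (connected_leaf_plaque hb hk (val_level x0) cc _ xx hz j1).
by move=> w /connected_component_sub[].
Qed.

End Foliation.

(** On an empty level regularity is vacuous and does not bound the dimension from below, so [d = 1]
    might exceed [n.-1]; the empty family with [d = 0] always fits. *)
Lemma empty_level_foliation (R : realType) (n : nat) (X : topologicalType)
  (A : set (chart R X n)) (H : X -> Cx R) (XH : chart R X n -> X -> 'rV[Cx R]_n)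
  (XR : chart R X n -> X -> 'rV[R]_n * 'rV[R]_n) (E : Cx R) :
  complex_manifold A -> (forall x, H x <> E) ->
  complex_manifold (slice_atlas (leq_pred n) A (H @^-1` [set E])) /\
  exists (d : nat) (F : set (set (set_type (H @^-1` [set E])))),
    [/\ holomorphic_foliation (slice_atlas (leq_pred n) A (H @^-1` [set E])) d F,
        forall x0 : set_type (H @^-1` [set E]), exists2 L, F L &
          L x0 /\ set_val @` L = hamiltonian_leaf A XR (set_val x0) &
        forall (U : set (Cx R)) (g : Cx R -> X),
          holomorphic_trajectory A XH U g -> (forall z, U z -> H (g z) = E) ->
          exists2 L, F L & g @` U `<=` set_val @` L].
Proof.
move=> [hT sc atl] noE.
have noY (y : set_type (H @^-1` [set E])) : False.
  by apply: (noE (set_val y)); apply: (set_valS y).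
split.
  split; [exact: subtype_hausdorff|exact: subtype_second_countable|].
  by apply: slice_complex_atlas => // y; case: (noY y).
exists 0%N, set0; split; last first.
- by move=> U g [_ _ [z Uz] _] h; case: (noE (g z)); apply: h.
- by move=> y; case: (noY y).
- split => [//||L []|y]; last by case: (noY y).
  split => [|L M []|L []].
  by apply/seteqP; split=> y; case: (noY y).
Qed.

Theorem proposition3 (R : realType) (n : nat) (X : topologicalType)
  (A : set (chart R X n)) (Omega : chart R X n -> X -> 'M[Cx R]_n)
  (H : X -> Cx R) (XH : chart R X n -> X -> 'rV[Cx R]_n)
  (XR : chart R X n -> X -> 'rV[R]_n * 'rV[R]_n) (E : Cx R)
  (hsys : holomorphic_hamiltonian_system A Omega H)
  (hXH : hamiltonian_vfield A Omega H XH)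
  (hXR : real_field_of A XH XR)
  (hE : regular_value A H E) :
  let Y := set_type (H @^-1` [set E]) in
  let AY := slice_atlas (leq_pred n) A (H @^-1` [set E]) in
  complex_manifold AY /\
  exists (d : nat) (F : set (set Y)),
    [/\ holomorphic_foliation AY d F,
        forall x0 : Y, exists2 L, F L &
          L x0 /\ set_val @` L = hamiltonian_leaf A XR (set_val x0) &
        forall (U : set (Cx R)) (g : Cx R -> X),
          holomorphic_trajectory A XH U g -> (forall z, U z -> H (g z) = E) ->
          exists2 L, F L & g @` U `<=` set_val @` L].
Proof.
cbv zeta; have [man _ _ _ _] := hsys.
have [[p Hp]|noE] := pselect (exists x, H x = E); last first.
  by apply: empty_level_foliation man _ => x Hx; apply: noE; exists x.
have [c Ac dc] : exists2 c, A c & dom c p by case: man => _ _ [_ _]; apply.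
have [v hv] := hE p c Hp Ac dc 1.
(* A regular point excludes dimensions 0 and 1: in the first there is no nonzero tangent vector, in
   the second a skew form is zero and the Hamiltonian equation forces [dH = 0]. *)
case: n A Omega XH XR hsys hXH hXR hE man c Ac dc v hv => [|[|m]] A Omega XH XR hsys hXH hXR hE man c Ac dc v hv.
- have v0 : v = 0 by apply/rowP => -[].
  by move: hv; rewrite v0 /dfun linear0 => /esym/eqP; rewrite oner_eq0.
- have [_ [anti _ _] _ _ _] := hsys.
  have [_ hamV] := hXH; have := hamV c p Ac dc v; rewrite hv.
  have W0 : Omega c p = 0.
    apply/matrixP => i j; rewrite !ord1 mxE; have := congr1 (fun M : 'M_1 => M 0 0) (anti c p Ac dc).
    by rewrite !mxE => /eqP; rewrite -addr_eq0 -mulr2n mulrn_eq0 => /eqP.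
  rewrite /form_at W0 mulmx0 mul0mx mxE => /eqP.
  by rewrite eq_sym oppr_eq0 oner_eq0.
split; first exact: slice_manifold hsys hXH hE.
exists 1%N, (leaves A XR (E := E) (H := H)); split.
- exact: leaves_foliation hsys hXH hXR hE.
- move=> x0; exists (leaf_of A XR x0); first by exists x0.
  by split; [exact: leaf_refl|exact: leaf_of_image hsys hXH hXR hE x0].
- move=> U g tr gE; have [_ _ [z0 U0] _] := tr.
  have S0 : (H @^-1` [set E]) (g z0) by apply: gE.
  have [y0 ey0] := set_type_of S0.
  exists (leaf_of A XR y0); first by exists y0.
  rewrite (leaf_of_image hsys hXH hXR hE) ey0 => _ [z Uz <-].
  exact: (trajectory_ind hsys hXH hE (@leaf_trans _ _ _ _ _) (plaque_leaf hXR) tr gE U0 Uz).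
Qed.
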